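(* Let $k$ be an algebraically closed field of characteristic $0$. (a) Every smooth cubic surface in $\mathbb P^3$ can be defined by a linear pfaffian. (b) Let $d\ge 1$. A general surface of degree $d$ in $\mathbb P^3$ can be defined by a linear pfaffian if and only if $d\le 15$.
   Context: A surface $S\subset\mathbb P^3$ of degree $d$ ''can be defined by a linear pfaffian'' if there is a skew-symmetric $(2d)\times(2d)$ matrix $M$ whose entries are linear forms in $k[X_0,\dots,X_3]$ such that $S$ is defined by the equation $\operatorname{pf}M=0$. ''A general surface of degree $d$'' means a surface corresponding to a point of some non-empty Zariski open subset of the projective space $|\mathcal O_{\mathbb P^3}(d)|$. *)

(* Defs.v *)
From mathcomp Require Import all_boot all_order all_fingroup all_algebra.
From mathcomp Require Export mpoly.

Set Implicit Arguments.
Unset Strict Implicit.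
Unset Printing Implicit Defensive.

Import GRing.Theory.

Local Open Scope ring_scope.

Section Pfaffian.

Variables (R : comNzRingType) (n : nat).

Lemma ord_even_subproof (i : 'I_n) : (2 * i < 2 * n)%N.
Proof. by rewrite ltn_pmul2l. Qed.

Lemma ord_odd_subproof (i : 'I_n) : ((2 * i).+1 < 2 * n)%N.
Proof. by rewrite !mul2n -doubleS ltn_Sdouble. Qed.

Definition ord_even (i : 'I_n) : 'I_(2 * n) := Ordinal (ord_even_subproof i).
Definition ord_odd (i : 'I_n) : 'I_(2 * n) := Ordinal (ord_odd_subproof i).

(* Each partition of {0, .., 2n-1} into pairs is {{s 0, s 1}, {s 2, s 3}, ..}
   for exactly one permutation s satisfying this predicate. *)
Definition matching_perm (s : 'S_(2 * n)) : bool :=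
  [forall i : 'I_n, s (ord_even i) < s (ord_odd i)]%N
  && [forall i : 'I_n, forall j : 'I_n, (i < j) ==> (s (ord_even i) < s (ord_even j))]%N.

Definition pf (M : 'M[R]_(2 * n)) : R :=
  \sum_(s : 'S_(2 * n) | matching_perm s)
    (-1) ^+ s * \prod_(i < n) M (s (ord_even i)) (s (ord_odd i)).

End Pfaffian.

(* Adequate as skew-symmetry in characteristic <> 2, where it forces the
   diagonal to vanish. *)
Definition skew_symmetric (R : nzRingType) n (M : 'M[R]_n) : Prop := M^T = - M.

Section Surfaces.

Variable k : closedFieldType.

(* A surface of degree d in P^3, i.e. a point of |O_{P^3}(d)|, is given by one
   of its equations. Such an equation is unique up to a nonzero scalar, and all
   the predicates on surfaces below are invariant under rescaling it. *)
Record surface (d : nat) := Surface {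
  surface_form : dhomog 4 k d;
  surface_form_neq0 : surface_form != 0
}.

Definition equation d (S : surface d) : {mpoly k[4]} := val (surface_form S).

(* Smoothness at every point of P^3(k) lying on S, by the Jacobian criterion. *)
Definition smooth d (S : surface d) : Prop :=
  forall x : 'I_4 -> k, (exists i, x i != 0) -> (equation S).@[x] = 0 ->
    exists i, (equation S)^`M(i).@[x] != 0.

(* S is the subscheme (equivalently, the divisor) f = 0 of P^3. *)
Definition defined_by d (S : surface d) (f : {mpoly k[4]}) : Prop :=
  exists2 c : k, c != 0 & equation S = c *: f.

Definition linear_pfaffian d (S : surface d) : Prop :=
  exists M : 'M[{mpoly k[4]}]_(2 * d),
    [/\ skew_symmetric M, forall i j, M i j \is 1.-homog & defined_by S (pf M)].

Definition monomial (d : nat) : finType :=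
  {m : 'X_{1..4 < d.+1} | mdeg m == d}.

(* Homogeneous coordinates on |O_{P^3}(d)|: the coefficients of the equation. *)
Definition coords d (S : surface d) (i : 'I_#|monomial d|) : k :=
  (equation S)@_(val (enum_val i)).

Definition zariski_open d (U : surface d -> Prop) : Prop :=
  exists G : {mpoly k[#|monomial d|]} -> Prop,
    (forall g, G g -> g \is homog mdeg) /\
    (forall S, U S <-> exists2 g, G g & g.@[coords S] != 0).

Definition for_general_surface d (P : surface d -> Prop) : Prop :=
  exists U : surface d -> Prop,
    [/\ zariski_open U, (exists S, U S) & (forall S, U S -> P S)].

End Surfaces.

(* Main.v *)
Require Import Defs.
From HB Require Import structures.
From mathcomp Require Import all_boot all_order all_fingroup all_algebra.
From mathcomp Require Import mpoly ssrcomplements.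
From mathcomp Require Import zify ring.
From Stdlib Require Import Classical FunctionalExtensionality.

(** Everything rests on one property of the pfaffian, [pf_congr]: pf (P M P^T) =
    det P * pf M. The alternating sum of the matching products over all
    permutations, not only those listing a perfect matching, satisfies this
    identity by the argument that proves multiplicativity of determinants, and
    that sum is 2^n n! times the pfaffian.

    Part (a). A smooth cubic surface F = 0 contains no plane, since otherwise it
    would be singular along a conic of that plane ([smooth_plane_section]). Hence the
    surface has points off any finite set of planes ([zero_off_planes]), and
    five of its points can be moved to the vertices of the coordinate
    tetrahedron and (1,1,1,1) ([five_points]). A cubic through these points is a
    combination with linear coefficients y_t of the five quadrics X_i X_j - X_0 X_1
    ([cubic_five_quadrics]). Up to sign these quadrics are the 4 x 4 pfaffians of a
    linear skew 5 x 5 matrix, and bordering that matrix by the y_t gives a 6 x 6 matrix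
    with pfaffian F ([pf_border_mx]).

    Part (b), d <= 15. The coefficients of pf M are polynomials in the entries of
    M. A polynomial map from an affine space to itself whose Jacobian determinant
    is not zero has an image containing a nonempty open set
    ([jacobian_open_image]), so it is enough to find one M for which the products
    X_k P_ij span the forms of degree d, where the P_ij are the partial derivatives of
    the pfaffian with respect to the entries. The witness is an integer matrix and the rank is
    computed modulo 2. The P_ij form, up to sign, the adjoint of M, so that
    M P = pf M ([pf_adjoint]), and M starts with X_0 J, where J is its own inverse
    modulo 2. Put X_0 = 1 and expand P = pf M * M^-1 as a geometric series: a
    linear form on forms of degree d that kills all X_k P_ij turns into a
    solution theta of an explicit linear system ([U_unroll]), where theta takes
    the values of the form on the multiples of pf M. No pfaffian has to be
    expanded. The system has only the zero solution ([check_sound],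
    [check_le15]), and theta = 0 forces the form to vanish ([psi0]).

    Part (b), d >= 16. Let M = X_0 M_0 + .. + X_3 M_3 be generic, T = M_0^-1 M_1,
    e an eigenvector of M_0^-1 M_2 and f = M_0^-1 M_3 e. In the basis e, f, T e,
    T f, T^2 e, .. the forms M_0 and M_1 become Hankel matrices with 2d
    parameters, M_2 is a multiple of M_0 up to a form with kernel containing e,
    and the first row of M_3 is the second row of M_0, up to a scalar
    ([krylov_slice]). There remain 4d^2 - 4d + 4 parameters, fewer than the
    binomial coefficient C(d+3, 3) ([slice_count]). So the coefficients of pf M
    satisfy a nontrivial polynomial relation on these normal forms
    ([slice_relation]). By [pf_congr] the relation holds for all tuples admitting
    such a basis, and it extends to all skew tuples along lines
    ([vanishes_skew]). A relation among the coefficients contradicts that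
    pfaffians form a dense set. *)

Set Implicit Arguments.
Unset Strict Implicit.
Unset Printing Implicit Defensive.

Import GRing.Theory.
Local Open Scope ring_scope.

(** * Pfaffians and congruence *)

Section Pairs.
Variable n : nat.
Implicit Types (i : 'I_n) (b : bool) (x : 'I_(2 * n)).

Definition ord_pair i b : 'I_(2 * n) := if b then ord_odd i else ord_even i.

Lemma ord_half_subproof x : (x./2 < n)%N.
Proof. case: x => x /= hx; lia. Qed.
Definition ord_half x : 'I_n := Ordinal (ord_half_subproof x).

Lemma val_ord_pair i b : ord_pair i b = (2 * i + b)%N :> nat.
Proof. by case: b; rewrite /= ?addn1 ?addn0. Qed.

Lemma ord_pairK x : ord_pair (ord_half x) (odd x) = x.
Proof. by apply: val_inj; rewrite /= val_ord_pair mul2n addnC odd_double_half. Qed.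

Lemma ord_half_pair i b : ord_half (ord_pair i b) = i.
Proof. by apply: val_inj; case: b => /=; lia. Qed.

Lemma odd_ord_pair i b : odd (ord_pair i b) = b.
Proof. by rewrite val_ord_pair; case: b => /=; lia. Qed.

Lemma ord_pair_inj i b i' b' : ord_pair i b = ord_pair i' b' -> (i, b) = (i', b').
Proof.
move=> e; have := ord_half_pair i b; have := odd_ord_pair i b.
by rewrite e ord_half_pair odd_ord_pair => -> ->.
Qed.

(** The indices 2i and 2i+1 are treated as the two halves of the pair i; this is
    how products over all rows are matched with the products in [pf]. *)
Lemma big_ord_pair (R : Type) (idx : R) (op : Monoid.com_law idx) (G : 'I_(2 * n) -> R) :
  \big[op/idx]_x G x = \big[op/idx]_(i < n) op (G (ord_even i)) (G (ord_odd i)).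
Proof.
rewrite (reindex (fun p : 'I_n * bool => ord_pair p.1 p.2)) /=; last first.
  exists (fun x => (ord_half x, odd x)) => [[i b] _ | x _] /=.
    by rewrite ord_half_pair odd_ord_pair.
  exact: ord_pairK.
rewrite -(pair_bigA_idem _ (fun i b => G (ord_pair i b))) /=; last by rewrite Monoid.mul1m.
by apply: eq_bigr => i _; rewrite big_bool /= Monoid.mulmC.
Qed.
End Pairs.

Section PermSum.
Variables (R : comNzRingType) (n : nat).
Implicit Types (M P : 'M[R]_(2 * n)) (s : 'S_(2 * n)).

Definition pf_term M s := (-1) ^+ s * \prod_(i < n) M (s (ord_even i)) (s (ord_odd i)).
(** The pfaffian sum without the normalization that picks one permutation per
    matching. Symmetry under all permutations makes it easy to transform. *)
Definition pf_all M := \sum_s pf_term M s.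

(** Expanding every entry of P M P^T writes the left side as a sum, over functions
    f from rows to rows, of a matching product of M along f times the determinant of the matrix
    with columns P_(f x). That determinant is det P times the determinant of the
    matrix of f, which vanishes unless f is a permutation, as in the
    Cauchy-Binet formula. *)
Lemma pf_all_congr P M : pf_all (P *m M *m P^T) = \det P * pf_all M.
Proof.
pose T := ('I_(2 * n) * 'I_(2 * n))%type.
pose pr (f : {ffun 'I_(2 * n) -> 'I_(2 * n)}) : {ffun 'I_n -> T} :=
  [ffun i => (f (ord_even i), f (ord_odd i))].
pose delta (f : {ffun 'I_(2 * n) -> 'I_(2 * n)}) : 'M[R]_(2 * n) := \matrix_(a, x) (a == f x)%:R.
have expand s : pf_term (P *m M *m P^T) s =
    \sum_(f : {ffun 'I_(2 * n) -> 'I_(2 * n)}) (\prod_(i < n) M (f (ord_even i)) (f (ord_odd i))) *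
       ((-1) ^+ s * \prod_x (P *m delta f) (s x) x).
  rewrite /pf_term.
  under eq_bigr => i _.
    have -> : (P *m M *m P^T) (s (ord_even i)) (s (ord_odd i)) =
       \sum_(ab : T) P (s (ord_even i)) ab.1 * M ab.1 ab.2 * P (s (ord_odd i)) ab.2.
      rewrite mxE -(pair_bigA _ (fun a b => P (s (ord_even i)) a * M a b * P (s (ord_odd i)) b)) /=.
      rewrite exchange_big; apply: eq_bigr => b _; rewrite !mxE big_distrl.
      by apply: eq_bigr => a _.
    over.
  rewrite bigA_distr_bigA mulr_sumr.
  rewrite (reindex pr) /=; last first.
    exists (fun g : {ffun 'I_n -> T} =>
        [ffun x : 'I_(2 * n) => if odd x then (g (ord_half x)).2 else (g (ord_half x)).1]).
      move=> f _; apply/ffunP => x; rewrite !ffunE /=.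
      by rewrite -[in RHS](ord_pairK x); case: (odd x).
    move=> g _; apply/ffunP => i; rewrite !ffunE.
    have := odd_ord_pair i true; have := odd_ord_pair i false => /= -> ->.
    have := ord_half_pair i true; have := ord_half_pair i false => /= -> ->.
    by case: (g i).
  apply: eq_bigr => f _; rewrite mulrCA; congr (_ * _).
  rewrite (big_ord_pair _ (fun x => (P *m delta f) (s x) x)) -big_split /=.
  apply: eq_bigr => i _; rewrite ffunE /=.
  have deltaE y x : (P *m delta f) y x = P y (f x).
    rewrite mxE (bigD1 (f x)) //= big1 ?addr0 ?mxE ?eqxx ?mulr1 // => a.
    by rewrite mxE => /negbTE ->; rewrite mulr0.
  by rewrite !deltaE; ring.
rewrite /pf_all; under eq_bigr => s _ do rewrite expand.
rewrite exchange_big /=.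
under eq_bigr => f _.
  rewrite -mulr_sumr.
  have -> : \sum_(s : 'S_(2 * n)) (-1) ^+ s * \prod_x (P *m delta f) (s x) x = \det P * \det (delta f).
    rewrite -det_mulmx -det_tr; apply: eq_bigr => s _.
    by congr (_ * _); apply: eq_bigr => x _; rewrite [RHS]mxE.
  rewrite mulrCA; over.
rewrite -mulr_sumr; congr (_ * _).
rewrite (bigID (fun f : {ffun 'I_(2 * n) -> 'I_(2 * n)} => injectiveb f)) /= [X in _ + X]big1 ?addr0; last first.
  move=> f /injectivePn [x [y neq_xy fxy]].
  rewrite -det_tr (determinant_alternate neq_xy) ?mulr0 // => a.
  by rewrite !mxE fxy.
rewrite (reindex (fun s : 'S_(2 * n) => pval s)) /=; last first.
  have s0 : 'S_(2 * n) := 1%g.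
  exists (fun f => insubd s0 f) => [s _|f inj_f]; first by rewrite valKd.
  by rewrite insubdK.
apply: eq_big => [s|s _]; first by rewrite (valP s).
rewrite /pf_term mulrC; congr (_ * _).
  have -> : delta (pval s) = (perm_mx s)^T.
    by apply/matrixP => a x; rewrite !mxE !pvalE eq_sym.
  by rewrite det_tr det_perm.
by apply: eq_bigr => i _; rewrite !pvalE.
Qed.
End PermSum.

Section Rank.
Variables (n : nat) (v : 'I_n -> nat).
Hypothesis v_inj : injective v.

Lemma rank_subproof i : (#|[set j | v j < v i]| < n)%N.
Proof.
rewrite -[X in (_ < X)%N]card_ord -cardsT; apply: proper_card.
by apply/properP; split; [exact/subsetP | exists i; rewrite !inE ?ltnn].
Qed.
Definition rank i : 'I_n := Ordinal (rank_subproof i).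

Lemma ltn_rank i j : (rank i < rank j)%N = (v i < v j)%N.
Proof.
have mono a b : (v a < v b)%N -> (rank a < rank b)%N.
  move=> ab; apply: proper_card; apply/properP; split.
    by apply/subsetP => x; rewrite !inE => /ltn_trans; apply.
  by exists a; rewrite !inE ?ltnn.
case: (ltngtP (v i) (v j)) => [/mono -> // | /mono ji | /v_inj ->]; last by rewrite ltnn.
by rewrite ltnNge ltnW.
Qed.

Lemma rank_inj : injective rank.
Proof.
move=> i j eqr.
by case: (ltngtP (v i) (v j)) => [|| /v_inj //]; rewrite -ltn_rank eqr ltnn.
Qed.
(** Sorts the pairs of a matching by their smaller elements. *)
Definition rank_perm : 'S_n := perm rank_inj.
End Rank.

Section PairGroup.
Variable n : nat.
Implicit Types (s m : 'S_(2 * n)) (q : 'S_n) (b : {ffun 'I_n -> bool}).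

Definition swap_pair (i : 'I_n) : 'S_(2 * n) := tperm (ord_even i) (ord_odd i).
Definition flips b : 'S_(2 * n) := (\prod_(i | b i) swap_pair i)%g.

Lemma swap_pairE i j c : swap_pair i (ord_pair j c) = ord_pair j (c (+) (i == j)).
Proof.
rewrite /swap_pair; case: eqP => [-> | ne].
  by case: c => /=; rewrite ?tpermL ?tpermR.
rewrite addbF tpermD //; apply/eqP => e.
  by have [] := @ord_pair_inj _ i false j c e.
by have [] := @ord_pair_inj _ i true j c e.
Qed.

Lemma flipsE b i c : flips b (ord_pair i c) = ord_pair i (c (+) b i).
Proof.
rewrite /flips -big_filter.
have /= : forall r : seq 'I_n, uniq r ->
    (\prod_(j <- r) swap_pair j)%g (ord_pair i c) = ord_pair i (c (+) (i \in r)).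
  elim=> [_|j r IH /= /andP [jr ur]]; first by rewrite big_nil perm1 addbF.
  rewrite big_cons permM swap_pairE inE eq_sym.
  case: (eqVneq i j) => [-> | ne] /=; last by rewrite addbF IH.
  rewrite (eq_bigr (fun j => swap_pair j)) // addbT.
  elim: (r) (jr) => [|l r' IHr]; first by rewrite big_nil perm1.
  rewrite inE negb_or => /andP [jl jr']; rewrite big_cons permM swap_pairE.
  by rewrite eq_sym (negbTE jl) addbF IHr.
by move=> -> ; rewrite ?filter_uniq ?index_enum_uniq // mem_filter mem_index_enum andbT.
Qed.

Definition pairs_fun q (x : 'I_(2 * n)) := ord_pair (q (ord_half x)) (odd x).
Lemma pairs_fun_inj q : injective (pairs_fun q).
Proof.
move=> x y /ord_pair_inj [/perm_inj hxy oxy].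
by rewrite -(ord_pairK x) -(ord_pairK y) hxy oxy.
Qed.
Definition pairs_perm q : 'S_(2 * n) := perm (@pairs_fun_inj q).

Lemma pairs_permE q i c : pairs_perm q (ord_pair i c) = ord_pair (q i) c.
Proof. by rewrite permE /pairs_fun ord_half_pair odd_ord_pair. Qed.

Lemma perm_pairP s s' : (forall i c, s (ord_pair i c) = s' (ord_pair i c)) -> s = s'.
Proof. by move=> e; apply/permP => x; rewrite -(ord_pairK x). Qed.

Lemma pairs_permM : {morph pairs_perm : q q' / (q * q')%g}.
Proof. by move=> q q'; apply: perm_pairP => i c; rewrite permM !pairs_permE permM. Qed.

Lemma pairs_perm1 : pairs_perm 1%g = 1%g.
Proof. by apply: perm_pairP => i c; rewrite pairs_permE !perm1. Qed.

Lemma pairs_perm_tperm i j : i != j ->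
  pairs_perm (tperm i j) = (tperm (ord_even i) (ord_even j) * tperm (ord_odd i) (ord_odd j))%g.
Proof.
move=> ne; apply: perm_pairP => l c; rewrite permM pairs_permE.
have neq (a a' : 'I_n) d e : a != a' -> ord_pair a d != ord_pair a' e.
  by apply: contra_neq => /ord_pair_inj [].
have neqb (a a' : 'I_n) d e : d != e -> ord_pair a d != ord_pair a' e.
  by apply: contra_neq => /ord_pair_inj [].
rewrite -[ord_even i]/(ord_pair i false) -[ord_even j]/(ord_pair j false).
rewrite -[ord_odd i]/(ord_pair i true) -[ord_odd j]/(ord_pair j true).
case: tpermP => [-> | -> | /eqP li /eqP lj].
- case: c; first by rewrite [tperm _ _ (ord_pair i true)]tpermD ?neqb ?tpermL.
  by rewrite tpermL tpermD // neqb.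
- case: c; first by rewrite [tperm _ _ (ord_pair j true)]tpermD ?neqb ?tpermR.
  by rewrite tpermR tpermD // neqb.
by rewrite !tpermD // neq // eq_sym.
Qed.

(** The group of order 2^n n! that permutes the pairs and flips inside each pair.
    It acts freely on permutations, and every orbit contains exactly one [matching_perm]. *)
Definition pair_move q b : 'S_(2 * n) := (flips b * pairs_perm q)%g.

Lemma pair_moveE q b i c : pair_move q b (ord_pair i c) = ord_pair (q i) (c (+) b i).
Proof. by rewrite permM flipsE pairs_permE. Qed.

Definition flip_of s : {ffun 'I_n -> bool} := [ffun i => (s (ord_odd i) < s (ord_even i))%N].
Definition first_of s i : nat := s (ord_pair i (flip_of s i)).

Lemma first_of_inj s : injective (first_of s).
Proof. by move=> i j /val_inj /perm_inj /ord_pair_inj []. Qed.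

Definition order_of s := rank_perm (@first_of_inj s).
(** The [matching_perm] in the orbit of [s]: flip every pair that is out of order,
    then sort the pairs. *)
Definition matching_of s : 'S_(2 * n) := ((pair_move (order_of s) (flip_of s))^-1 * s)%g.

Lemma matching_ofE s i c :
  matching_of s (ord_pair (order_of s i) c) = s (ord_pair i (c (+) flip_of s i)).
Proof.
rewrite /matching_of permM; congr (s _).
by apply: (canLR (permK _)); rewrite pair_moveE -addbA addbb addbF.
Qed.

Lemma matching_ofP s : matching_perm (matching_of s).
Proof.
have mE i c := matching_ofE s (((order_of s)^-1%g : 'S_n) i) c.
apply/andP; split; apply/forallP => i.
  have /= := mE i false; have /= := mE i true; rewrite permKV => -> ->.
  set j := (_ : 'S_n) i; rewrite /= !ffunE.
  case: (ltngtP (s (ord_odd j)) (s (ord_even j))) => //= /val_inj/perm_inj e.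
  by have := @ord_pair_inj _ j true j false e.
apply/forallP => j; apply/implyP => ij.
have /= := mE i false; have /= := mE j false; rewrite !permKV => -> ->.
rewrite -![nat_of_ord _]/(first_of s _) -(ltn_rank (@first_of_inj s)).
by rewrite -!(permE (@rank_inj _ _ (@first_of_inj s))) !permKV.
Qed.

(** The flips and the order of pairs can be read off the permutation, which
    is the freeness of the action. *)
Lemma pair_moveK m q b : matching_perm m ->
  let s := (pair_move q b * m)%g in flip_of s = b /\ order_of s = q.
Proof.
move=> /andP [/forallP eo /forallP ee] s.
have sE i c : s (ord_pair i c) = m (ord_pair (q i) (c (+) b i)) by rewrite permM pair_moveE.
have fb : flip_of s = b.
  apply/ffunP => i; rewrite ffunE.
  rewrite -[ord_even i]/(ord_pair i false) -[ord_odd i]/(ord_pair i true) !sE.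
  have := eo (q i); case: (b i) => //=.
  by move/ltnW; rewrite leqNgt => /negbTE.
split=> //; apply/permP => i; rewrite permE; apply: val_inj => /=.
have fE j : first_of s j = m (ord_even (q j)) by rewrite /first_of sE fb addbb.
have ltE j l : (m (ord_even j) < m (ord_even l))%N = (j < l)%N.
  have up (a c : 'I_n) : (a < c)%N -> (m (ord_even a) < m (ord_even c))%N.
    by move=> ac; move: (ee a) => /forallP /(_ c) /implyP; apply.
  case: (ltngtP j l) => [/up // | /up /ltnW | /val_inj ->]; last by rewrite ltnn.
  by rewrite leqNgt => /negbTE.
under eq_finset => j do rewrite !fE ltE.
transitivity #|[set l : 'I_n | (l < q i)%N]|.
  rewrite -[in RHS](card_preimset _ (@perm_inj _ q)).
  by apply: eq_card => j; rewrite !inE.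
rewrite cardsE -sum1_card (big_ord_narrow (ltnW (ltn_ord (q i)))).
by rewrite sum_nat_const card_ord muln1.
Qed.

(** Each orbit is parametrized by its [matching_perm] and a group element. *)
Lemma reindex_matching (V : nmodType) (G : 'S_(2 * n) -> V) :
  \sum_s G s = \sum_(t : 'S_(2 * n) * ('S_n * {ffun 'I_n -> bool}) | matching_perm t.1)
                 G (pair_move t.2.1 t.2.2 * t.1)%g.
Proof.
rewrite (reindex_onto (fun t : 'S_(2 * n) * ('S_n * {ffun 'I_n -> bool}) =>
            (pair_move t.2.1 t.2.2 * t.1)%g)
   (fun s => (matching_of s, (order_of s, flip_of s)))) /=; last first.
  by move=> s _; rewrite /matching_of mulKVg.
apply: eq_bigl => -[m [q b]] /=; apply/eqP/idP => [[<- _ _]|mm].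
  exact: matching_ofP.
have [fb oq] := pair_moveK q b mm.
by rewrite /matching_of fb oq mulKg.
Qed.

Section Terms.
Variable R : comNzRingType.
Variable M : 'M[R]_(2 * n).
Hypothesis skewM : forall i j, M i j = - M j i.

Lemma pf_term_swap_pair i s : pf_term M (swap_pair i * s)%g = pf_term M s.
Proof.
have neq : ord_even i != ord_odd i.
  by apply/eqP => /(@ord_pair_inj _ i false i true).
rewrite /pf_term odd_permM odd_tperm neq signr_addb expr1 (bigD1 i) //=.
rewrite [in RHS](bigD1 i) //= !permM.
rewrite (swap_pairE i i false) (swap_pairE i i true) eqxx /= skewM.
rewrite -mulrA mulN1r mulNr mulrN opprK; congr (_ * (_ * _)).
apply: eq_bigr => j ji; rewrite !permM.
by rewrite (swap_pairE i j false) (swap_pairE i j true) eq_sym (negbTE ji).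
Qed.

Lemma pf_term_pairs_tperm i j s : pf_term M (pairs_perm (tperm i j) * s)%g = pf_term M s.
Proof.
case: (eqVneq i j) => [-> | ne]; first by rewrite tperm1 pairs_perm1 mul1g.
have ne2 c : ord_pair i c != ord_pair j c.
  by apply: contra_neq ne => /ord_pair_inj [].
rewrite /pf_term; congr (_ * _).
  rewrite pairs_perm_tperm // !odd_permM !odd_tperm.
  by have /= -> := ne2 false.
rewrite (reindex_inj (@perm_inj _ (tperm i j))) /=; apply: eq_bigr => l _; rewrite !permM.
by rewrite (pairs_permE _ _ false) (pairs_permE _ _ true) tpermK.
Qed.

(** A flip changes the sign of the permutation and, by skew-symmetry, of one entry;
    exchanging two pairs is an even permutation that permutes the factors. *)
Lemma pf_term_pair_move q b s : pf_term M (pair_move q b * s)%g = pf_term M s.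
Proof.
rewrite /pair_move -mulgA.
have -> s' : pf_term M (flips b * s')%g = pf_term M s'.
  rewrite /flips; elim/big_rec: _ => [|i h _ IH]; first by rewrite mul1g.
  by rewrite -mulgA pf_term_swap_pair.
have [ts -> _] := prod_tpermP q; elim: ts => [|t ts IH].
  by rewrite big_nil pairs_perm1 mul1g.
by rewrite big_cons pairs_permM -mulgA pf_term_pairs_tperm.
Qed.

Lemma pf_allE : pf_all M = pf M *+ (n`! * 2 ^ n).
Proof.
rewrite /pf_all reindex_matching.
rewrite (eq_bigl (fun t => matching_perm t.1 && xpredT t.2)); last by move=> t; rewrite andbT.
rewrite -(pair_big (fun m => matching_perm m) xpredT (fun m t => pf_term M (pair_move t.1 t.2 * m)%g)) /=.
rewrite /pf -sumrMnl; apply: eq_bigr => m _.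
under eq_bigr => t _ do rewrite pf_term_pair_move.
by rewrite sumr_const card_prod card_Sn card_ffun card_bool card_ord.
Qed.
End Terms.
End PairGroup.

Section Congruence.
Variable R : idomainType.
Hypothesis charR : [pchar R] =i pred0.
Variable n : nat.
Implicit Types M P : 'M[R]_(2 * n).

Lemma skewE m (M : 'M[R]_m) : skew_symmetric M <-> forall i j, M i j = - M j i.
Proof.
split=> [sM i j | sM]; last by apply/matrixP => i j; rewrite !mxE.
by have /matrixP /(_ j i) := sM; rewrite !mxE.
Qed.

Lemma skew_congr m p (P : 'M[R]_(m, p)) (M : 'M[R]_p) :
  skew_symmetric M -> skew_symmetric (P *m M *m P^T).
Proof. by move=> sM; rewrite /skew_symmetric !trmx_mul trmxK sM mulNmx mulmxN mulmxA. Qed.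

(** Divide [pf_all_congr] by 2^n n!, which is where characteristic 0 enters. *)
Lemma pf_congr P M : skew_symmetric M -> pf (P *m M *m P^T) = \det P * pf M.
Proof.
move=> sM; have := pf_all_congr P M.
rewrite !pf_allE; [|exact/skewE|exact/skewE/skew_congr].
rewrite mulrnAr -[LHS]mulr_natl -[RHS]mulr_natl; apply: mulfI.
move/pcharf0P: charR => ->.
by rewrite -lt0n muln_gt0 fact_gt0 expn_gt0.
Qed.
End Congruence.

Section PfMap.
Variables (R S : comNzRingType) (f : {rmorphism R -> S}) (n : nat).
Lemma pf_map (M : 'M[R]_(2 * n)) : pf (map_mx f M) = f (pf M).
Proof.
rewrite rmorph_sum; apply: eq_bigr => s _.
rewrite rmorphM rmorphXn rmorphN1 rmorph_prod; congr (_ * _).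
by apply: eq_bigr => i _; rewrite mxE.
Qed.
End PfMap.

Section Dpf.
Variables (R : comNzRingType) (n : nat).
Implicit Types M E : 'M[R]_(2 * n).

(** The differential of [pf] at [M] in the direction [E]. *)
Definition dpf M E : R :=
  \sum_(s : 'S_(2 * n) | matching_perm s) (-1) ^+ s *
    \sum_(i < n) E (s (ord_even i)) (s (ord_odd i)) *
                 \prod_(j < n | j != i) M (s (ord_even j)) (s (ord_odd j)).

Lemma dpf_linear M : scalar (dpf M).
Proof.
move=> a E E'; rewrite /dpf [a * _]mulr_sumr -big_split; apply: eq_bigr => s _ /=.
rewrite [a * _]mulrCA -mulrDr; congr (_ * _).
rewrite mulr_sumr -big_split /=; apply: eq_bigr => i _.
by rewrite !mxE mulrDl mulrA.
Qed.
HB.instance Definition _ M :=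
  GRing.isLinear.Build R 'M[R]_(2 * n) R _ (dpf M) (@dpf_linear M).

Section Derivation.
Variable D : {additive R -> R}.
Hypothesis D_mul : forall a b, D (a * b) = D a * b + a * D b.

Lemma derivation_prod (I : finType) (a : I -> R) :
  D (\prod_i a i) = \sum_i D (a i) * \prod_(j | j != i) a j.
Proof.
have D1 : D 1 = 0.
  by have /eqP := D_mul 1 1; rewrite !mul1r mulr1 -subr_eq subrr eq_sym => /eqP.
have : uniq (index_enum I) by apply: index_enum_uniq.
elim: (index_enum I) => [_|x r IH /= /andP [xr ur]]; first by rewrite !big_nil.
rewrite !big_cons D_mul IH // eqxx mulr_sumr; congr (_ * _ + _).
  rewrite big_seq [RHS]big_seq_cond; apply: eq_bigl => j.
  by case: (boolP (j \in r)) => //= jr; apply/esym; apply: contraNneq xr => <-.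
rewrite big_seq [RHS]big_seq; apply: eq_bigr => i ir; rewrite big_cons.
have -> : x != i by apply: contraNneq xr => ->.
by rewrite mulrCA.
Qed.

(** The chain rule; it serves both for the parameter of a one-parameter family and
    for the partial derivatives of a family with several parameters. *)
Lemma derivation_pf M : D (pf M) = dpf M (map_mx D M).
Proof.
rewrite /pf raddf_sum; apply: eq_bigr => s _.
rewrite mulr_sign (fun_if D) raddfN derivation_prod -mulr_sign; congr (_ * _).
by apply: eq_bigr => i _; rewrite mxE.
Qed.
End Derivation.
End Dpf.

Lemma dpf_map (R S : comNzRingType) (f : {rmorphism R -> S}) n (M E : 'M[R]_(2 * n)) :
  dpf (map_mx f M) (map_mx f E) = f (dpf M E).
Proof.
rewrite rmorph_sum; apply: eq_bigr => s _.
rewrite rmorphM rmorphXn rmorphN1 rmorph_sum; congr (_ * _); apply: eq_bigr => i _.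
by rewrite rmorphM rmorph_prod mxE; congr (_ * _); apply: eq_bigr => j _; rewrite mxE.
Qed.

Definition skew_unit (R : nzRingType) m (l j : 'I_m) : 'M[R]_m := delta_mx l j - delta_mx j l.

Section Adjoint.
Variable R : idomainType.
Hypothesis charR : [pchar R] =i pred0.
Variable n : nat.
Implicit Types M : 'M[R]_(2 * n).

(** Differentiate pf (P M P^T) = det P * pf M along P = 1 + t E_li at t = 0. *)
Lemma dpf_transvection M i l : skew_symmetric M ->
  dpf M (delta_mx l i *m M + M *m delta_mx i l) = (l == i)%:R * pf M.
Proof.
move=> sM; pose MX := map_mx polyC M.
have sMX : skew_symmetric MX.
  by apply/skewE => a b; rewrite !mxE; have /skewE -> := sM; rewrite raddfN.
pose P : 'M[{poly R}]_(2 * n) := 1%:M + 'X *: delta_mx l i.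
have charX : [pchar {poly R}] =i pred0.
  by move=> p; rewrite pchar_poly charR.
have := pf_congr charX P sMX.
have -> : \det P = 1 + (l == i)%:R * 'X.
  pose B : 'M[{poly R}]_(2 * n) := \matrix_(a, b) (if a == l then b == i else b == a)%:R.
  rewrite (@determinant_multilinear _ _ P 1%:M B l 1 'X).
  - rewrite det1 mul1r ['X * _]mulrC; congr (_ + _ * _).
    case: (eqVneq l i) => [li|li].
      rewrite -[RHS](det1 _ (2 * n)); congr (\det _); apply/matrixP => a b.
      by rewrite !mxE -li; case: (eqVneq a l) => [->|_]; rewrite eq_sym.
    apply: (determinant_alternate li) => b.
    by rewrite !mxE eqxx [i == l]eq_sym (negbTE li).
  - by apply/rowP => b; rewrite !mxE eqxx mul1r /= [_ == i]eq_sym.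
  - apply/matrixP => a b; rewrite !mxE [_ == l]eq_sym.
    by rewrite (negbTE (neq_lift _ _)) /= mulr0 addr0.
  - apply/matrixP => a b; rewrite !mxE [_ == l]eq_sym (negbTE (neq_lift _ _)).
    by rewrite mulr0 addr0 eq_sym.
pose D : {additive {poly R} -> {poly R}} := @deriv R.
have DM a b : D (a * b) = D a * b + a * D b by apply: derivM.
move/(congr1 D); rewrite (derivation_pf DM).
move/(congr1 (horner_eval 0)); rewrite -dpf_map.
have -> : map_mx (horner_eval 0) (P *m MX *m P^T) = M.
  have -> : P *m MX *m P^T = MX + 'X *: (P *m MX *m delta_mx i l + delta_mx l i *m MX).
    rewrite /P linearD /= trmx1 linearZ /= trmx_delta mulmxDr mulmx1 -scalemxAr.
    by rewrite mulmxDl mul1mx -scalemxAl addrAC -addrA -scalerDr.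
  by apply/matrixP => a b; rewrite !mxE /horner_eval !hornerE.
have -> : map_mx (horner_eval 0) (map_mx D (P *m MX *m P^T)) =
    delta_mx l i *m M + M *m delta_mx i l.
  have -> : P *m MX *m P^T =
      MX + 'X *: map_mx polyC (delta_mx l i *m M + M *m delta_mx i l)
         + 'X ^+ 2 *: map_mx polyC (delta_mx l i *m M *m delta_mx i l).
    rewrite map_mxD !map_mxM /= !map_delta_mx -/MX.
    rewrite /P linearD /= trmx1 linearZ /= trmx_delta mulmxDr mulmx1 -scalemxAr.
    rewrite mulmxDl mul1mx -scalemxAl mulmxDl -scalemxAl scalerDr scalerA -expr2.
    by rewrite scalerDr !addrA.
  apply/matrixP => a b; rewrite !mxE /= /horner_eval.
  by rewrite !derivE !hornerE /= !addr0.
move=> ->.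
rewrite pf_map DM /horner_eval !hornerE /D /= !derivE !hornerE.
by case: (l == i); rewrite !hornerE.
Qed.

(** The partial derivatives of the pfaffian form an adjoint matrix of M, a version
    of Cramer's rule obtained from the infinitesimal transvections. *)
Lemma pf_adjoint M : skew_symmetric M ->
  M *m (\matrix_(j, l) dpf M (skew_unit R l j)) = (pf M)%:M.
Proof.
move=> sM; have /skewE sME := sM; apply/matrixP => i l; rewrite !mxE [i == l]eq_sym -mulr_natl.
rewrite -dpf_transvection // (_ : _ + _ = \sum_j M i j *: skew_unit R l j).
  by rewrite linear_sum; apply: eq_bigr => j _; rewrite linearZ mxE.
apply/matrixP => a b; rewrite !mxE summxE.
under [in RHS]eq_bigr => j _ do rewrite !mxE mulrBr.
rewrite sumrB (bigD1 i) //= big1 ?addr0 => [|j ji]; last first.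
  by rewrite mxE (negbTE ji) andbF mul0r.
rewrite (bigD1 i) //= big1 ?addr0 => [|j ji]; last first.
  by rewrite mxE (negbTE ji) mulr0.
rewrite (bigD1 b) //= big1 ?addr0 => [|j jb]; last first.
  by rewrite [b == j]eq_sym (negbTE jb) andbF mulr0.
rewrite [X in _ = _ - X](bigD1 a) //= big1 ?addr0 => [|j ja]; last first.
  by rewrite [a == j]eq_sym (negbTE ja) mulr0.
by rewrite !mxE !eqxx !andbT /= [M a i]sME; ring.
Qed.
End Adjoint.

(** * Polynomials and algebraic dependence *)

Section Char0.
Variable k : fieldType.
Hypothesis char0 : [pchar k] =i pred0.

Lemma natr_inj : injective (fun n : nat => n%:R : k).
Proof.
move=> m n; wlog le_mn : m n / (m <= n)%N => [H e|].
  by case/orP: (leq_total m n) => /H; [apply|move=> /(_ (esym e))].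
move/eqP; rewrite eq_sym -subr_eq0 -natrB //; have /pcharf0P -> := char0.
by rewrite subn_eq0 => le_nm; apply/eqP; rewrite eqn_leq le_mn.
Qed.

Lemma exists_nonroot (p : {poly k}) : p != 0 -> exists x, p.[x] != 0.
Proof.
move=> p0; pose rs := [seq n%:R : k | n <- iota 0 (size p)].
have : ~~ all (root p) rs.
  apply/negP => /max_poly_roots - /(_ p0).
  rewrite map_inj_uniq ?iota_uniq ?size_map ?size_iota ?ltnn; first by move/(_ isT).
  exact: natr_inj.
by case/allPn => x _ px; exists x.
Qed.

Lemma poly_eq0_of_eval (p : {poly k}) : (forall x, p.[x] = 0) -> p = 0.
Proof.
move=> p0; apply/eqP; apply/negPn/negP => /exists_nonroot [x].
by rewrite p0 eqxx.
Qed.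

(** Base B representations are unique; used to substitute powers x^(B^i) for the
    variables without merging monomials. *)
Lemma base_repr_inj B n (a b : nat -> nat) :
  (forall i, (i < n)%N -> (a i < B)%N) -> (forall i, (i < n)%N -> (b i < B)%N) ->
  (\sum_(i < n) a i * B ^ i = \sum_(i < n) b i * B ^ i)%N ->
  forall i, (i < n)%N -> a i = b i.
Proof.
elim: n a b => [//|n IH] a b aB bB.
have shift (c : nat -> nat) : (\sum_(i < n.+1) c i * B ^ i =
    (\sum_(i < n) c i.+1 * B ^ i) * B + c 0)%N.
  rewrite big_ord_recl expn0 muln1 addnC big_distrl; congr (_ + _)%N.
  by apply: eq_bigr => i _; rewrite /= expnSr mulnA.
rewrite !shift => e.
have B0 : (0 < B)%N by apply: leq_ltn_trans (aB 0 _).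
have e0 : a 0 = b 0.
  by have := congr1 (modn^~ B) e; rewrite !modnMDl !modn_small ?aB ?bB.
case=> // i; rewrite ltnS => lt_in; apply: (IH (a \o S) (b \o S)) => // [j|j|].
- by rewrite -ltnS; apply: aB.
- by rewrite -ltnS; apply: bB.
by have := congr1 (divn^~ B) e; rewrite !divnMDl // !divn_small ?aB ?bB // !addn0.
Qed.

(** Kronecker substitution reduces the statement to one variable. *)
Lemma exists_mnonroot n (p : {mpoly k[n]}) : p != 0 -> exists v, p.@[v] != 0.
Proof.
move=> p0; pose B := msize p; pose code (m : 'X_{1..n}) := (\sum_(i < n) m i * B ^ i)%N.
have code_inj : {in msupp p &, injective code}.
  move=> m m' pm pm'; rewrite /code => e; apply/mnmP => i.
  have lt (l : 'X_{1..n}) : l \in msupp p -> forall j, (l j < B)%N.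
    move=> pl j; apply: leq_ltn_trans (msize_mdeg_lt pl).
    by rewrite mdegE (bigD1 j) //= leq_addr.
  pose ext (l : 'X_{1..n}) j := if insub j is Some o then l o else 0%N.
  have extE (l : 'X_{1..n}) (o : 'I_n) : ext l o = l o by rewrite /ext valK.
  rewrite -(extE m) -(extE m'); apply: (@base_repr_inj B n) => [j jn|j jn||//].
  - by rewrite /ext insubT lt.
  - by rewrite /ext insubT lt.
  by under eq_bigr do rewrite extE; under [RHS]eq_bigr do rewrite extE.
pose q : {poly k} := \sum_(m <- msupp p) p@_m *: 'X^(code m).
have qE x : q.[x] = p.@[fun i => x ^+ (B ^ i)].
  rewrite mevalE horner_sum; apply: eq_bigr => m _; rewrite hornerZ hornerXn; congr (_ * _).
  rewrite /code expr_sum; apply: eq_bigr => i _; by rewrite mulnC exprM.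
have /exists_nonroot [x] : q != 0.
  apply/eqP => /(congr1 (fun r : {poly k} => r`_(code (mlead p)))) /eqP.
  have lp := mlead_supp p0.
  rewrite coef0 coef_sum (big_rem (mlead p)) //= coefZ coefXn eqxx mulr1.
  rewrite big_seq big1 ?addr0 => [|m].
    by rewrite mleadc_eq0 (negbTE p0).
  rewrite mem_rem_uniq ?msupp_uniq // inE => /andP [ml pm].
  rewrite coefZ coefXn; case: eqP => [/code_inj e|]; last by rewrite mulr0.
  by rewrite e ?eqxx in ml.
by rewrite qE => px; exists (fun i => x ^+ (B ^ i)).
Qed.

(** The coefficients of monomials with exponents below K give K^n linear
    equations, fewer than the unknowns. *)
Lemma exists_dependence n (I : finType) (g : I -> {mpoly k[n]}) K :
  (forall a, (msize (g a) <= K)%N) -> (K ^ n < #|I|)%N ->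
  exists2 u : I -> k, (exists a, u a != 0) & \sum_a u a *: g a = 0.
Proof.
move=> gK ltKI; pose T := {ffun 'I_n -> 'I_K}.
pose mon (t : T) : 'X_{1..n} := [multinom (t i : nat) | i < n].
pose A : 'M[k]_(#|I|, #|T|) := \matrix_(a, t) (g (enum_val a))@_(mon (enum_val t)).
have : kermx A != 0.
  rewrite -mxrank_eq0 mxrank_ker -lt0n subn_gt0; apply: leq_ltn_trans (rank_leq_col _) _.
  by rewrite card_ffun !card_ord.
case/rowV0Pn => u /sub_kermxP uA u0.
exists (fun a => u 0 (enum_rank a)).
  have [j uj] : exists j, u 0 j != 0.
    by apply/existsP; apply: contraNT u0 => /existsPn u0; apply/eqP/rowP => j; rewrite mxE; apply/eqP/negPn.
  by exists (enum_val j); rewrite enum_valK.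
apply/mpolyP => m; rewrite mcoeff0 raddf_sum /=.
case: (boolP [forall i, (m i < K)%N]) => [/forallP mK | /forallPn [i]].
  pose t : T := [ffun i => Ordinal (mK i)].
  have tm : mon t = m by apply/mnmP => i; rewrite mnmE ffunE.
  have /rowP /(_ (enum_rank t)) := uA; rewrite !mxE => uAt; rewrite -[RHS]uAt.
  rewrite (reindex _ (onW_bij _ (@enum_val_bij I))) /=.
  by apply: eq_bigr => a _; rewrite mcoeffZ mxE enum_rankK tm enum_valK.
rewrite -leqNgt /= => Kmi; apply: big1 => a _; rewrite mcoeffZ memN_msupp_eq0 ?mulr0 //.
apply: msize_mdeg_ge; apply: leq_trans (gK a) _; apply: leq_trans Kmi _.
by rewrite mdegE (bigD1 i) //= leq_addr.
Qed.

End Char0.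

Section Dependence.
Variable k : fieldType.

Lemma msize_expr n (p : {mpoly k[n]}) e : (msize (p ^+ e) <= (e * (msize p).+1).+1)%N.
Proof.
elim: e => [|e IH]; first by rewrite expr0 msize1.
rewrite exprS; apply: leq_trans (msizeM_le _ _) _; rewrite mulSn; lia.
Qed.

(** More polynomials than variables: the D^m monomials of box size D in them lie in
    a space of dimension at most (c D)^n, with c independent of D, and D^m is
    larger as soon as D > c^n. *)
Lemma monomial_dependence n (J : finType) (f : J -> {mpoly k[n]}) : (n < #|J|)%N ->
  exists D, exists2 u : {ffun J -> 'I_D} -> k, (exists a, u a != 0) &
    \sum_a u a *: \prod_j f j ^+ a j = 0.
Proof.
move=> ltnJ; pose s := \max_j msize (f j); pose c := (#|J| * s.+3).+1.
pose D := (c ^ n).+1; exists D.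
apply: (@exists_dependence _ n _ (fun a : {ffun J -> 'I_D} => \prod_j f j ^+ a j) (c * D)).
  move=> a; have : (msize (\prod_j f j ^+ a j) <= (\sum_(j : J) (D * s.+3)).+1)%N.
    elim/big_rec2: _ => [|j e p _ IH]; first by rewrite msize1.
    have ms : (msize (f j) <= s)%N by apply: (@leq_bigmax _ (fun j => msize (f j))).
    have fj : (msize (f j ^+ a j) <= (D * s.+1).+1)%N.
      apply: leq_trans (msize_expr _ _) _; rewrite ltnS leq_mul //.
      by rewrite ltnW.
    have := msizeM_le (f j ^+ a j) p; rewrite /D in fj *; nia.
  rewrite sum_nat_const => /leq_trans; apply.
  rewrite /c mulSn mulnCA [(D * _)%N]mulnC -addn1 addnC leq_add2r; by [].
rewrite card_ffun card_ord expnMn; apply: (@leq_trans (D * D ^ n)).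
  by rewrite ltn_pmul2r ?expn_gt0.
by rewrite -expnS leq_pexp2l.
Qed.

Lemma algebraic_dependence n m (f : 'I_m -> {mpoly k[n]}) : (n < m)%N ->
  exists2 Phi : {mpoly k[m]}, Phi != 0 & Phi \mPo (mktuple f) = 0.
Proof.
rewrite -{1}(card_ord m) => /monomial_dependence -/(_ f) [D [u [a ua] uf]].
pose mon (t : {ffun 'I_m -> 'I_D}) : 'X_{1..m} := [multinom (t i : nat) | i < m].
have mon_inj : injective mon.
  move=> t t' /mnmP e; apply/ffunP => i; apply: val_inj.
  by have := e i; rewrite !mnmE.
exists (\sum_t u t *: 'X_[mon t]).
  apply: contraNneq ua => /(congr1 (mcoeff (mon a))); rewrite mcoeff0 raddf_sum /=.
  rewrite (bigD1 a) //= mcoeffZ mcoeffX eqxx mulr1 big1 ?addr0 => [-> //|t ta].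
  by rewrite mcoeffZ mcoeffX (inj_eq mon_inj) (negbTE ta) mulr0.
rewrite raddf_sum -[RHS]uf; apply: eq_bigr => t _ /=.
rewrite comp_mpolyZ comp_mpolyX; congr (_ *: _); apply: eq_bigr => i _.
by rewrite tnth_mktuple mnmE.
Qed.

Lemma algebraic_relation n (f : 'I_n -> {mpoly k[n]}) (h : {mpoly k[n]}) :
  exists2 P : {poly {mpoly k[n]}}, P != 0 &
    (map_poly (comp_mpoly (mktuple f)) P).[h] = 0.
Proof.
pose fh (j : option 'I_n) := if j is Some i then f i else h.
have [|D [u [a ua] uf]] := @monomial_dependence n _ fh; first by rewrite card_option card_ord.
pose mon (t : {ffun option 'I_n -> 'I_D}) : 'X_{1..n} := [multinom (t (Some i) : nat) | i < n].
exists (\sum_t (u t *: 'X_[mon t])%:P * 'X^(t None)).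
  apply: contraNneq ua => /(congr1 (fun p : {poly {mpoly k[n]}} => (p`_(a None))@_(mon a))).
  rewrite coef0 mcoeff0 coef_sum raddf_sum (bigD1 a) //= coefCM coefXn eqxx mulr1.
  rewrite mcoeffZ mcoeffX eqxx mulr1 big1 ?addr0 => [-> //|t ta].
  rewrite coefCM coefXn; case: eqP => [eN|]; last by rewrite mulr0 mcoeff0.
  rewrite mulr1 mcoeffZ mcoeffX; case: eqP => [/mnmP eS|]; last by rewrite mulr0.
  case/eqP: ta; apply/ffunP => -[i|]; apply: val_inj => //.
  by have := eS i; rewrite !mnmE.
rewrite raddf_sum horner_sum -[RHS]uf; apply: eq_bigr => t _ /=.
rewrite mul_polyC map_polyZ map_polyXn hornerZ hornerXn /=.
rewrite comp_mpolyZ comp_mpolyX -scalerAl; congr (_ *: _).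
rewrite (bigD1 None) //= mulrC; congr (_ * _).
rewrite (reindex_omap Some id) => [|[]] //=.
apply: eq_big => [i|i _]; first by rewrite eqxx.
by rewrite tnth_mktuple mnmE.
Qed.
End Dependence.

Section Jacobian.
Variable k : fieldType.
Hypothesis char0 : [pchar k] =i pred0.

(** Both sides are derivations along composition, so they agree once they agree on the
    variables. *)
Lemma mderiv_comp n m (f : 'I_m -> {mpoly k[n]}) (p : {mpoly k[m]}) j :
  (p \mPo (mktuple f))^`M(j) = \sum_i (p^`M(i) \mPo (mktuple f)) * (f i)^`M(j).
Proof.
pose S : {rmorphism {mpoly k[m]} -> {mpoly k[n]}} := comp_mpoly (mktuple f).
pose Q p := (S p)^`M(j) = \sum_i S (p^`M(i)) * (f i)^`M(j).
have QM p1 p2 : Q p1 -> Q p2 -> Q (p1 * p2).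
  move=> q1 q2; rewrite /Q rmorphM mderivM q1 q2 mulr_suml mulr_sumr -big_split.
  by apply: eq_bigr => i _; rewrite mderivM (rmorphD S) !(rmorphM S) /=; ring.
have SX i : S 'X_i = f i by rewrite /S /= comp_mpolyXU -tnth_nth tnth_mktuple.
have QX i : Q 'X_i.
  rewrite /Q SX (bigD1 i) //= big1 ?addr0 => [|l li].
    rewrite mderivX mnm1E eqxx scale1r (_ : (U_(i) - U_(i) = 0)%MM) ?mpolyX0 ?rmorph1 ?mul1r //.
    by apply/mnmP => l; rewrite mnmBE subnn mnm0E.
  by rewrite mderivX mnm1E eq_sym (negbTE li) scale0r raddf0 mul0r.
have Q1 : Q 1.
  rewrite /Q rmorph1 -mpolyC1 mderivC big1 // => i _.
  by rewrite -mpolyC1 mderivC raddf0 mul0r.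
have QXm m0 : Q 'X_[m0].
  rewrite mpolyXE_id; elim/big_rec: _ => [//|i q _ Qq]; apply: (QM) => //.
  by elim: (m0 i) => [|e IH]; rewrite ?expr0 // exprS; apply: (QM).
rewrite -/(S p) -/(Q p); elim/mpolyind: p => [|c m0 p _ _ Qp].
  by rewrite /Q !raddf0 big1 // => i _; rewrite !raddf0 mul0r.
have SZ q : S (c *: q) = c *: S q by apply: linearZ.
rewrite /Q !raddfD /= SZ mderivZ Qp QXm scaler_sumr -big_split.
by apply: eq_bigr => i _ /=; rewrite !raddfD /= mderivZ SZ mulrDl scalerAl.
Qed.

(** By the chain rule and the Jacobian, the partial derivatives of a relation are
    again relations, of smaller degree. By induction they vanish, and a constant relation is 0. *)
Lemma jacobian_alg_indep n (f : 'I_n -> {mpoly k[n]}) :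
  \det (\matrix_(i, j) (f i)^`M(j)) != 0 ->
  forall Phi : {mpoly k[n]}, Phi \mPo (mktuple f) = 0 -> Phi = 0.
Proof.
move=> J0 Phi; have [b] := ubnP (msize Phi); elim: b Phi => // b IH Phi.
rewrite ltnS => szb Phif.
have dPhi i : Phi^`M(i) = 0.
  case: (eqVneq Phi 0) => [->|Phi0]; first by rewrite raddf0.
  apply: IH.
    apply: leq_trans szb; rewrite [X in (_ <= X)%N](mpolySpred _ Phi0) ltnS msizeE.
    apply/bigmax_leqP_seq => m + _; rewrite mcoeff_msupp mcoeff_deriv.
    case: (eqVneq Phi@_(m + U_(i)) 0) => [->|]; first by rewrite mul0rn eqxx.
    rewrite -mcoeff_msupp => /msize_mdeg_lt; rewrite mdegD mdeg1 addn1 => lt _.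
    lia.
  pose w : 'rV_n := \row_l (Phi^`M(l) \mPo (mktuple f)).
  set J := \matrix_(i, j) _ in J0.
  have wJ : w *m J = 0.
    apply/rowP => j; rewrite !mxE; have := mderiv_comp f Phi j; rewrite Phif raddf0 => e; rewrite [RHS]e.
    by apply: eq_bigr => l _; rewrite !mxE.
  have : w *m J *m \adj J = 0 by rewrite wJ mul0mx.
  rewrite -mulmxA mul_mx_adj mul_mx_scalar.
  move/eqP; rewrite scalemx_eq0 (negbTE J0) /= => /eqP/rowP/(_ i).
  by rewrite !mxE.
have PhiC : Phi = (Phi@_0)%:MP.
  apply/mpolyP => m; rewrite mcoeffC; case: (eqVneq m 0%MM) => [->|m0].
    by rewrite mulr1.
  rewrite mulr0; have [i mi] : exists i, (m i != 0)%N.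
    by apply/existsP; apply: contraNT m0 => /existsPn m0; apply/eqP/mnmP => i; rewrite mnm0E; apply/eqP/negPn.
  have := congr1 (mcoeff (m - U_(i))) (dPhi i).
  rewrite mcoeff_deriv submK ?lep1mP // mcoeff0 -mulr_natr => /eqP.
  by rewrite mulf_eq0; have /pcharf0P -> := char0; rewrite orbF => /eqP.
by rewrite PhiC in Phif *; rewrite comp_mpolyC in Phif.
Qed.
End Jacobian.

(** * Polynomial maps with invertible Jacobian have open image *)

Section Ideals.
Variable A : comNzRingType.

Definition is_ideal (I : A -> Prop) :=
  [/\ I 0, forall a b, I a -> I b -> I (a + b) & forall a b, I b -> I (a * b)].

Definition adjoin (I : A -> Prop) (g : A) : A -> Prop := fun p => exists a, I (p - a * g).

Lemma is_ideal_adjoin I g : is_ideal I -> is_ideal (adjoin I g).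
Proof.
move=> [I0 ID IM]; split; first by exists 0; rewrite mul0r subrr.
  move=> a b [u Iu] [v Iv]; exists (u + v).
  by rewrite (_ : _ - _ = (a - u * g) + (b - v * g)); [apply: ID | ring].
move=> a b [u Iu]; exists (a * u).
by rewrite (_ : _ - _ = a * (b - u * g)); [apply: IM | ring].
Qed.

Lemma sub_adjoin (I : A -> Prop) g p : I p -> adjoin I g p.
Proof. by exists 0; rewrite mul0r subr0. Qed.

Lemma mem_adjoin I g : is_ideal I -> adjoin I g g.
Proof. by case=> I0 _ _; exists 1; rewrite mul1r subrr. Qed.

(** A proper ideal containing a product stays proper after adding some
    factor, the step towards a maximal ideal that needs no Zorn lemma. *)
Lemma proper_adjoin_factor I (rs : seq A) : is_ideal I -> ~ I 1 ->
  I (\prod_(r <- rs) r) -> exists2 r, r \in rs & ~ adjoin I r 1.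
Proof.
move=> [I0 ID IM] I1; elim: rs => [|r rs IH]; first by rewrite big_nil.
rewrite big_cons => Irs.
case: (classic (adjoin I r 1)) => [[a Ia]|nI]; last by exists r; rewrite ?mem_head.
have [|s srs nI] := IH; last by exists s; rewrite // inE srs orbT.
rewrite (_ : \prod_(s <- rs) s = a * (r * \prod_(s <- rs) s) + (\prod_(s <- rs) s) * (1 - a * r)).
  by apply: ID; apply: IM.
by ring.
Qed.
End Ideals.

Section OpenImage.
Variable k : closedFieldType.
Hypothesis char0 : [pchar k] =i pred0.
Variables (n : nat) (f : 'I_n -> {mpoly k[n]}).
Hypothesis jac_f : \det (\matrix_(i, j) (f i)^`M(j)) != 0.

Local Notation A := {mpoly k[n]}.
Let S : {rmorphism A -> A} := comp_mpoly (mktuple f).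

Let S_inj p : S p = 0 -> p = 0.
Proof. exact: jacobian_alg_indep. Qed.

Let SX i : S 'X_i = f i.
Proof. by rewrite /S /= comp_mpolyXU -tnth_nth tnth_mktuple. Qed.

Let SC c : S c%:MP = c%:MP.
Proof. by rewrite /S /= comp_mpolyC. Qed.

(** Each variable is algebraic over the subring k[f_1, .., f_n]. Multiplying by a
    power of the unknown makes all the equations have the same degree [D]. *)
Lemma integral_equations : exists D, exists P : 'I_n -> {poly A},
  [/\ (0 < D)%N, forall i, size (P i) = D.+1 &
      forall i, (map_poly S (P i)).['X_i] = 0].
Proof.
have /fin_all_exists2 [P P0 PX] i := algebraic_relation f 'X_i.
pose D := (\max_i size (P i)).
exists D.+1; exists (fun i => P i * 'X^(D.+2 - size (P i))); split=> // i.
  have le : (size (P i) <= D)%N by apply: (@leq_bigmax _ (fun i => size (P i))).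
  by rewrite size_mulXn // subnK // (leq_trans le) // ltnW.
by rewrite rmorphM /= hornerM PX mul0r.
Qed.

Section Box.
Variables (D : nat) (P : 'I_n -> {poly A}).
Hypothesis D_gt0 : (0 < D)%N.
Hypothesis sizeP : forall i, size (P i) = D.+1.
Hypothesis P_X : forall i, (map_poly S (P i)).['X_i] = 0.

Local Notation box := {ffun 'I_n -> 'I_D}.
Definition box_mon (g : box) : A := \prod_i 'X_i ^+ g i.
(** Once this element is inverted the variables become integral over
    k[f_1, .., f_n]; the open set of the theorem is its nonvanishing locus. *)
Definition lead_prod : A := \prod_i lead_coef (P i).

Lemma lead_prod_neq0 : lead_prod != 0.
Proof. by apply/prodf_neq0 => i _; rewrite lead_coef_eq0 -size_poly_gt0 sizeP. Qed.

(** [a] lies in the k[f_1, .., f_n]-module generated by the monomials with exponents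
    below [D], after multiplication by a power of [lead_prod]. *)
Definition box_span (a : A) : Prop :=
  exists e, exists b : box -> A, S (lead_prod ^+ e) * a = \sum_g S (b g) * box_mon g.

Lemma box_spanD a b : box_span a -> box_span b -> box_span (a + b).
Proof.
move=> [e [u eu]] [e' [v ev]]; exists (e + e')%N.
exists (fun g => lead_prod ^+ e' * u g + lead_prod ^+ e * v g).
rewrite exprD rmorphM mulrDr {1}[S _ * S _]mulrC -!mulrA eu ev !mulr_sumr -big_split.
by apply: eq_bigr => g _; rewrite (rmorphD S) !(rmorphM S) /=; ring.
Qed.

Lemma box_spanMl c a : box_span a -> box_span (S c * a).
Proof.
move=> [e [u eu]]; exists e; exists (fun g => c * u g).
rewrite mulrCA eu mulr_sumr; apply: eq_bigr => g _; by rewrite (rmorphM S) mulrA.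
Qed.

Lemma box_span0 : box_span 0.
Proof.
exists 0%N; exists (fun=> 0); rewrite mulr0 big1 // => g _.
by rewrite raddf0 mul0r.
Qed.

Lemma box_span_sum (I : Type) (r : seq I) (Q : pred I) (a : I -> A) :
  (forall i, Q i -> box_span (a i)) -> box_span (\sum_(i <- r | Q i) a i).
Proof.
by move=> Ha; elim/big_ind: _ => //; [apply: box_span0 | apply: box_spanD].
Qed.

Lemma box_span_cancel i a : box_span (S (lead_coef (P i)) * a) -> box_span a.
Proof.
move=> [e [u eu]]; exists e.+1; pose c' := \prod_(j | j != i) lead_coef (P j).
exists (fun g => c' * u g).
rewrite exprSr {2}/lead_prod (bigD1 i) //= -/c' !(rmorphM S).
transitivity (S c' * (S (lead_prod ^+ e) * (S (lead_coef (P i)) * a))); first by ring.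
rewrite eu mulr_sumr; apply: eq_bigr => g _; by rewrite (rmorphM S) mulrA.
Qed.

Lemma box_span_cancelX e a : box_span (S (lead_prod ^+ e) * a) -> box_span a.
Proof.
move=> [e' [u eu]]; exists (e' + e)%N; exists u.
by rewrite -eu exprD rmorphM mulrA.
Qed.

Lemma box_span_mon g : box_span (box_mon g).
Proof.
exists 0%N; exists (fun h => (h == g)%:R); rewrite expr0 rmorph1 mul1r.
rewrite (bigD1 g) //= eqxx rmorph1 mul1r big1 ?addr0 // => h hg.
by rewrite (negbTE hg) raddf0 mul0r.
Qed.

Definition box_set (g : box) i (l : 'I_D) : box := [ffun j => if j == i then l else g j].

Lemma box_mon_set g i l : box_mon (box_set g i l) = 'X_i ^+ l * \prod_(j | j != i) 'X_j ^+ g j.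
Proof.
rewrite /box_mon (bigD1 i) //= ffunE eqxx; congr (_ * _); apply: eq_bigr => j ji.
by rewrite ffunE (negbTE ji).
Qed.

(** When the exponent of X_i reaches D, the algebraic equation of X_i lowers it. *)
Lemma box_spanX_mon i g : box_span ('X_i * box_mon g).
Proof.
have gE : box_mon g = 'X_i ^+ g i * \prod_(j | j != i) 'X_j ^+ g j.
  by rewrite /box_mon (bigD1 i).
rewrite gE mulrA -exprS.
case: (ltnP (g i).+1 D) => [lt|ge].
  by rewrite -[(g i).+1]/(Ordinal lt : nat) -box_mon_set; apply: box_span_mon.
have -> : (g i).+1 = D by apply/eqP; rewrite eqn_leq ge ltn_ord.
apply: (@box_span_cancel i).
have e : S (lead_coef (P i)) * 'X_i ^+ D = \sum_(l < D) S (- (P i)`_l) * 'X_i ^+ l.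
  have sz : (size (map_poly S (P i)) <= D.+1)%N by rewrite -(sizeP i) size_poly.
  have := P_X i; rewrite (horner_coef_wide _ sz).
  rewrite big_ord_recr /= coef_map /= lead_coefE sizeP /= addrC => /eqP.
  rewrite addr_eq0 => /eqP ->; rewrite -sumrN; apply: eq_bigr => l _.
  by rewrite coef_map /= raddfN mulNr.
rewrite mulrA e mulr_suml; apply: box_span_sum => l _.
by rewrite -mulrA -box_mon_set; apply/box_spanMl/box_span_mon.
Qed.

Lemma box_spanX i a : box_span a -> box_span ('X_i * a).
Proof.
move=> [e [u eu]]; apply: (@box_span_cancelX e).
rewrite mulrCA eu mulr_sumr; apply: box_span_sum => g _.
by rewrite mulrCA; apply/box_spanMl/box_spanX_mon.
Qed.

Lemma box_span_all a : box_span a.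
Proof.
elim/mpolyind: a => [|c m a _ _ IH]; first exact: box_span0.
apply: box_spanD IH; rewrite -mul_mpolyC -SC; apply: box_spanMl.
rewrite mpolyXE_id; elim/big_rec: _ => [|i a' _ IH].
  pose g0 : box := [ffun=> Ordinal D_gt0].
  rewrite (_ : 1 = box_mon g0); first exact: box_span_mon.
  by rewrite /box_mon big1 // => i _; rewrite ffunE expr0.
elim: (m i) => [|l IHl]; first by rewrite mul1r.
by rewrite exprS -mulrA; apply: box_spanX.
Qed.

Variable y : 'I_n -> k.
Hypothesis cy : lead_prod.@[y] != 0.

(** The ideal of the fiber of f over y. *)
Definition fiber_ideal (a : A) : Prop :=
  exists b : 'I_n -> A, a = \sum_i (f i - (y i)%:MP) * b i.

Lemma is_ideal_fiber : is_ideal fiber_ideal.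
Proof.
split; first by exists (fun=> 0); rewrite big1 // => i _; rewrite mulr0.
  move=> _ _ [u ->] [v ->]; exists (fun i => u i + v i).
  by rewrite -big_split; apply: eq_bigr => i _; rewrite mulrDr.
move=> a _ [u ->]; exists (fun i => a * u i).
by rewrite mulr_sumr; apply: eq_bigr => i _; rewrite mulrCA.
Qed.

(** The determinant trick of Nakayama's lemma. If 1 lies in the ideal, the
    generating monomials satisfy a square system (c^E - B) v = 0 with B in the maximal
    ideal of y in k[f_1, .., f_n]. The determinant kills v, which contains 1, so
    it is 0, while at y it takes the value of a power of c, which is not 0. *)
Lemma fiber_ideal_proper : ~ fiber_ideal 1.
Proof.
move=> [a e1].
have /fin_all_exists [ex] (p : 'I_n * box) := box_span_all (a p.1 * box_mon p.2).
move=> /fin_all_exists [b bE].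
pose E := (\sum_p ex p)%N.
have bE' i g : S (lead_prod ^+ E) * (a i * box_mon g) =
    \sum_h S (lead_prod ^+ (E - ex (i, g)) * b (i, g) h) * box_mon h.
  rewrite -{1}(@subnK (ex (i, g)) E); last by rewrite /E (bigD1 (i, g)) //= leq_addr.
  rewrite exprD (rmorphM S) -mulrA bE mulr_sumr; apply: eq_bigr => h _.
  by rewrite (rmorphM S) mulrA.
pose B (g h : box) : A := \sum_i ('X_i - (y i)%:MP) * (lead_prod ^+ (E - ex (i, g)) * b (i, g) h).
have monE g : S (lead_prod ^+ E) * box_mon g = \sum_h S (B g h) * box_mon h.
  rewrite -[box_mon g]mul1r {1}e1 mulr_suml mulr_sumr.
  have tE i : S (lead_prod ^+ E) * ((f i - (y i)%:MP) * a i * box_mon g) =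
      (f i - (y i)%:MP) * (S (lead_prod ^+ E) * (a i * box_mon g)) by rewrite -[X in _ * X]mulrA mulrCA.
  under eq_bigr => i _ do rewrite tE bE' mulr_sumr.
  rewrite exchange_big; apply: eq_bigr => h _.
  rewrite (raddf_sum S) mulr_suml; apply: eq_bigr => i _.
  by rewrite [X in _ = X * _](rmorphM S) (rmorphB S) SX SC mulrA.
pose M : 'M[A]_#|{: box}| := (lead_prod ^+ E)%:M - \matrix_(g, h) B (enum_val g) (enum_val h).
pose v : 'cV[A]_#|{: box}| := \col_g box_mon (enum_val g).
have Mv : map_mx S M *m v = 0.
  apply/colP => g; rewrite !mxE.
  under eq_bigr => h _ do rewrite !mxE (rmorphB S) mulrBl.
  rewrite sumrB (bigD1 g) //= eqxx mulr1n big1 ?addr0 => [|h hg]; last first.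
    by rewrite [g == h]eq_sym (negbTE hg) mulr0n raddf0 mul0r.
  rewrite -[comp_mpoly _ _]/(S _) monE; apply/eqP; rewrite subr_eq0; apply/eqP.
  by rewrite (reindex _ (onW_bij _ (@enum_val_bij {: box}))).
have detM : \det M = 0.
  apply: S_inj; rewrite -det_map_mx.
  pose g0 : box := [ffun=> Ordinal D_gt0].
  have : \adj (map_mx S M) *m map_mx S M *m v = 0 by rewrite -mulmxA Mv mulmx0.
  rewrite mul_adj_mx mul_scalar_mx => /colP /(_ (enum_rank g0)).
  rewrite !mxE enum_rankK /box_mon big1 ?mulr1 // => i _.
  by rewrite ffunE expr0.
have : (\det M).@[y] != 0.
  rewrite -det_map_mx (_ : map_mx _ M = (lead_prod.@[y] ^+ E)%:M).
    by rewrite det_scalar !expf_neq0.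
  apply/matrixP => g h; rewrite !mxE rmorphB /= rmorphMn rmorphXn /=.
  rewrite (raddf_sum (meval y)) big1 ?subr0 // => i _.
  by rewrite /= mevalM mevalB mevalXU mevalC subrr mul0r.
by rewrite detM meval0 eqxx.
Qed.

Lemma congr_fiber p : fiber_ideal (S p - (p.@[y])%:MP).
Proof.
have [I0 ID IM] := is_ideal_fiber.
pose Q p := fiber_ideal (S p - (p.@[y])%:MP); rewrite -/(Q p).
have QM p1 p2 : Q p1 -> Q p2 -> Q (p1 * p2).
  move=> q1 q2; rewrite /Q (rmorphM S) mevalM mpolyCM.
  rewrite (_ : _ - _ = S p2 * (S p1 - (p1.@[y])%:MP) + (p1.@[y])%:MP * (S p2 - (p2.@[y])%:MP)).
    by apply: ID; apply: IM.
  by ring.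
have QC c : Q c%:MP by rewrite /Q SC mevalC subrr.
elim/mpolyind: p => [|c m p _ _ Qp]; first by rewrite /Q rmorph0 meval0 subrr.
rewrite /Q (rmorphD S) mevalD mpolyCD opprD addrACA; apply: ID => //.
rewrite -/(Q _) -mul_mpolyC; apply: (QM) => //.
rewrite mpolyXE_id; elim/big_rec: _ => [|i a' _ IH]; first by rewrite -mpolyC1.
apply: (QM) => //; elim: (m i) => [|l IHl]; first by rewrite expr0 -mpolyC1.
rewrite exprS; apply: (QM) => //; rewrite /Q SX mevalXU.
exists (fun j => (j == i)%:R); rewrite (bigD1 i) //= eqxx mulr1 big1 ?addr0 // => j ji.
by rewrite (negbTE ji) mulr0.
Qed.

(** Modulo the ideal the equation of X_i has constant coefficients, and it splits
    over k. *)
Lemma fiber_root i : exists rs : seq k, fiber_ideal (\prod_(r <- rs) ('X_i - r%:MP)).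
Proof.
have [I0 ID IM] := is_ideal_fiber.
pose q := map_poly (meval y) (P i).
have lq : (lead_coef (P i)).@[y] != 0.
  by move: cy; rewrite /lead_prod rmorph_prod => /prodf_neq0 /(_ i isT).
have [rs qE] := closed_field_poly_normal q; exists rs.
have szq : size q = D.+1 by rewrite size_map_poly_id0 // sizeP.
have lq' : lead_coef q != 0 by rewrite lead_coef_eq0 -size_poly_eq0 szq.
have qX : fiber_ideal (map_poly (@mpolyC n k) q).['X_i].
  have -> : (map_poly (@mpolyC n k) q).['X_i] = - \sum_(l < D.+1) 'X_i ^+ l * (S ((P i)`_l) - (((P i)`_l).@[y])%:MP).
    have szS : (size (map_poly S (P i)) <= D.+1)%N by rewrite -(sizeP i) size_poly.
    have szC : (size (map_poly (@mpolyC n k) q) <= D.+1)%N by rewrite -szq size_poly.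
    have e0 := P_X i; rewrite (horner_coef_wide _ szS) in e0.
    rewrite (horner_coef_wide _ szC) -[LHS]subr0 -[X in _ - X]e0 -sumrB -sumrN; apply: eq_bigr => l _.
    by rewrite !coef_map /=; ring.
  rewrite -mulN1r; apply: (IM); elim/big_ind: _ => // l _.
  by apply: (IM); apply: congr_fiber.
have -> : \prod_(r <- rs) ('X_i - r%:MP) = ((lead_coef q)^-1)%:MP * (map_poly (@mpolyC n k) q).['X_i].
  rewrite {2}qE map_polyZ hornerZ mulrA -mpolyCM mulVf // mul1r rmorph_prod horner_prod.
  by apply: eq_bigr => r _; rewrite rmorphB /= map_polyX map_polyC hornerXsubC.
exact: IM.
Qed.

(** Adjoin X_i - v_i for one root v_i per variable while keeping the ideal
    proper; then v is a point of the fiber. *)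
Lemma fiber_point : exists v, forall i, (f i).@[v] = y i.
Proof.
have [J [JI J1 sub Jv]] : exists J : A -> Prop, [/\ is_ideal J, ~ J 1,
    forall a, fiber_ideal a -> J a & forall i, exists r : k, J ('X_i - r%:MP)].
  have : exists J : A -> Prop, [/\ is_ideal J, ~ J 1,
    forall a, fiber_ideal a -> J a & forall i, i \in enum 'I_n -> exists r : k, J ('X_i - r%:MP)].
    elim: (enum 'I_n) => [|i s [J [JI J1 sub Jv]]].
      by exists fiber_ideal; split=> //; [exact: is_ideal_fiber|exact: fiber_ideal_proper].
    have [rs /sub] := fiber_root i.
    rewrite -(big_map (fun r => 'X_i - r%:MP) xpredT id) => Jrs.
    have [_ /mapP [r _ ->] nJ] := proper_adjoin_factor JI J1 Jrs.
    exists (adjoin J ('X_i - r%:MP)); split=> //.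
    - exact: is_ideal_adjoin.
    - by move=> a /sub; apply: sub_adjoin.
    move=> j; rewrite inE => /orP [/eqP ->|/Jv [r' Jr']].
      by exists r; apply: mem_adjoin.
    by exists r'; apply: sub_adjoin.
  by case=> J [JI J1 sub Jv]; exists J; split=> // i; apply: Jv; rewrite mem_enum.
have [v vP] := fin_all_exists Jv; have [J0 JD JM] := JI.
have congr_v p : J (p - (p.@[v])%:MP).
  pose Q p := J (p - (p.@[v])%:MP); rewrite -/(Q p).
  have QM p1 p2 : Q p1 -> Q p2 -> Q (p1 * p2).
    move=> q1 q2; rewrite /Q mevalM mpolyCM.
    rewrite (_ : _ - _ = p2 * (p1 - (p1.@[v])%:MP) + (p1.@[v])%:MP * (p2 - (p2.@[v])%:MP)).
      by apply: JD; apply: JM.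
    by ring.
  have QC c : Q c%:MP by rewrite /Q mevalC subrr.
  elim/mpolyind: p => [|c m p _ _ Qp]; first by rewrite /Q meval0 subrr.
  rewrite /Q mevalD mpolyCD opprD addrACA; apply: JD => //.
  rewrite -/(Q _) -mul_mpolyC; apply: (QM) => //.
  rewrite mpolyXE_id; elim/big_rec: _ => [|i a' _ IH]; first by rewrite -mpolyC1.
  apply: (QM) => //; elim: (m i) => [|l IHl]; first by rewrite expr0 -mpolyC1.
  by rewrite exprS; apply: (QM) => //; rewrite /Q mevalXU; apply: vP.
exists v => i; apply/eqP; rewrite -subr_eq0; apply: contra_notT J1 => ne.
have fy : J (f i - (y i)%:MP).
  apply: sub; exists (fun j => (j == i)%:R); rewrite (bigD1 i) //= eqxx mulr1 big1 ?addr0 // => j ji.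
  by rewrite (negbTE ji) mulr0.
have -> : 1 = (((f i).@[v] - y i)^-1)%:MP * ((f i - (y i)%:MP) + (-1) * (f i - ((f i).@[v])%:MP)).
  rewrite (_ : _ + _ = ((f i).@[v])%:MP - (y i)%:MP); last by ring.
  by rewrite -mpolyCB -mpolyCM mulVf.
by apply: (JM); apply: (JD) => //; apply: JM.
Qed.
End Box.

(** A case of Chevalley's theorem for dominant maps between affine spaces of
    equal dimension. *)
Theorem jacobian_open_image :
  exists2 g : A, g != 0 & forall y, g.@[y] != 0 -> exists v, forall i, (f i).@[v] = y i.
Proof.
have [D [P [D0 szP PX]]] := integral_equations.
exists (lead_prod P); first exact: (lead_prod_neq0 szP).
by move=> y; apply: (fiber_point D0 szP PX).
Qed.
End OpenImage.

(** * Coordinates on the space of surfaces *)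

Definition mon d (i : 'I_#|monomial d|) : 'X_{1..4} := val (enum_val i : monomial d).

Lemma surface_of_coords (k : closedFieldType) d (y : 'I_#|monomial d| -> k) b :
  y b != 0 -> exists S : surface k d, forall c, coords S c = y c.
Proof.
move=> yb; pose p : {mpoly k[4]} := \sum_b y b *: 'X_[mon b].
have ph : p \is d.-homog.
  by apply: rpred_sum => c _; apply: rpredZ; rewrite dhomogX; apply: (valP (enum_val c : monomial d)).
have pE c : p@_(mon c) = y c.
  rewrite /p raddf_sum (bigD1 c) //= mcoeffZ mcoeffX eqxx mulr1 big1 ?addr0 // => a ac.
  rewrite mcoeffZ mcoeffX; case: eqP => [e'|]; last by rewrite mulr0.
  by case/eqP: ac; apply: enum_val_inj; apply: val_inj; apply: val_inj.
have p0 : DHomog ph != 0.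
  rewrite -val_eqE /=; apply: contraNneq yb => p0.
  by rewrite -pE p0 mcoeff0.
by exists (Surface p0) => c; rewrite /coords /equation /= pE.
Qed.

Lemma meval_scale (R : comNzRingType) n d (f : {mpoly R[n]}) c (v : 'I_n -> R) :
  f \is d.-homog -> f.@[fun i => c * v i] = c ^+ d * f.@[v].
Proof.
move=> /dhomogP fh; rewrite !mevalE mulr_sumr; apply: eq_big_seq => m mf.
under eq_bigr => j _ do rewrite exprMn.
rewrite big_split /= prodrXr -mdegE fh //; ring.
Qed.

Lemma meval_vertex (R : comNzRingType) n d (g : {mpoly R[n]}) a : g \is d.-homog ->
  g.@[fun i => (i == a)%:R] = g@_(U_(a) *+ d).
Proof.
move=> /dhomogP gh; rewrite mevalE.
have term (m : 'X_{1..n}) : mdeg m = d -> m != (U_(a) *+ d)%MM -> \prod_i (i == a)%:R ^+ m i = 0 :> R.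
  move=> dm ma; have [i /andP [ia mi]] : exists i, (i != a) && (m i != 0%N).
    apply/existsP; apply: contraNT ma => /existsPn m0.
    have m0' i : i != a -> m i = 0%N by move=> ia; have := m0 i; rewrite ia => /negPn/eqP.
    apply/eqP/mnmP => i; rewrite mulmnE mnm1E [a == i]eq_sym.
    by case: eqVneq => [->|/m0' -> //]; rewrite mul1n -[RHS]dm mdegE (bigD1 a) //= big1 ?addn0.
  by rewrite (bigD1 i) //= (negbTE ia) expr0n (negbTE mi) mul0r.
case: (boolP ((U_(a) *+ d)%MM \in msupp g)) => [ag|/[dup] ag /memN_msupp_eq0 ->].
  rewrite (bigD1_seq _ ag (msupp_uniq g)) /= [X in _ + X](_ : _ = 0); last first.
    by rewrite big_seq_cond big1 // => m /andP [mg ma]; rewrite term ?mulr0 //; apply: gh.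
  rewrite addr0 [X in _ * X](_ : _ = 1) ?mulr1 //; apply: big1 => i _.
  rewrite [X in _ ^+ X]mulmnE mnm1E [a == i]eq_sym.
  by case: eqP => _; rewrite ?expr1n.
rewrite big_seq big1 // => m mg; rewrite term ?mulr0 //; first exact: gh.
by apply: contraNneq ag => <-.
Qed.

(** * A linear system over the field with two elements *)

Local Close Scope ring_scope.

(** Rows of a linear system over the field with two elements, as bit strings whose
    tail of zeros may be omitted. *)
Inductive bits := BNil | B0 of bits | B1 of bits.

Fixpoint bxor (x y : bits) : bits :=
  match x, y with
  | BNil, _ => y
  | _, BNil => x
  | B0 a, B0 b => B0 (bxor a b)
  | B0 a, B1 b => B1 (bxor a b)
  | B1 a, B0 b => B1 (bxor a b)
  | B1 a, B1 b => B0 (bxor a b)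
  end.

Fixpoint bnth (x : bits) (i : nat) : bool :=
  match x, i with
  | BNil, _ => false
  | B0 _, 0 => false
  | B1 _, 0 => true
  | B0 a, i.+1 | B1 a, i.+1 => bnth a i
  end.

Definition bcons (b : bool) (x : bits) :=
  if b then B1 x else if x is BNil then BNil else B0 x.
Definition bits_of (s : seq bool) : bits := foldr bcons BNil s.

Fixpoint bsplit (rows ev od : seq bits) : seq bits * seq bits :=
  match rows with
  | [::] => (ev, od)
  | BNil :: rs => bsplit rs ev od
  | B0 t :: rs => bsplit rs (t :: ev) od
  | B1 t :: rs => bsplit rs ev (t :: od)
  end.

(** Always true; testing it fully evaluates its argument, which keeps the elimination
    feasible under lazy evaluation, where suspended sums would otherwise pile up. *)
Fixpoint bforce (x : bits) : bool :=
  match x with BNil => true | B0 a | B1 a => bforce a end.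

Fixpoint eliminate (p : bits) (acc rows : seq bits) : seq bits :=
  match rows with
  | [::] => acc
  | r :: rs => let q := bxor p r in
               if bforce q then eliminate p (q :: acc) rs else [::]
  end.

(** Gaussian elimination, one column after the other: the rows are split by their
    first bit and a row with first bit 1 is the pivot. *)
Fixpoint full_rank (n : nat) (rows : seq bits) : bool :=
  match n with
  | 0 => true
  | n'.+1 =>
    let (ev, od) := bsplit rows [::] [::] in
    match od with
    | [::] => false
    | p :: ps => full_rank n' (eliminate p ev ps)
    end
  end.

(** Witness matrices A_1, A_2, A_3 modulo 2, for d at most 3. The entry of rank i in
    the k-th list contains the columns l < i of the nonzero entries (i, l). *)
Definition small_data : seq (seq (seq nat)) :=
  [:: [:: [::]; [::]; [::]; [:: 1]; [:: 2]; [::]];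
      [:: [::]; [::]; [:: 0]; [::]; [:: 3]; [::]];
      [:: [::]; [::]; [::]; [:: 0]; [::]; [:: 1]]].

(** Same format. The leading blocks of size 2d of these matrices are witnesses for
    every d from 4 to 15; they come from a random search. *)
Definition large_data : seq (seq (seq nat)) :=
  [:: [:: [::]; [::]; [:: 0; 1]; [::]; [::]; [:: 0]; [:: 3]; [:: 1]; [:: 2; 5; 7]; 
      [:: 2; 5]; [:: 9]; [:: 3; 6]; [:: 0; 1; 9]; [:: 6]; [:: 7]; 
      [:: 5; 7; 12]; [:: 6; 11; 13]; [:: 0; 1]; [:: 0; 9; 15]; [:: 3; 13; 16]; 
      [:: 2; 7]; [::]; [:: 13; 19]; [:: 1; 8; 15; 21]; [:: 22]; 
      [:: 8; 14; 15; 20; 21]; [:: 5; 12; 17; 25]; [:: 2; 25]; 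
      [:: 1; 8; 9; 21; 26]; [:: 3; 11; 19]];
  [:: [::]; [::]; [::]; [:: 0; 1]; [::]; [::]; [:: 0]; [:: 2; 5]; [:: 3]; 
      [:: 3; 4]; [:: 2; 7]; [:: 0; 1; 8; 9]; [:: 10]; [:: 0; 8; 9]; [:: 13]; 
      [:: 3; 4]; [:: 0; 1]; [:: 2; 5]; [:: 10; 17]; [:: 14; 15]; 
      [:: 3; 4; 6; 16; 19]; [:: 4; 13]; [:: 1; 9; 14; 15; 20]; [:: 2; 7]; 
      [:: 0]; [:: 2]; [:: 4; 6; 22]; [:: 4]; [:: 5; 7; 10; 18; 23]; 
      [:: 1; 8; 15; 20; 26; 27]];
  [:: [::]; [::]; [::]; [:: 2]; [:: 2]; [::]; [:: 5]; [:: 3; 6]; [:: 0; 1]; 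
      [:: 1; 8]; [:: 4; 6]; [:: 7]; [:: 4]; [:: 2; 7]; [:: 8]; [:: 0; 9]; 
      [:: 2; 12]; [:: 3; 6; 11; 13]; [:: 3; 6; 11; 13]; [:: 12; 17]; [:: 8]; 
      [:: 1; 14]; [:: 2; 5; 7; 10]; [:: 3; 4; 13]; [:: 10; 12; 23]; 
      [:: 3; 4; 6; 11; 16]; [:: 8; 9; 14; 20; 21]; [:: 1; 9]; 
      [:: 13; 19; 22; 24]; [:: 2; 7; 17; 18]]].

(** The index k = 0 is the matrix J, with 2 x 2 blocks on the diagonal. *)
Definition lower (d k i : nat) : seq nat :=
  if k is k'.+1 then nth [::] (nth [::] (if d <= 3 then small_data else large_data) k') i
  else if odd i then [:: i.-1] else [::].

(** Exchanges 2i and 2i+1, which is the permutation of J modulo 2. *)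
Definition flip1 (i : nat) := if odd i then i.-1 else i.+1.

Definition supp (d k i : nat) : seq nat :=
  [seq l <- iota 0 (2 * d) | (l \in lower d k i) (+) (i \in lower d k l)].

(** Exponents of X_1, X_2, X_3; the variable X_0 is set to 1. *)
Definition xpn := (nat * nat * nat)%type.
Definition xeq (x y : xpn) : bool := let: (a, b, c) := x in let: (a', b', c') := y in
  [&& eqn a a', eqn b b' & eqn c c'].
Definition xpred (k : nat) (x : xpn) : option xpn :=
  match k, x with
  | 1, (a.+1, b, c) => Some (a, b, c)
  | 2, (a, b.+1, c) => Some (a, b, c)
  | 3, (a, b, c.+1) => Some (a, b, c)
  | _, _ => None
  end.

Definition bmat := seq bits.
Definition brow (A : bmat) i := nth BNil A i.

Fixpoint xlookup (l : seq (xpn * bmat)) (x : xpn) : bmat :=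
  match l with
  | [::] => [::]
  | (y, A) :: l' => if xeq x y then A else xlookup l' x
  end.

Definition xdeg s : seq xpn :=
  [seq (s - t, t - c, c) | t <- iota 0 s.+1, c <- iota 0 t.+1].

Definition shifted (k : nat) (l : seq (xpn * bmat)) (x : xpn) : bmat :=
  if xpred k x is Some y then xlookup l y else [::].

Definition supps (d : nat) : seq (seq (seq nat)) :=
  [seq [seq supp d k (flip1 i) | k <- [:: 1; 2; 3]] | i <- iota 0 (2 * d)].

Definition combine (A : bmat) (s : seq nat) (r : bits) : bits :=
  foldr (fun l => bxor (brow A l)) r s.

(** One step of the geometric series for (J + X_1 A_1 + X_2 A_2 + X_3 A_3)^-1: the
    coefficients of degree s+1 are the sums of J A_k times those of degree s. *)
Definition next_mat (adj : seq (seq (seq nat))) (l : seq (xpn * bmat)) (x : xpn) : bmat :=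
  let A1 := shifted 1 l x in let A2 := shifted 2 l x in let A3 := shifted 3 l x in
  [seq combine A1 (nth [::] s 0) (combine A2 (nth [::] s 1) (combine A3 (nth [::] s 2) BNil))
  | s <- adj].

Definition unit_bits j : bits := iter j B0 (B1 BNil).

Definition mat0 (n w : nat) : bmat :=
  [seq if flip1 i < w then unit_bits (flip1 i) else BNil | i <- iota 0 n].

(** The coefficients, up to degree s, of the inverse of J + X_1 A_1 + X_2 A_2 +
    X_3 A_3. Only the first [w] columns are needed. *)
Fixpoint layers adj (n w s : nat) : seq (seq (xpn * bmat)) :=
  match s with
  | 0 => [:: [:: ((0, 0, 0), mat0 n w)]]
  | s'.+1 => let L := layers adj n w s' in
     [seq (x, next_mat adj (head [::] L) x) | x <- xdeg s'.+1] :: L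
  end.

Definition xall d : seq xpn := flatten [seq xdeg s.+1 | s <- iota 0 d].
(** Any order of the unknowns is sound; grouping them by this weight modulo 3
    keeps the elimination sparse. *)
Definition xclass (x : xpn) := (2 * x.1.1 + x.1.2) %% 3.
Definition xpos d := flatten [seq [seq x <- xall d | xclass x == c] | c <- iota 0 3].

(** The equations say that X_k times the entry (i, j) of the inverse matrix, for
    i > j and j < d, pairs to 0 with the unknown values theta at the monomials of
    degrees 1 to d. The test is that they determine theta. *)
Definition check (d : nat) : bool :=
  let n := 2 * d in let w := d in
  let L := rev (layers (supps d) n w d.-1) in
  let o := xpos d in
  let M k := [seq shifted k (nth [::] L (x.1.1 + x.1.2 + x.2).-1) x | x <- o] in
  let M1 := M 1 in let M2 := M 2 in let M3 := M 3 in
  let rows i :=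
    let r A := [seq brow B i | B <- A] in
    let r1 := r M1 in let r2 := r M2 in let r3 := r M3 in
    flatten [seq [:: bits_of [seq bnth x j | x <- r1]; bits_of [seq bnth x j | x <- r2]; bits_of [seq bnth x j | x <- r3]]
            | j <- iota 0 (minn i w)] in
  let R := flatten [seq rows i | i <- iota 0 n] in
  all bforce R && full_rank (size o) R.

Local Open Scope ring_scope.

Lemma bnth_bxor x y i : bnth (bxor x y) i = bnth x i + bnth y i.
Proof.
elim: x y i => [|x IH|x IH] [|y|y] [|i] //=; rewrite ?addr0 ?add0r //; exact: IH.
Qed.

Lemma bnth_bits_of s i : bnth (bits_of s) i = nth false s i.
Proof.
elim: s i => [|b s IH] [|i] //=; rewrite -/(bits_of s) /bcons.
  by case: b => //; case: (bits_of s).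
by case: b; case: (bits_of s) (IH i).
Qed.

Definition dot n (psi : nat -> bool) (r : bits) : bool := \sum_(i < n) bnth r i * psi i.

Lemma dot_bxor n psi x y : dot n psi (bxor x y) = dot n psi x + dot n psi y.
Proof. by rewrite -big_split; apply: eq_bigr => i _; rewrite bnth_bxor mulrDl. Qed.

Lemma dotS n psi r : dot n.+1 psi r =
  bnth r 0 * psi 0 + dot n (psi \o S) (match r with BNil => BNil | B0 t | B1 t => t end).
Proof.
by rewrite /dot big_ord_recl; congr (_ + _); apply: eq_bigr => i _; case: r => [|r|r].
Qed.

Lemma bforceT x : bforce x. Proof. by elim: x. Qed.

Lemma eliminateP p acc rows (Q : pred bits) :
  all Q acc -> all (fun r => Q (bxor p r)) rows -> all Q (eliminate p acc rows).
Proof.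
elim: rows acc => [//|r rs IH] acc Qa /= /andP [Qr Qrs].
by rewrite bforceT; apply: IH => //=; rewrite Qr.
Qed.

Lemma full_rankP n rows psi : full_rank n rows ->
  all (fun r => dot n psi r == 0) rows -> forall i, (i < n)%N -> psi i = false.
Proof.
elim: n rows psi => [//|n IH] rows psi /=.
set T := fun t => dot n (psi \o S) t == 0.
set T1 := fun t => psi 0 + dot n (psi \o S) t == 0.
have split rs ev od : all (fun r => dot n.+1 psi r == 0) rs -> all T ev -> all T1 od ->
    all T (bsplit rs ev od).1 && all T1 (bsplit rs ev od).2.
  elim: rs ev od => [ev od _ -> -> //|[|t|t] rs IHr] ev od /= /andP [] dr drs aev aod; apply: IHr => //=.
    by rewrite aev andbT; rewrite dotS /= mul0r add0r in dr.
  by rewrite aod andbT; rewrite dotS /= mul1r in dr.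
move=> + all0; have := split rows [::] [::] all0 isT isT.
case: (bsplit rows [::] [::]) => ev [//|p ps] /= /andP [aev /andP [/eqP pE aps]] fr.
have tail : forall i, (i < n)%N -> (psi \o S) i = false.
  apply: (IH _ _ fr); apply: eliminateP => //.
  apply: sub_all aps => r /eqP rE; rewrite dot_bxor; apply/eqP.
  move: pE rE; case: (psi 0); case: (dot n _ p); case: (dot n _ r) => //.
case=> [_|i]; last exact: tail.
move: pE; rewrite /dot big1 ?addr0 // => i _.
by rewrite (tail i (ltn_ord i)) mulr0.
Qed.

Definition addx (x y : xpn) : xpn := (x.1.1 + y.1.1, x.1.2 + y.1.2, x.2 + y.2)%N.
Definition degx (x : xpn) : nat := (x.1.1 + x.1.2 + x.2)%N.
Definition unitx (k : nat) : xpn := ((k == 1) : nat, (k == 2) : nat, (k == 3) : nat).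

Lemma xeqE x y : xeq x y = (x == y).
Proof.
case: x y => [[a b] c] [[a' b'] c'] /=; rewrite !eqnE.
by apply/and3P/eqP => [[/eqP -> /eqP -> /eqP ->]|[-> -> ->]].
Qed.

Lemma xlookup_map (F : xpn -> bmat) s x : x \in s -> xlookup [seq (y, F y) | y <- s] x = F x.
Proof.
elim: s => [//|y s IH] /=; rewrite inE xeqE.
by case: (eqVneq x y) => [->|_] //= /IH.
Qed.

Lemma mem_xdeg s x : (x \in xdeg s) = (degx x == s).
Proof.
apply/allpairsPdep/idP => [[t [c [+ + ->]]]|].
  by rewrite !mem_iota /degx /=; lia.
case: x => [[a b] c] /eqP <-.
exists (b + c)%N; exists c; rewrite !mem_iota /degx /fst /snd; split; [lia | lia |].
by congr (_, _, _); lia.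
Qed.

Lemma uniq_xdeg s : uniq (xdeg s).
Proof.
apply: allpairs_uniq_dep => [|t _|]; [exact: iota_uniq | exact: iota_uniq |].
move=> [t c] [t' c'] /allpairsPdep [u [v [+ + [-> ->]]]] /allpairsPdep [u' [v' [+ + [-> ->]]]] /=.
rewrite !mem_iota => /andP [_ uh] /andP [_ vh] /andP [_ uh'] /andP [_ vh'] [e1 e2 e3].
have eu : u = u' by lia.
by rewrite eu e3.
Qed.

Lemma xpredP k x y : k \in [:: 1; 2; 3]%N -> (xpred k x == Some y) = (x == addx (unitx k) y).
Proof.
rewrite !inE; case: x y => [[a b] c] [[a' b'] c'] /or3P [] /eqP -> /=.
- by case: a => [|a]; rewrite /addx /unitx /= ?add0n ?add1n.
- by case: b => [|b]; rewrite /addx /unitx /= ?add0n ?add1n // xpair_eqE xpair_eqE andbF.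
- by case: c => [|c]; rewrite /addx /unitx /= ?add0n ?add1n // xpair_eqE andbF.
Qed.

(** Summing over x with x = y + e_k is summing over y. *)
Lemma sum_xdegS (s k : nat) (H : xpn -> xpn -> bool) : k \in [:: 1; 2; 3]%N ->
  \sum_(x <- xdeg s.+1) (if xpred k x is Some y then H x y else 0) =
  \sum_(y <- xdeg s) H (addx (unitx k) y) y.
Proof.
move=> kh; rewrite (bigID (fun x => xpred k x)) /= addrC big1 ?add0r; last first.
  by move=> x; case: (xpred k x).
rewrite -big_filter.
have addxI : injective (addx (unitx k)).
  by move=> [[a b] c] [[a' b'] c'] [] /addnI -> /addnI -> /addnI ->.
rewrite (perm_big [seq addx (unitx k) y | y <- xdeg s]).
  rewrite big_map; apply: eq_bigr => y _.
  by have /eqP -> : xpred k (addx (unitx k) y) == Some y by rewrite xpredP.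
apply: uniq_perm; rewrite ?filter_uniq ?map_inj_uniq ?uniq_xdeg // => x.
rewrite mem_filter mem_xdeg; apply/andP/mapP => [[]|[y]].
  case e: (xpred k x) => [y|//] _ /eqP dx; exists y; last first.
    by apply/eqP; rewrite -xpredP // e.
  have := xpredP x y kh; rewrite e eqxx => /esym /eqP xE; rewrite mem_xdeg -eqSS -dx xE.
  by move: kh; rewrite !inE /degx /= => /or3P [] /eqP -> /=; lia.
rewrite mem_xdeg => /eqP dy ->.
have /eqP -> : xpred k (addx (unitx k) y) == Some y by rewrite xpredP.
split=> //; rewrite -dy; move: kh; rewrite !inE /degx /= => /or3P [] /eqP -> /=; lia.
Qed.

Lemma sum_xpos d (F : xpn -> bool) :
  \sum_(x <- xpos d) F x = \sum_(s < d) \sum_(x <- xdeg s.+1) F x.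
Proof.
rewrite big_flatten big_map.
under eq_bigr => c _ do rewrite big_filter.
rewrite (exchange_big_dep xpredT) //=.
under eq_bigr => x _ do rewrite big_const_seq.
rewrite -(big_mkord xpredT (fun s => \sum_(x <- xdeg s.+1) F x)) /index_iota subn0.
rewrite -(big_map (fun s => xdeg s.+1) xpredT (fun l => \sum_(x <- l) F x)) -big_flatten.
apply: eq_bigr => x _.
have : (xclass x < 3)%N by rewrite ltn_mod.
by case: (xclass x) => [|[|[|]]] //= _; rewrite addr0.
Qed.

Lemma mem_xpos d x : (0 < degx x <= d)%N -> x \in xpos d.
Proof.
move=> dx; apply/flatten_mapP; exists (xclass x); first by rewrite mem_iota ltn_mod.
rewrite mem_filter eqxx /=; apply/flatten_mapP; exists (degx x).-1.
  by rewrite mem_iota; lia.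
by rewrite mem_xdeg; lia.
Qed.

(** The coefficient at X^x, of degree s, of the entry (i, j) of the inverse of
    J + X_1 A_1 + X_2 A_2 + X_3 A_3 modulo 2, as a specification of [layers]. *)
Fixpoint inv_coef (d s : nat) (x : xpn) (i j : nat) : bool :=
  (i < 2 * d)%N *
  if s is s'.+1 then
    \sum_(k <- [:: 1; 2; 3]%N) (if xpred k x is Some y then
       \sum_(l <- supp d k (flip1 i)) inv_coef d s' y l j else 0)
  else (x == (0, 0, 0)%N) * (j == flip1 i).

Lemma bnth_combine A s r j :
  bnth (combine A s r) j = \sum_(l <- s) bnth (brow A l) j + bnth r j.
Proof.
elim: s => [|l s IH] /=; first by rewrite big_nil add0r.
by rewrite bnth_bxor big_cons -addrA -IH.
Qed.

Lemma bnth_unit l j : bnth (unit_bits l) j = (j == l).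
Proof. by elim: l j => [|l IH] [|j] //=; apply: IH. Qed.

Lemma head_layersS adj n w s : head [::] (layers adj n w s.+1) =
  [seq (x, next_mat adj (head [::] (layers adj n w s)) x) | x <- xdeg s.+1].
Proof. by []. Qed.

Lemma layersP d s x i j : degx x = s -> (j < d)%N ->
  bnth (brow (xlookup (head [::] (layers (supps d) (2 * d) d s)) x) i) j = inv_coef d s x i j.
Proof.
elim: s x i j => [|s IH] x i j dx jd.
  have -> : x = (0, 0, 0)%N by case: x dx => [[a b] c]; rewrite /degx /=; case: a b c => [|?] [|?] [|?].
  rewrite /= /brow; case: ltnP => iN; last first.
    by rewrite nth_default ?mul0r // size_map size_iota.
  rewrite (nth_map 0%N) ?size_iota // nth_iota // add0n !mul1r.
  by case: ltnP => fi; rewrite ?bnth_unit //; apply/esym/negbTE/eqP; lia.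
rewrite head_layersS; set L := head [::] _ in IH *.
rewrite xlookup_map ?mem_xdeg ?dx // /next_mat /brow /=.
case: ltnP => iN; last first.
  by rewrite nth_default ?mul0r // !size_map size_iota.
rewrite mul1r (nth_map [::]) ?size_map ?size_iota // (nth_map 0%N) ?size_iota // nth_iota // add0n.
rewrite !bnth_combine addr0 !big_cons big_nil addr0 addrA.
have sh k : k \in [:: 1; 2; 3]%N -> \sum_(l <- supp d k (flip1 i)) bnth (brow (shifted k L x) l) j =
   (if xpred k x is Some y then \sum_(l <- supp d k (flip1 i)) inv_coef d s y l j else 0).
  move=> kh; rewrite /shifted; case e: (xpred k x) => [y|].
    apply: eq_bigr => l _; apply: IH => //.
    have := xpredP x y kh; rewrite e eqxx => /esym /eqP xE; move: dx; rewrite xE.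
    by move: kh; rewrite !inE /degx /= => /or3P [] /eqP -> /=; lia.
  by apply: big1 => l _; rewrite /brow nth_nil.
by rewrite -!sh // addrA.
Qed.

Lemma nth_layers adj n w S s : (s <= S)%N ->
  nth [::] (rev (layers adj n w S)) s = head [::] (layers adj n w s).
Proof.
have sz T : size (layers adj n w T) = T.+1 by elim: T => //= T ->.
elim: S => [|S IH]; first by rewrite leqn0 => /eqP ->.
rewrite leq_eqVlt => /orP [/eqP ->|lt].
  by rewrite nth_rev ?sz // subnn.
by rewrite /= rev_cons nth_rcons size_rev sz ltnS -ltnS lt; apply: IH.
Qed.

Theorem check_sound d (theta : xpn -> bool) : check d ->
  (forall k i j, k \in [:: 1; 2; 3]%N -> (i < 2 * d)%N -> (j < i)%N ->
     \sum_(s < d) \sum_(y <- xdeg s) inv_coef d s y i j * theta (addx (unitx k) y) = 0) ->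
  forall x, (0 < degx x <= d)%N -> theta x = false.
Proof.
rewrite /check; set L := rev _; set o := xpos d; set R := flatten _ => /andP [_ fr] hyp x xd.
pose psi i := theta (nth (0, 0, 0)%N o i).
have xo : x \in o by apply: mem_xpos.
rewrite -(nth_index (0, 0, 0)%N xo) -/(psi _).
apply: (full_rankP fr); last by rewrite index_mem.
pose M k := [seq shifted k (nth [::] L (x0.1.1 + x0.1.2 + x0.2).-1) x0 | x0 <- o].
have row k i j : k \in [:: 1; 2; 3]%N -> (i < 2 * d)%N -> (j < minn i d)%N ->
    dot (size o) psi (bits_of [seq bnth x0 j | x0 <- [seq brow B i | B <- M k]]) == 0.
  move=> kh id_; rewrite leq_min => /andP [ji jd]; rewrite /dot.
  apply/eqP; rewrite -[RHS](hyp k i j kh id_ ji).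
  transitivity (\sum_(y <- o) bnth (brow (shifted k (nth [::] L (degx y).-1) y) i) j * theta y).
    rewrite (big_nth (0, 0, 0)%N) big_mkord; apply: eq_bigr => l _.
    rewrite bnth_bits_of (nth_map BNil) ?size_map // (nth_map [::]) ?size_map //.
    by rewrite (nth_map (0, 0, 0)%N).
  rewrite sum_xpos; apply: eq_bigr => s _.
  rewrite -(sum_xdegS s (fun x y => inv_coef d s y i j * theta x) kh).
  apply: eq_big_seq => y; rewrite mem_xdeg => /eqP dy; rewrite dy /=.
  rewrite /shifted; case e: (xpred k y) => [z|]; last by rewrite /brow nth_nil mul0r.
  rewrite nth_layers ?layersP //; last by have := ltn_ord s; lia.
  have := xpredP y z kh; rewrite e eqxx => /esym /eqP yE; move: dy; rewrite yE.
  by move: kh; rewrite !inE /degx /= => /or3P [] /eqP -> /=; lia.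
have all_flat (T : Type) (Q : pred T) ss : all Q (flatten ss) = all (all Q) ss.
  by elim: ss => //= l ss IHss; rewrite all_cat IHss.
rewrite /R all_flat all_map; apply/allP => i; rewrite mem_iota add0n => /andP [_ iN].
rewrite [preim _ _ _]all_flat all_map; apply/allP => j; rewrite mem_iota add0n => /andP [_ jN].
by rewrite /= !row.
Qed.

(** * Linear pfaffians of degree at most 15 *)

Section Functional.
Variables (R : comNzRingType) (n : nat).
Implicit Types (h : 'X_{1..n} -> R) (p q : {mpoly R[n]}).

Definition functional h p : R := \sum_(m <- msupp p) p@_m * h m.

Lemma functionalwE h p K : (msize p <= K)%N ->
  functional h p = \sum_(m : 'X_{1..n < K}) p@_m * h m.
Proof.
move=> lepK; rewrite /functional (big_mksub 'X_{1..n < K}) /=; first last.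
- by move=> m /msize_mdeg_lt /leq_trans /(_ lepK).
- exact: msupp_uniq.
by rewrite big_rmcond //= => m /memN_msupp_eq0 ->; rewrite mul0r.
Qed.

Lemma functional_linear h : scalar (functional h).
Proof.
move=> c p q; pose K := maxn (msize (c *: p + q)) (maxn (msize p) (msize q)).
rewrite !(@functionalwE h _ K) ?leq_max ?leqnn ?orbT //.
rewrite [c * _]mulr_sumr -big_split; apply: eq_bigr => m _ /=.
by rewrite mcoeffD mcoeffZ mulrDl mulrA.
Qed.
HB.instance Definition _ h :=
  GRing.isLinear.Build R {mpoly R[n]} R _ (functional h) (@functional_linear h).

Lemma functionalX h m : functional h 'X_[m] = h m.
Proof. by rewrite /functional msuppX big_seq1 mcoeffX eqxx mul1r. Qed.

Lemma functional_mulX h i p :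
  functional h ('X_i * p) = functional (fun m => h (U_(i) + m)%MM) p.
Proof.
elim/mpolyind: p => [|c m p _ _ IH]; first by rewrite mulr0 !raddf0.
by rewrite mulrDr !raddfD /= -IH -scalerAr -mpolyXD !linearZ /= !functionalX.
Qed.
End Functional.

Section Homogeneous.
Variables (R : comNzRingType) (m n : nat).
Variables (M : 'M[{mpoly R[m]}]_(2 * n)).
Hypothesis M1 : forall i j, M i j \is 1.-homog.

Lemma dhomog_prod_ord (P : pred 'I_n) (F : 'I_n -> {mpoly R[m]}) :
  (forall i, F i \is 1.-homog) -> \prod_(i < n | P i) F i \is (\sum_(i < n | P i) 1)%N.-homog.
Proof.
move=> F1; elim/big_rec2: _ => [|i e p _ hp]; first exact: dhomog1.
exact: dhomogM.
Qed.

Lemma pf_dhomog : pf M \is n.-homog.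
Proof.
apply: rpred_sum => s _; rewrite mulr_sign.
have H : \prod_(i < n) M (s (ord_even i)) (s (ord_odd i)) \is n.-homog.
  have /(_ xpredT) := @dhomog_prod_ord _ (fun i => M (s (ord_even i)) (s (ord_odd i))).
  by rewrite sum1_card card_ord; apply.
by case: ifP => _; rewrite ?dhomogN.
Qed.

Lemma dpf_dhomog (E : 'M[{mpoly R[m]}]_(2 * n)) : (forall i j, E i j \is 0.-homog) -> dpf M E \is n.-1.-homog.
Proof.
move=> E0; apply: rpred_sum => s _; rewrite mulr_sign.
have H : \sum_(i < n) E (s (ord_even i)) (s (ord_odd i)) *
    \prod_(j < n | j != i) M (s (ord_even j)) (s (ord_odd j)) \is n.-1.-homog.
  apply: rpred_sum => i _; rewrite -[n.-1]add0n; apply: dhomogM => //.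
  have /(_ (fun j => j != i)) := @dhomog_prod_ord _ (fun j => M (s (ord_even j)) (s (ord_odd j))).
  have -> : (\sum_(j < n | j != i) 1)%N = n.-1 by rewrite sum1_card cardC1 card_ord.
  exact.
by case: ifP => _; rewrite ?dhomogN.
Qed.
End Homogeneous.

Section PfFlip.
Variable n : nat.

Lemma matching_perm1 : matching_perm (1%g : 'S_(2 * n)).
Proof.
apply/andP; split; apply/forallP => i; first by rewrite !perm1.
by apply/forallP => j; apply/implyP => ij; rewrite !perm1 /= ltn_mul2l.
Qed.

Lemma flip1_even i : ~~ odd i -> flip1 i = i.+1.
Proof. by rewrite /flip1 => /negbTE ->. Qed.

(** The pfaffian of J is 1 modulo 2: only the identity contributes. *)
Lemma pf_flip : pf (\matrix_(i < 2 * n, l < 2 * n) ((l : nat) == flip1 i) : 'M[bool]_(2 * n)) = 1.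
Proof.
rewrite /pf (bigD1 1%g) ?matching_perm1 //= [X in _ + X]big1 ?addr0 => [|s]; last first.
  case/andP => ms s1.
  rewrite [X in _ * X](_ : _ = 0) ?mulr0 //; apply/eqP; apply: contraNT s1.
  move=> /prodf_neq0 all1; apply/eqP.
  have e i : s (ord_odd i) = flip1 (s (ord_even i)) :> nat.
    by apply/eqP/negPn/negP => /negbTE ne; have := all1 i isT; rewrite mxE ne eqxx.
  have [/forallP lt _] := andP ms.
  have ev i : odd (s (ord_even i)) = false.
    by have := lt i; rewrite e /flip1; case: odd => //; lia.
  pose q i := ord_half (s (ord_even i)).
  have qE i : s (ord_even i) = ord_pair (q i) false by rewrite -(ev i) ord_pairK.
  have q_inj : injective q.
    move=> i j qij; have : s (ord_even i) = s (ord_even j) by rewrite !qE qij.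
    by move/perm_inj => /(@ord_pair_inj _ i false j false) [].
  have sE : s = (pair_move (perm q_inj) [ffun=> false] * 1)%g.
    apply: perm_pairP => i c; rewrite mulg1 pair_moveE ffunE addbF permE.
    case: c; last exact: qE.
    apply: val_inj; rewrite /= e flip1_even ?ev // qE /=; lia.
  have sE' : s = (pair_move 1 [ffun=> false] * s)%g.
    by apply: perm_pairP => i c; rewrite permM pair_moveE perm1 ffunE addbF.
  have [_ o1] := pair_moveK (perm q_inj) [ffun=> false] matching_perm1.
  have [_ o2] := pair_moveK 1 [ffun=> false] ms.
  rewrite -sE in o1; rewrite -sE' in o2.
  rewrite sE -o1 o2 mulg1; apply: perm_pairP => i c.
  by rewrite pair_moveE !perm1 ffunE addbF.
rewrite odd_perm1 expr0 mul1r big1 // => i _; rewrite mxE !perm1 /=.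
by rewrite flip1_even ?eqxx // mul2n odd_double.
Qed.
End PfFlip.

Section Witness.
Variable d : nat.
Local Notation n := (2 * d)%N.

Definition wit_coef (k i l : nat) : int := (l \in lower d k i)%:R - (i \in lower d k l)%:R.

(** The integer lift X_0 J + X_1 A_1 + X_2 A_2 + X_3 A_3 of the witness. *)
Definition wit_mx : 'M[{mpoly int[4]}]_n :=
  \matrix_(i, l) \sum_(k < 4) 'X_k * (wit_coef k i l)%:MP.

Lemma skew_wit_mx : skew_symmetric wit_mx.
Proof.
apply/skewE => i l; rewrite !mxE -sumrN; apply: eq_bigr => k _.
by rewrite /wit_coef -[X in _ = - (_ * X%:MP)]opprB mpolyCN mulrN opprK.
Qed.

Lemma wit_mx_homog i l : wit_mx i l \is 1.-homog.
Proof.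
rewrite mxE; apply: rpred_sum => k _; rewrite mulrC mul_mpolyC; apply: rpredZ.
by rewrite dhomogX /= mdeg1.
Qed.

Definition wit_dpf : 'M[{mpoly int[4]}]_n := \matrix_(j, l) dpf wit_mx (skew_unit _ l j).

Lemma wit_dpf_homog j l : wit_dpf j l \is d.-1.-homog.
Proof.
rewrite mxE; apply: dpf_dhomog => [|a b]; first exact: wit_mx_homog.
by rewrite !mxE rpredB // rpredMn // dhomog1.
Qed.

Lemma char0_mpoly_int : [pchar {mpoly int[4]}] =i pred0.
Proof.
apply/pcharf0P => m; rewrite -mpolyC_nat mpolyC_eq0 pmulrn intr_eq0 //=.
Qed.

(** Reduction modulo 2; [Qb] is the reduced adjoint and [fb] the reduced pfaffian. *)
Let red : {rmorphism {mpoly int[4]} -> {mpoly bool[4]}} := map_mpoly (intmul (1 : bool)).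

Let Qb := map_mx red wit_dpf.
Let fb := red (pf wit_mx).
Let cb (k i l : nat) : bool := (wit_coef k i l)%:~R.

Lemma cbE k i l : cb k i l = (l \in lower d k i) (+) (i \in lower d k l).
Proof. by rewrite /cb /wit_coef; case: (l \in _); case: (i \in _). Qed.

Lemma cb0E i l : cb 0 i l = (l == flip1 i).
Proof.
rewrite cbE /= /flip1.
case: (boolP (odd i)) => oi; case: (boolP (odd l)) => ol; rewrite ?inE ?addbF ?addFb //=.
- by case: eqP => ?; case: eqP => ? //=; lia.
- by case: eqP => ?; case: eqP => ? //=; lia.
by apply/esym/negbTE/eqP; lia.
Qed.

Lemma red_witE (i l : 'I_n) : red (wit_mx i l) = \sum_(k < 4) 'X_k * (cb k i l)%:MP.
Proof.
rewrite mxE raddf_sum; apply: eq_bigr => k _.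
by rewrite /= (rmorphM red) /= map_mpolyX map_mpolyC.
Qed.

Lemma red_adjoint (i j : 'I_n) :
  \sum_(l < n) \sum_(k < 4) 'X_k * (cb k i l)%:MP * Qb l j = fb *+ (i == j).
Proof.
have /matrixP /(_ i j) := congr1 (map_mx red) (pf_adjoint char0_mpoly_int skew_wit_mx).
rewrite map_mxM map_scalar_mx !mxE => <-; apply: eq_bigr => l _.
by rewrite [map_mx red wit_mx i l]mxE red_witE mulr_suml.
Qed.

Lemma fb_dhomog : fb \is d.-homog.
Proof.
apply/dhomogP => m; rewrite mcoeff_msupp mcoeff_map_mpoly => nz.
have /dhomogP -> // := pf_dhomog wit_mx_homog.
by rewrite mcoeff_msupp; apply: contraNneq nz => ->.
Qed.

Lemma Qb_dhomog i j : Qb i j \is d.-1.-homog.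
Proof.
apply/dhomogP => m; rewrite mcoeff_msupp mxE mcoeff_map_mpoly => nz.
have /dhomogP -> // := wit_dpf_homog i j.
by rewrite mcoeff_msupp; apply: contraNneq nz => ->.
Qed.

(** At the vertex X_0 the witness is J. *)
Lemma fb_lead : fb@_(U_(ord0) *+ d)%MM = 1.
Proof.
have := meval_vertex ord0 fb_dhomog; set e0 := fun i : 'I_4 => _; move=> <-.
rewrite /fb -pf_map -pf_map -[RHS](pf_flip d); congr pf.
apply/matrixP => i l; rewrite [LHS]mxE [map_mx red wit_mx i l]mxE red_witE [RHS]mxE raddf_sum.
rewrite (bigD1 ord0) //= [X in _ + X]big1 ?addr0 => [|k k0].
  by rewrite mevalM mevalXU mevalC /e0 eqxx mul1r cb0E.
by rewrite mevalM mevalXU /e0 (negbTE k0) mul0r.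
Qed.

Lemma eq_functional (R : comNzRingType) m (h h' : 'X_{1..m} -> R) p :
  h =1 h' -> functional h p = functional h' p.
Proof. by move=> e; apply: eq_bigr => x _; rewrite e. Qed.

Lemma functional_dhomog (R : comNzRingType) (h : 'X_{1..4} -> R) (p : {mpoly R[4]}) :
  p \is d.-homog -> functional h p = \sum_(t : monomial d) p@_(val t) * h (val t).
Proof.
move=> ph; have szp : (msize p <= d.+1)%N.
  rewrite msizeE; apply/bigmax_leqP_seq => m mp _.
  by have := dhomog_mf ph mp => /= ->.
rewrite (functionalwE _ szp) (bigID (fun m : 'X_{1..4 < d.+1} => mdeg m == d)) /= addrC big1 ?add0r.
  rewrite (reindex_omap (val : monomial d -> 'X_{1..4 < d.+1}) insub) => [|m md].
    by apply: eq_bigl => t; rewrite (valP t) valK eqxx.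
  by rewrite insubT.
by move=> m md; rewrite (dhomog_nemf_coeff ph) ?mul0r.
Qed.

Hypothesis d_gt0 : (0 < d)%N.
Hypothesis check_d : check d.
Variable vv : monomial d -> bool.
Hypothesis vv_kills : forall (k : 'I_4) (i j : 'I_n),
  \sum_(t : monomial d) ('X_k * Qb i j)@_(val t) * vv t = 0.

Definition tailx (m : 'X_{1..4}) : xpn := (m (inord 1), m (inord 2), m (inord 3)).

(** A monomial of degree d is determined by its exponents in X_1, X_2, X_3. *)
Lemma mdeg_tailx m : (mdeg m = m ord0 + degx (tailx m))%N.
Proof.
rewrite mdegE !big_ord_recl big_ord0 /degx /= addn0 -!addnA.
by do !congr (_ + _)%N; congr (m _); apply: val_inj; rewrite /= inordK.
Qed.

Lemma tailx_inj m m' : mdeg m = mdeg m' -> tailx m = tailx m' -> m = m'.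
Proof.
move=> dm tm; have m0 : m ord0 = m' ord0 by move: dm; rewrite !mdeg_tailx tm => /addIn.
case: tm => m1 m2 m3; apply/mnmP => i.
have [->|[->|[->|->]]] : i = ord0 \/ i = inord 1 \/ i = inord 2 \/ i = inord 3 => //.
case: i => [[|[|[|[|]]]]] // ih; [left | right; left | right; right; left | right; right; right];
  by apply: val_inj; rewrite /= ?inordK.
Qed.

Lemma tailxD (k : 'I_4) m : tailx (U_(k) + m)%MM = addx (unitx k) (tailx m).
Proof.
rewrite /tailx /addx /unitx !mnmDE !mnm1E /=.
by congr (_ + _, _ + _, _ + _)%N; congr (nat_of_bool _); rewrite -val_eqE /= inordK.
Qed.

Let psi x : bool := \sum_(t : monomial d | tailx (val t) == x) vv t.
Let at_ x (m : 'X_{1..4}) : bool := psi (addx x (tailx m)).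
Let theta x := functional (at_ x) fb.
Let U (i j : 'I_n) x := functional (at_ x) (Qb i j).

Lemma addxC : commutative addx.
Proof. by move=> [[a b] c] [[a' b'] c']; rewrite /addx /= ![(_ + a)%N]addnC ![(_ + b)%N]addnC ![(_ + c)%N]addnC. Qed.
Lemma addxA : associative addx.
Proof. by move=> [[a b] c] [[a' b'] c'] [[a'' b''] c'']; rewrite /addx /= !addnA. Qed.
Lemma degxD x y : degx (addx x y) = (degx x + degx y)%N.
Proof. by rewrite /degx /addx /=; lia. Qed.
Lemma add0x x : addx (0, 0, 0)%N x = x.
Proof. by case: x => [[]]. Qed.

Lemma psi_big x : (d < degx x)%N -> psi x = 0.
Proof.
move=> dx; rewrite /psi big_pred0 // => t; apply/eqP => e.
have /eqP := valP t; rewrite mdeg_tailx e; lia.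
Qed.

Lemma psi_tail (t : monomial d) : psi (tailx (val t)) = vv t.
Proof.
rewrite /psi (big_pred1 t) // => t'; apply/eqP/eqP => [e|-> //].
apply: val_inj; apply: val_inj; apply: tailx_inj e.
by rewrite (eqP (valP t)) (eqP (valP t')).
Qed.

Lemma at_mulX (k : 'I_4) x p :
  functional (at_ x) ('X_k * p) = functional (at_ (addx x (unitx k))) p.
Proof.
rewrite functional_mulX; apply: eq_functional => m.
by rewrite /at_ tailxD addxA.
Qed.

(** The hypothesis that the form kills X_k P_ij, for all k including 0. *)
Lemma U_unitx (k : 'I_4) i j : U i j (unitx k) = 0.
Proof.
rewrite /U -[unitx k]add0x -at_mulX functional_dhomog; last first.
  have hX : ('X_k : {mpoly bool[4]}) \is 1.-homog by rewrite dhomogX /= mdeg1.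
  by have := dhomogM hX (Qb_dhomog i j); rewrite add1n prednK.
rewrite -[RHS](vv_kills k i j); apply: eq_bigr => t _.
by rewrite /at_ add0x psi_tail.
Qed.

(** The linear form applied to M P = pf M. Here and below, U i j x and theta x are
    the values of the dehomogenized form on X^x P_ij and on X^x pf M. *)
Lemma U_rel (i j : 'I_n) x :
  \sum_(l < n) \sum_(k < 4) cb k i l * U l j (addx x (unitx k)) = (i == j) * theta x.
Proof.
have := congr1 (functional (at_ x)) (red_adjoint i j).
rewrite raddf_sum raddfMn /= -mulr_natl (_ : (i == j)%:R = (i == j)); last by case: (i == j).
move=> <-; apply: eq_bigr => l _; rewrite raddf_sum; apply: eq_bigr => k _ /=.
by rewrite /U -at_mulX [in RHS]mulrAC [in RHS]mulrC mul_mpolyC linearZ.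
Qed.

Lemma U_big i j x : (d < degx x)%N -> U i j x = 0.
Proof.
move=> dx; rewrite /U /functional big1 // => m _.
by rewrite /at_ psi_big ?mulr0 // degxD ltn_addr.
Qed.

Let Un (l : nat) j x : bool := oapp (fun l' : 'I_n => U l' j x) 0 (insub l).

Lemma supp_sum k (i : 'I_n) (F : nat -> bool) :
  \sum_(l <- supp d k i) F l = \sum_(l < n) cb k i l * F l.
Proof.
rewrite /supp big_filter -[2 * d as X in iota 0 X]subn0 -/(index_iota 0 (2 * d)) big_mkord big_mkcond.
by apply: eq_bigr => l _; rewrite cbE; case: (_ (+) _); rewrite ?mul1r ?mul0r.
Qed.

Lemma flip1_ltn i : (i < n)%N -> (flip1 i < n)%N.
Proof.
by rewrite /flip1; case: (boolP (odd i)) => oi; lia.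
Qed.

Lemma flip1K i : flip1 (flip1 i) = i.
Proof.
rewrite {2}/flip1; case: (boolP (odd i)) => oi; rewrite /flip1; case: (boolP (odd _)); lia.
Qed.

(** Solving M P = pf M for the term containing J. *)
Lemma U_step (i j : 'I_n) x :
  U i j x = (j == flip1 i :> nat) * theta x +
    \sum_(k <- [:: 1; 2; 3]%N) \sum_(l <- supp d k (flip1 i)) Un l j (addx x (unitx k)).
Proof.
pose i' := Ordinal (flip1_ltn (ltn_ord i)).
have := U_rel i' j x; rewrite exchange_big big_ord_recl.
have -> : \sum_(l < n) cb (ord0 : 'I_4) i' l * U l j (addx x (unitx (ord0 : 'I_4))) = U i j x.
  rewrite (bigD1 i) //= big1 ?addr0 => [|l li].
    by rewrite addxC add0x cb0E flip1K eqxx mul1r.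
  by rewrite cb0E /= flip1K -val_eqE /= in li *; rewrite (negbTE li) mul0r.
have -> : (i' == j) = (j == flip1 i :> nat) by rewrite eq_sym -val_eqE.
move/eqP; rewrite -[_ == _]/(_ == _ :> bool) => /eqP <-.
rewrite -addrA [X in U i j x + X](_ : _ = 0) ?addr0 //.
have -> : \sum_(k <- [:: 1; 2; 3]%N) \sum_(l <- supp d k (flip1 i)) Un l j (addx x (unitx k)) =
    \sum_(k < 3) \sum_(l < n) cb (lift ord0 k) i' l * U l j (addx x (unitx (lift ord0 k))).
  rewrite !big_cons big_nil !big_ord_recl big_ord0 !addr0.
  by congr (_ + (_ + _)); rewrite (supp_sum _ i'); apply: eq_bigr => l _; rewrite /Un valK.
exact: addbb.
Qed.

(** Iterating [U_step] expresses P_ij through pf M and the inverse of M; the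
    remainder vanishes for degree reasons. *)
Lemma U_unroll r (i j : 'I_n) x : (d < degx x + r)%N ->
  U i j x = \sum_(s < r) \sum_(y <- xdeg s) inv_coef d s y i j * theta (addx x y).
Proof.
elim: r i x => [|r IH] i x dx.
  by rewrite big_ord0 U_big // -[degx x]addn0.
rewrite U_step big_ord_recl; congr (_ + _).
  rewrite /= /xdeg /= big_seq1 /= ltn_ord eqxx !mul1r.
  by rewrite addxC add0x.
have step k : k \in [:: 1; 2; 3]%N ->
    \sum_(l <- supp d k (flip1 i)) Un l j (addx x (unitx k)) =
    \sum_(s < r) \sum_(y <- xdeg s) (\sum_(l <- supp d k (flip1 i)) inv_coef d s y l j) * theta (addx x (addx (unitx k) y)).
  move=> kh.
  transitivity (\sum_(l <- supp d k (flip1 i)) \sum_(s < r) \sum_(y <- xdeg s)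
     inv_coef d s y l j * theta (addx x (addx (unitx k) y))).
    apply: eq_big_seq => l; rewrite mem_filter mem_iota => /andP [_ /andP [_ ln]].
    rewrite /Un insubT /= IH.
      by apply: eq_bigr => s _; apply: eq_bigr => y _; rewrite addxA.
    rewrite degxD; move: kh dx; rewrite !inE => /or3P [] /eqP ->; rewrite /degx /=; lia.
  rewrite exchange_big; apply: eq_bigr => s _ /=.
  by rewrite exchange_big; apply: eq_bigr => y _; rewrite mulr_suml.
transitivity (\sum_(s < r) \sum_(k <- [:: 1; 2; 3]%N) \sum_(y <- xdeg s)
    (\sum_(l <- supp d k (flip1 i)) inv_coef d s y l j) * theta (addx x (addx (unitx k) y))).
  by rewrite exchange_big; apply: eq_big_seq => k kh; rewrite step.
apply: eq_bigr => s _.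
rewrite !lift0.
under [RHS]eq_bigr => y _ do rewrite [inv_coef _ _ _ _ _]/= ltn_ord mul1r mulr_suml.
rewrite [RHS]exchange_big; apply: eq_big_seq => k kh /=.
rewrite -(sum_xdegS s (fun y z => (\sum_(l <- supp d k (flip1 i)) inv_coef d s z l j) * theta (addx x y)) kh).
by apply: eq_bigr => y _; case: (xpred k y) => [z|]; rewrite ?mul0r.
Qed.

(** In positive degree, the hypothesis and [U_unroll] give the equations tested by
    [check]. In degree 0, M P = pf M writes pf M through the products X_k P_ij. *)
Lemma theta0 x : theta x = 0.
Proof.
have small y : (0 < degx y <= d)%N -> theta y = false.
  apply: (check_sound check_d) => k i j kh iN ji; have jN := ltn_trans ji iN.
  have k4 : (k < 4)%N by move: kh; rewrite !inE => /or3P [] /eqP ->.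
  rewrite -[RHS](U_unitx (Ordinal k4) (Ordinal iN) (Ordinal jN)).
  rewrite (@U_unroll d) //=; move: kh; rewrite !inE => /or3P [] /eqP ->; rewrite /degx /=; lia.
case: (ltnP d (degx x)) => [dx|dx].
  rewrite /theta /functional big1 // => m _.
  by rewrite /at_ psi_big ?mulr0 // degxD ltn_addr.
case: (posnP (degx x)) => [x0|x0]; last by apply: small; rewrite x0.
have -> : x = (0, 0, 0)%N by case: x x0 {dx} => [[a b] c]; rewrite /degx /=; case: a b c => [|?] [|?] [|?].
have n0 : (0 < n)%N by rewrite muln_gt0.
have := U_rel (Ordinal n0) (Ordinal n0) (0, 0, 0)%N; rewrite eqxx mul1r => <-.
rewrite big1 // => l _; rewrite big1 // => k _; by rewrite add0x U_unitx mulr0.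
Qed.

Lemma tailx_lead e : tailx (U_(ord0) *+ e)%MM = (0, 0, 0)%N.
Proof. by rewrite /tailx !mulmnE !mnm1E -!val_eqE /= !inordK // !mul0n. Qed.

(** pf M is X_0^d plus terms of positive degree in X_1, X_2, X_3, so the values on
    the multiples of pf M determine the form, by descending induction on degree. *)
Lemma psi0 x : psi x = 0.
Proof.
have [r] : exists r, (d < degx x + r)%N by exists d.+1; lia.
elim: r x => [|r IH] x dx; first by apply: psi_big; rewrite -[degx x]addn0.
have := theta0 x; rewrite /theta /functional.
have lead_in : (U_(ord0) *+ d)%MM \in msupp fb by rewrite mcoeff_msupp fb_lead.
rewrite (big_rem _ lead_in) /= fb_lead mul1r [X in _ + X]big_seq [X in _ + X]big1 ?addr0.
  by rewrite /at_ tailx_lead addxC add0x.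
move=> m; rewrite mem_rem_uniq ?msupp_uniq // inE => /andP [ne mf].
rewrite /at_ IH ?mulr0 // degxD.
suff : (0 < degx (tailx m))%N by move: dx; lia.
rewrite lt0n; apply: contraNneq ne => t0; apply/eqP.
have dm : mdeg m = d by apply: (dhomog_mf fb_dhomog).
apply: tailx_inj; first by rewrite dm mdegMn mdeg1 mul1n.
rewrite tailx_lead.
by case: (tailx m) t0 => [[a b] c]; rewrite /degx /=; case: a b c => [|?] [|?] [|?].
Qed.

(** Hence the products X_k P_ij span all forms of degree d modulo 2. *)
Lemma wit_kernel t : vv t = 0.
Proof. by rewrite -psi_tail psi0. Qed.
End Witness.

Lemma map_mpoly_mulX (R S : comNzRingType) (h : {rmorphism R -> S}) n (i : 'I_n) (p : {mpoly R[n]}) :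
  map_mpoly h ('X_i * p) = 'X_i * map_mpoly h p.
Proof. by rewrite rmorphM /= map_mpolyX. Qed.

Section Minor.
Variable d : nat.
Hypotheses (d_gt0 : (0 < d)%N) (check_d : check d).
Local Notation n := (2 * d)%N.
Local Notation N := #|monomial d|.
Local Notation dir := ('I_4 * 'I_n * 'I_n)%type.

Definition wit_jac (a : dir) (b : 'I_N) : int :=
  ('X_a.1.1 * wit_dpf d a.1.2 a.2)@_(val (enum_val b)).

(** Full rank modulo 2 gives a minor that is odd, in particular nonzero. *)
Lemma wit_minor : exists f : 'I_N -> dir, \det (\matrix_(a, b) wit_jac (f a) b) != 0.
Proof.
pose J : 'M[int]_(#|{: dir}|, N) := \matrix_(a, b) wit_jac (enum_val a) b.
pose Jb : 'M[bool]_(#|{: dir}|, N) := map_mx (intmul 1) J.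
have full : row_full Jb.
  rewrite -[Jb]trmxK -[row_full _]/(\rank (Jb^T^T) == N) mxrank_tr -/(row_free Jb^T) -kermx_eq0.
  apply/eqP/row_matrixP => r; rewrite row0.
  have /eqP vJ : row r (kermx Jb^T) *m Jb^T == 0 by rewrite -row_mul mulmx_ker row0.
  apply/rowP => b; rewrite [RHS]mxE -[b]enum_valK.
  pose vv (t : monomial d) : bool := row r (kermx Jb^T) 0 (enum_rank t).
  apply: (@wit_kernel d d_gt0 check_d vv) => k i j.
  have /rowP /(_ (enum_rank (k, i, j))) := vJ; rewrite [RHS]mxE => vJk; rewrite -[RHS]vJk [RHS]mxE.
  rewrite (reindex _ (onW_bij _ (@enum_val_bij (monomial d)))) /=; apply: eq_bigr => c _.
  rewrite mulrC /vv enum_valK; congr (_ * _).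
  by rewrite !mxE /wit_jac enum_rankK /= -map_mpoly_mulX mcoeff_map_mpoly mxE.
exists (fun a => enum_val (fullrankfun full a)).
have := fullrowsub_unit full; rewrite unitmxE unitfE.
apply: contraNneq => det0; rewrite (_ : rowsub _ Jb = map_mx (intmul 1) (\matrix_(a, b) wit_jac (enum_val (fullrankfun full a)) b)).
  by rewrite det_map_mx det0.
by apply/matrixP => a b; rewrite !mxE.
Qed.
End Minor.

Section General.
Variable k : closedFieldType.
Hypothesis char0 : [pchar k] =i pred0.

Lemma intr_eq0_char0 (z : int) : (z%:~R == 0 :> k) = (z == 0).
Proof.
have /pcharf0P nat0 := char0.
by case: z => m; rewrite ?NegzE ?mulrNz ?oppr_eq0 -pmulrn nat0.
Qed.

Lemma map_mpoly_deriv (R S : nzRingType) (h : {additive R -> S}) n (p : {mpoly R[n]}) i :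
  (map_mpoly h p)^`M(i) = map_mpoly h (p^`M(i)).
Proof. by apply/mpolyP => m; rewrite mcoeff_deriv !mcoeff_map_mpoly mcoeff_deriv raddfMn. Qed.

Section Degree.
Variable d : nat.
Hypotheses (d_gt0 : (0 < d)%N) (check_d : check d).
Local Notation n := (2 * d)%N.
Local Notation N := #|monomial d|.
Local Notation S := {mpoly k[4]}.

Let toS : {rmorphism {mpoly int[4]} -> S} := map_mpoly (intmul (1 : k)).

(** Deform the witness in the directions X_k (E_lj - E_jl) that index the nonzero
    minor; at the witness, the Jacobian matrix of the coefficients of the pfaffian
    is this minor. *)
Lemma pf_family_open : exists2 g : {mpoly k[N]}, g != 0 & forall y, g.@[y] != 0 ->
  exists2 M : 'M[S]_n, skew_symmetric M /\ (forall i j, M i j \is 1.-homog) &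
    forall b : 'I_N, (pf M)@_(val (enum_val b)) = y b.
Proof.
have [f detf] := wit_minor d_gt0 check_d.
pose E (a : 'I_N) : 'M[S]_n := 'X_(f a).1.1 *: skew_unit _ (f a).2 (f a).1.2.
pose M0 := map_mx toS (wit_mx d).
pose Mt : 'M[{mpoly S[N]}]_n := map_mx (@mpolyC N S) M0 + \sum_a 'X_a *: map_mx (@mpolyC N S) (E a).
have MtE i j : Mt i j = (M0 i j)%:MP + \sum_a 'X_a * (E a i j)%:MP.
  rewrite [LHS]mxE [X in X + _ = _]mxE summxE; congr (_ + _).
  by apply: eq_bigr => a _; rewrite mxE [X in _ * X = _]mxE.
pose F (b : 'I_N) : {mpoly k[N]} := map_mpoly (mcoeff (val (enum_val b : monomial d))) (pf Mt).
pose Mv (v : 'I_N -> k) : 'M[S]_n := M0 + \sum_a (v a)%:MP *: E a.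
have F_eval b v : (F b).@[v] = (pf (Mv v))@_(val (enum_val b : monomial d)).
  have -> : pf (Mv v) = (pf Mt).@[fun a => (v a)%:MP].
    rewrite -pf_map; congr pf; apply/matrixP => i j.
    rewrite [RHS]mxE MtE /= mevalD mevalC [LHS]mxE summxE raddf_sum; congr (_ + _).
    by apply: eq_bigr => a _; rewrite /= mevalM mevalXU mevalC mxE.
  rewrite /F !mevalE; set p := pf Mt.
  pose K := maxn (msize p) (msize (map_mpoly (mcoeff (val (enum_val b : monomial d))) p)).
  have ev (R : comNzRingType) (q : {mpoly R[N]}) (w : 'I_N -> R) : (msize q <= K)%N ->
      \sum_(m <- msupp q) q@_m * \prod_i w i ^+ m i = \sum_(m : 'X_{1..N < K}) q@_m * \prod_i w i ^+ m i.
    by move=> le; rewrite -(functionalwE (fun m => \prod_i w i ^+ (m : 'X_{1..N}) i) le).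
  rewrite !ev ?leq_max ?leqnn ?orbT // [RHS]raddf_sum; apply: eq_bigr => m _ /=.
  rewrite mcoeff_map_mpoly (_ : \prod_i (v i)%:MP ^+ m i = (\prod_i v i ^+ m i)%:MP).
    by rewrite [_ * _%:MP]mulrC mul_mpolyC mcoeffZ mulrC.
  by rewrite rmorph_prod; apply: eq_bigr => i _; rewrite rmorphXn.
have jacF : \det (\matrix_(b, a) (F b)^`M(a)) != 0.
  have : \det (map_mx (meval (fun=> 0)) (\matrix_(b, a) (F b)^`M(a))) != 0 :> k.
    rewrite (_ : map_mx _ _ = (map_mx (intmul 1) (\matrix_(a, b) wit_jac (f a) b))^T).
      by rewrite det_tr det_map_mx intr_eq0_char0.
    apply/matrixP => b a; rewrite !mxE /F map_mpoly_deriv.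
    have ev0 (R : comNzRingType) (q : {mpoly R[N]}) : q.@[fun=> 0] = q@_0%MM.
      rewrite mevalE; case: (boolP (0%MM \in msupp q)) => q0.
        rewrite (big_rem _ q0) /= [X in _ + X]big_seq [X in _ + X]big1 ?addr0.
          by rewrite big1 ?mulr1 // => i _; rewrite mnm0E.
        move=> m; rewrite mem_rem_uniq ?msupp_uniq // inE => /andP [m0 _].
        have [i mi] : exists i, m i != 0%N.
          by apply/existsP; apply: contraNT m0 => /existsPn m0; apply/eqP/mnmP => i; rewrite mnm0E; apply/eqP/negPn.
        by rewrite (bigD1 i) //= expr0n (negbTE mi) mul0r mulr0.
      rewrite (memN_msupp_eq0 q0) big_seq big1 // => m mq.
      have [i mi] : exists i, m i != 0%N.
        apply/existsP; apply: contraNT q0 => /existsPn m0; suff <- : m = 0%MM by [].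
        by apply/mnmP => i; rewrite mnm0E; apply/eqP/negPn.
      by rewrite (bigD1 i) //= expr0n (negbTE mi) mul0r mulr0.
    rewrite ev0 mcoeff_map_mpoly -ev0.
    pose D : {additive {mpoly S[N]} -> {mpoly S[N]}} := mderiv a.
    rewrite -[(pf Mt)^`M(a)]/(D (pf Mt)) derivation_pf; last exact: mderivM.
    rewrite -dpf_map (_ : map_mx _ Mt = M0); last first.
      apply/matrixP => i j; rewrite [LHS]mxE MtE /= mevalD mevalC raddf_sum [X in _ + X]big1 ?addr0 // => c _.
      by rewrite /= mevalM mevalXU mul0r.
    rewrite (_ : map_mx _ (map_mx D Mt) = E a); last first.
      apply/matrixP => i j; rewrite [LHS]mxE [map_mx D Mt i j]mxE /D /= MtE mderivD mderivC add0r.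
      have dX c : ('X_c * (E c i j)%:MP)^`M(a) = ((E c i j) *+ (c == a))%:MP :> {mpoly S[N]}.
        rewrite mderivM mderivC mulr0 addr0 mderivX mnm1E.
        case: (eqVneq c a) => [->|_]; last by rewrite scale0r mul0r.
        rewrite scale1r (_ : (U_(a) - U_(a) = 0)%MM) ?mpolyX0 ?mul1r //.
        by apply/mnmP => l; rewrite mnmBE subnn mnm0E.
      rewrite (raddf_sum (mderiv a)) (eq_bigr _ (fun c _ => dX c)) -(raddf_sum (@mpolyC N S)) mevalC.
      by rewrite (bigD1 a) //= eqxx big1 ?addr0 // => c /negbTE ->.
    rewrite /E linearZ /=.
    have -> : dpf M0 (skew_unit S (f a).2 (f a).1.2) = toS (wit_dpf d (f a).1.2 (f a).2).
      rewrite [wit_dpf _ _ _]mxE -dpf_map; congr dpf.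
      by rewrite /skew_unit map_mxB !map_delta_mx.
    by rewrite /wit_jac -mcoeff_map_mpoly rmorphM /= map_mpolyX.
  apply: contraNneq => J0; by rewrite det_map_mx J0 raddf0.
have [g g0 gP] := jacobian_open_image char0 jacF; exists g => // y /gP [v vP].
exists (Mv v); last by move=> b; rewrite -F_eval vP.
have skE a i j : E a i j = - E a j i by rewrite !mxE ![(j == _) && _]andbC; ring.
split.
  apply/skewE => i j; rewrite [LHS]mxE [X in _ = - X]mxE !summxE opprD; congr (_ + _).
    by have /skewE e := skew_wit_mx d; rewrite [LHS]mxE [M0 j i]mxE e rmorphN.
  by rewrite -sumrN; apply: eq_bigr => a _; rewrite [in LHS]mxE skE [in RHS]mxE mulrN.
move=> i j; rewrite mxE summxE; apply: rpredD.
  rewrite mxE; apply/dhomogP => m; rewrite mcoeff_msupp mcoeff_map_mpoly => nz.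
  have /dhomogP -> // := wit_mx_homog i j.
  by rewrite mcoeff_msupp; apply: contraNneq nz => ->.
apply: rpred_sum => a _; rewrite mxE mul_mpolyC; apply: rpredZ; rewrite !mxE.
set p := _ - _; have hp : p \is 0.-homog by rewrite /p rpredB // rpredMn // dhomog1.
have hX : ('X_(f a).1.1 : S) \is 1.-homog by rewrite dhomogX /= mdeg1.
exact: (dhomogM hX hp).
Qed.

Lemma dhomog_ext (p q : S) : p \is d.-homog -> q \is d.-homog ->
  (forall b : 'I_N, p@_(val (enum_val b)) = q@_(val (enum_val b))) -> p = q.
Proof.
move=> ph qh e; apply/mpolyP => m; case: (eqVneq (mdeg m) d) => [dm|dm]; last first.
  by rewrite !(@dhomog_nemf_coeff _ _ mdeg d).
have lt : (mdeg m < d.+1)%N by rewrite dm.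
pose t : monomial d := exist _ (BMultinom lt) (introT eqP dm).
by have := e (enum_rank t); rewrite enum_rankK.
Qed.

(** The polynomial g of [pf_family_open] need not be homogeneous, so the open
    set is defined by its homogeneous components. If one of them is nonzero at T,
    then g is nonzero at some multiple of the coordinates of T. *)
Lemma general_linear_pfaffian :
  for_general_surface (fun S : surface k d => linear_pfaffian S).
Proof.
have [g g0 gP] := pf_family_open.
have gE : g = \sum_(i < msize g) pihomog mdeg i g by apply: pihomog_partitionE.
pose G (h : {mpoly k[N]}) := exists e, h = pihomog mdeg e g.
exists (fun S => exists2 h, G h & h.@[coords S] != 0); split.
- exists G; split => [h [e ->]|//].
  by apply/homogP; exists e; apply: pihomogP.
- have [e ge] : exists e : nat, pihomog mdeg e g != 0.
    apply: NNPP => none; case/eqP: g0.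
    rewrite gE big1 // => i _.
    by apply/eqP/negPn/negP => gi; apply: none; exists (i : nat).
  have lt : (mdeg ((U_(ord0) *+ d)%MM : 'X_{1..4}) < d.+1)%N by rewrite mdegMn mdeg1 mul1n.
  have dm : mdeg ((U_(ord0) *+ d)%MM : 'X_{1..4}) == d by rewrite mdegMn mdeg1 mul1n.
  pose b0 : 'I_N := enum_rank (exist _ (BMultinom lt) dm : monomial d).
  have [|y] := @exists_mnonroot k char0 N (pihomog mdeg e g * 'X_b0).
    rewrite mulf_neq0 // -msupp_eq0 msuppX //.
  rewrite mevalM mevalXU mulf_eq0 negb_or => /andP [gy yb].
  have [T TE] := surface_of_coords yb.
  exists T, (pihomog mdeg e g); first by exists e.
  by rewrite (meval_eq (v2 := y)).
move=> T [_ [e ->]] ge; set y := coords T in ge.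
(* The restriction of g to the multiples of the coordinates of T. *)
pose q : {poly k} := \sum_(i < msize g) (pihomog mdeg i g).@[y] *: 'X^i.
have qE c : q.[c] = g.@[fun b => c * y b].
  rewrite [in RHS]gE raddf_sum horner_sum.
  apply: eq_bigr => i _; rewrite hornerZ hornerXn /=.
  by rewrite (meval_scale _ _ (pihomogP mdeg i g)) mulrC.
have q0 : q != 0.
  apply: contraNneq ge => q0; have : q`_e = 0 by rewrite q0 coef0.
  rewrite /q coef_sum; case: (ltnP e (msize g)) => [lt|le].
    rewrite (bigD1 (Ordinal lt)) //= coefZ coefXn eqxx mulr1 big1 ?addr0 => [-> //|i ie].
    by rewrite coefZ coefXn [e == _]eq_sym (_ : (i == e :> nat) = false) ?mulr0 //; apply/negbTE.
  rewrite (_ : pihomog mdeg e g = 0) ?meval0 //.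
  rewrite pihomogE big_seq_cond big1 // => m /andP [mg /eqP me].
  by have := msize_mdeg_lt mg; rewrite me ltnNge le.
have [c] : exists c, (q * 'X).[c] != 0.
  by apply: exists_nonroot => //; rewrite mulf_neq0 // polyX_eq0.
rewrite hornerM hornerX mulf_eq0 negb_or => /andP [qc c0].
rewrite qE in qc; have [M [sM M1] Mc] := gP _ qc.
exists M; split => //; exists c^-1; first by rewrite invr_eq0.
apply: dhomog_ext; first exact: (valP (surface_form T)).
  by apply: rpredZ; apply: pf_dhomog.
by move=> b; rewrite mcoeffZ Mc mulKf.
Qed.
End Degree.
End General.

(** * A normal form for tuples of skew matrices *)

Lemma card_monomial d : ('C(d + 3, 3) <= #|monomial d|)%N.
Proof.
pose s := [seq bmnm (val t) | t <- enum (monomial d)].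
have -> : #|monomial d| = size s by rewrite size_map -cardE.
rewrite -bin_sub ?leq_addl // addnK -(size_basis 3 d).
apply: uniq_leq_size (uniq_basis _ _) _ => m; rewrite -basis_cover => dm.
have lt : (mdeg m < d.+1)%N by rewrite (eqP dm).
by apply/mapP; exists (exist _ (BMultinom lt) dm); rewrite // mem_enum.
Qed.

Section Slice.
Variable d : nat.
Local Notation n := (2 * d)%N.

(** Positions 0 < a < b, with [b] the first component and a - 1 the second one: the free entries of
    a skew matrix with vanishing first row. *)
Definition pair_ix := {b : 'I_n & 'I_(b.-1)}.
(** The parameters of the normal form: lambda, mu, the Hankel sequence and two skew
    matrices with vanishing first row. *)
Definition slice_ix := option (option ('I_n + (pair_ix + pair_ix))).

Lemma card_slice_ix : (0 < d)%N -> #|{: slice_ix}| = (2 + n + 2 * 'C(n.-1, 2))%N.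
Proof.
move=> d0; have cp : #|{: pair_ix}| = 'C(n.-1, 2).
  rewrite card_tagged sumnE big_map big_enum /=.
  under eq_bigr => b _ do rewrite card_ord.
  have [m nE] : exists m, n = m.+1 by exists n.-1; rewrite prednK // muln_gt0.
  by rewrite nE big_ord_recl /= add0n -bin2_sum big_mkord.
by rewrite !card_option !card_sum card_ord cp; lia.
Qed.

Section Def.
Variable A : comNzRingType.
Implicit Types (h : nat -> A) (g : pair_ix -> A) (p : slice_ix -> A).

(** The matrix with entries plus or minus h (i + i') at the pairs (2i, 2i'+1) and
    (2i+1, 2i'), and 0 at pairs of equal parity: the matrix of M_0 in a Krylov
    basis, where h m is the pairing of e and T^m f. *)
Definition hankel h (a b : nat) : A :=
  if odd a == odd b then 0 else (-1) ^+ odd a * h (a./2 + b./2)%N.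

Definition upper g (a b : 'I_n) : A :=
  if (0 < a)%N then oapp (fun x : 'I_(b.-1) => g (Tagged _ x)) 0 (insub a.-1) else 0.

Definition skew_of g : 'M[A]_n := \matrix_(a, b) (upper g a b - upper g b a).

Definition slice_h p (m : nat) : A := oapp (fun i : 'I_n => p (Some (Some (inl i)))) 0 (insub m).

(** The normal form of a tuple (M_0, M_1, M_2, M_3). In the last case the first
    summand puts mu times the second row of M_0 into the first row, and its
    negative into the first column. *)
Definition slice p (k : 'I_4) : 'M[A]_n :=
  let lam := p None in let mu := p (Some None) in let h := slice_h p in
  match val k with
  | 0 => \matrix_(a, b) hankel h a b
  | 1 => \matrix_(a, b) (mu * hankel (h \o S) a b)
  | 2 => \matrix_(a, b) (lam * hankel h a b) + skew_of (fun x => p (Some (Some (inr (inl x)))))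
  | _ => \matrix_(a, b) (mu * (((a : nat) == 0)%:R * hankel h 1 b - ((b : nat) == 0)%:R * hankel h 1 a))
         + skew_of (fun x => p (Some (Some (inr (inr x)))))
  end.

Definition pencil (M : 'I_4 -> 'M[A]_n) : 'M[{mpoly A[4]}]_n :=
  \matrix_(a, b) \sum_(k < 4) 'X_k * (M k a b)%:MP.
End Def.

Section Map.
Variables (A B : comNzRingType) (phi : {rmorphism A -> B}).

Lemma map_hankel (h : nat -> A) a b : phi (hankel h a b) = hankel (phi \o h) a b.
Proof.
by rewrite /hankel; case: ifP => _; rewrite ?rmorph0 // rmorphM rmorphXn rmorphN1.
Qed.

Lemma map_skew_of (g : pair_ix -> A) : map_mx phi (skew_of g) = skew_of (phi \o g).
Proof.
apply/matrixP => a b; rewrite !mxE rmorphB /upper.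
by congr (_ - _); case: ifP => _; rewrite ?rmorph0 //; case: insubP => [x|] *; rewrite ?rmorph0.
Qed.

Lemma map_slice_h p m : phi (slice_h p m) = slice_h (phi \o p) m.
Proof. by rewrite /slice_h; case: insubP => [x|] *; rewrite /= ?rmorph0. Qed.

Lemma eq_hankel (h h' : nat -> A) a b : h =1 h' -> hankel h a b = hankel h' a b.
Proof. by move=> e; rewrite /hankel e. Qed.

Lemma map_slice p k : map_mx phi (slice p k) = slice (phi \o p) k.
Proof.
have hE a b : hankel (phi \o slice_h p) a b = hankel (slice_h (phi \o p)) a b.
  by rewrite /hankel /= map_slice_h.
rewrite /slice; case: k => [[|[|[|[|]]]] //= _].
- by apply/matrixP => a b; rewrite !mxE map_hankel hE.
- by apply/matrixP => a b; rewrite !mxE (rmorphM phi) map_hankel /hankel /= map_slice_h.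
- rewrite map_mxD map_skew_of; congr (_ + _).
  apply/matrixP => a b; rewrite !mxE -hE -map_hankel; exact: rmorphM.
rewrite map_mxD map_skew_of; congr (_ + _).
apply/matrixP => a b; rewrite !mxE -!hE -!map_hankel.
transitivity (phi (p (Some None)) *
  phi (((a : nat) == 0)%:R * hankel (slice_h p) 1 b - ((b : nat) == 0)%:R * hankel (slice_h p) 1 a)).
  exact: rmorphM.
by rewrite rmorphB !rmorphM !rmorph_nat.
Qed.

Lemma map_pencil (M : 'I_4 -> 'M[A]_n) :
  map_mx (map_mpoly phi) (pencil M) = pencil (fun k => map_mx phi (M k)).
Proof.
apply/matrixP => a b; rewrite !mxE rmorph_sum; apply: eq_bigr => k _.
by rewrite /= rmorphM /= map_mpolyX map_mpolyC mxE.
Qed.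
End Map.
End Slice.

Section KrylovDef.
Variables (A : comNzRingType) (n : nat) (e f : 'cV[A]_n) (T : 'M[A]_n).

(** The basis e, f, T e, T f, T^2 e, T^2 f, .. *)
Definition krylov_vec (b : nat) : 'cV[A]_n := iter b./2 (mulmx T) (if odd b then f else e).
Definition krylov : 'M[A]_n := \matrix_(a, b) krylov_vec b a 0.
End KrylovDef.

Lemma map_krylov (A B : comNzRingType) (phi : {rmorphism A -> B}) n e f (T : 'M[A]_n) :
  map_mx phi (krylov e f T) = krylov (map_mx phi e) (map_mx phi f) (map_mx phi T).
Proof.
have vE b : map_mx phi (krylov_vec e f T b) =
    krylov_vec (map_mx phi e) (map_mx phi f) (map_mx phi T) b.
  by rewrite /krylov_vec; elim: b./2 => [|m IH] /=; rewrite -?IH ?map_mxM //; case: odd.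
by apply/matrixP => a b; rewrite [LHS]mxE [RHS]mxE -vE !mxE.
Qed.

Lemma krylov_scale (A : comNzRingType) n c (e f : 'cV[A]_n) T :
  krylov (c *: e) (c *: f) T = c *: krylov e f T.
Proof.
have vE b : krylov_vec (c *: e) (c *: f) T b = c *: krylov_vec e f T b.
  by rewrite /krylov_vec; elim: b./2 => [|m IH] /=; rewrite ?IH -?scalemxAr //; case: odd.
by apply/matrixP => a b; rewrite [LHS]mxE [RHS]mxE vE !mxE.
Qed.

Section NormalForm.
Variable k : fieldType.
Hypothesis char0 : [pchar k] =i pred0.
Variable d : nat.
Hypothesis d_gt0 : (0 < d)%N.
Local Notation n := (2 * d)%N.

Lemma eq_opp_eq0 (x : k) : x = - x -> x = 0.
Proof.
move=> e; have /eqP : x *+ 2 = 0 by rewrite mulr2n {1}e addNr.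
by rewrite -mulr_natr mulf_eq0; have /pcharf0P -> := char0; rewrite orbF => /eqP.
Qed.

Lemma skew_of_exists (X : 'M[k]_n) : (forall a b, X a b = - X b a) ->
  (forall a b : 'I_n, (a : nat) = 0%N -> X a b = 0) -> exists g, X = skew_of g.
Proof.
move=> sX X0; pose g (t : pair_ix d) := X (insubd (tag t) (tagged t).+1) (tag t).
have up (c c' : 'I_n) : (0 < c < c')%N -> upper g c c' = X c c'.
  move=> /andP [c0 cc']; rewrite /upper c0 insubT; first by lia.
  move=> lt /=; rewrite /g /=; congr (X _ _); apply: val_inj; rewrite val_insubd /= prednK //.
  by rewrite ltn_ord.
have low (c c' : 'I_n) : (c' <= c)%N -> upper g c c' = 0.
  by rewrite /upper; case: ifP => // c0 cc'; rewrite insubF //; lia.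
have low0 (c c' : 'I_n) : (c : nat) = 0%N -> upper g c c' = 0 by rewrite /upper => ->.
exists g; apply/matrixP => a b; rewrite mxE.
case: (posnP a) => a0; first by rewrite X0 // (low0 a b a0) (low b a) ?subrr // a0.
case: (posnP b) => b0; first by rewrite sX X0 // (low0 b a b0) (low a b) ?subr0 ?oppr0 // b0.
case: (ltngtP a b) => [ab|ba|/val_inj ->].
- by rewrite (up a b) ?a0 // (low b a) ?subr0 // ltnW.
- by rewrite (low a b) ?(ltnW ba) // (up b a) ?b0 // sub0r sX.
by rewrite subrr; apply: eq_opp_eq0; apply: sX.
Qed.

Section Krylov.
Variables (e f : 'cV[k]_n) (T : 'M[k]_n).

Local Notation krylov_vec := (krylov_vec e f T).
Local Notation krylov := (krylov e f T).

Lemma krylov_congr (X : 'M[k]_n) a b :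
  (krylov^T *m X *m krylov) a b = ((krylov_vec a)^T *m X *m krylov_vec b) 0 0.
Proof.
rewrite [LHS]mxE [RHS]mxE; apply: eq_bigr => j _; rewrite [krylov j b]mxE.
by congr (_ * _); rewrite [LHS]mxE [RHS]mxE; apply: eq_bigr => i _; rewrite !mxE.
Qed.

Variables (M : 'I_4 -> 'M[k]_n) (lam mu : k).
Let M0 := M ord0.
Hypothesis skewM : forall c, skew_symmetric (M c).
Hypothesis M0T : M0 *m T = T^T *m M0.
Hypothesis M1E : M (inord 1) = mu *: (M0 *m T).
Hypothesis M2e : M (inord 2) *m e = lam *: (M0 *m e).
Hypothesis M3e : M (inord 3) *m e = mu *: (M0 *m f).

Let Tn m : 'M[k]_n := iter m (mulmx T) 1%:M.

Lemma TnE m (v : 'cV[k]_n) : iter m (mulmx T) v = Tn m *m v.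
Proof. by rewrite /Tn; elim: m => [|m IH] /=; rewrite ?mul1mx // IH mulmxA. Qed.

Lemma Tn_add m m' : Tn (m + m') = Tn m *m Tn m'.
Proof. by elim: m => [|m IH]; rewrite ?mul1mx // addSn /Tn /= -/(Tn _) -/(Tn m) IH mulmxA. Qed.

Lemma M0_Tn m : M0 *m Tn m = (Tn m)^T *m M0.
Proof.
elim: m => [|m IH]; first by rewrite /Tn /= trmx1 mulmx1 mul1mx.
have TnS : Tn m.+1 = T *m Tn m by [].
have -> : Tn m.+1 = Tn m *m T by rewrite -[m.+1]addn1 Tn_add {2}/Tn /= mulmx1.
by rewrite mulmxA IH -mulmxA M0T mulmxA -trmx_mul -TnS -[m.+1]addn1 Tn_add {2}/Tn /= mulmx1.
Qed.

Let H m (x y : 'cV[k]_n) : k := (x^T *m M0 *m (Tn m *m y)) 0 0.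

(** T is self-adjoint for the alternating form M_0, so (T^m x, y) is alternating too. *)
Lemma H_swap m x y : H m x y = - H m y x.
Proof.
have sM0 : M0^T = - M0 by apply: skewM.
have tr (z : 'M[k]_1) : z 0 0 = z^T 0 0 by rewrite mxE.
rewrite /H [LHS]tr !trmx_mul trmxK sM0 mulNmx mulmxN mxE; congr (- _).
by rewrite !mulmxA -[y^T *m _ *m M0]mulmxA -M0_Tn !mulmxA.
Qed.

Lemma H_diag m x : H m x x = 0.
Proof. exact/eq_opp_eq0/H_swap. Qed.

Lemma krylov_M0 a b j :
  ((krylov_vec a)^T *m (M0 *m Tn j) *m krylov_vec b) 0 0 =
  hankel (fun m => H (m + j) e f) a b.
Proof.
rewrite /krylov_vec !TnE trmx_mul.
have -> x y : x^T *m (Tn a./2)^T *m (M0 *m Tn j) *m (Tn b./2 *m y) =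
    x^T *m M0 *m (Tn (a./2 + b./2 + j) *m y).
  rewrite addnAC !Tn_add !mulmxA; congr (_ *m _ *m _ *m _).
  by rewrite -!mulmxA M0_Tn.
rewrite -/(H _ _ _) /hankel; case: (odd a); case: (odd b); rewrite /= ?H_diag //.
  by rewrite H_swap expr1 mulN1r.
by rewrite expr0 mul1r.
Qed.

Let h m := H m e f.

Lemma krylov_M0E a b : (krylov^T *m M ord0 *m krylov) a b = hankel h a b.
Proof.
rewrite krylov_congr; have := krylov_M0 a b 0; rewrite [Tn 0]/Tn /= mulmx1 => ->.
by apply: eq_hankel => m; rewrite addn0.
Qed.

Lemma krylov_M1E a b : (krylov^T *m M (inord 1) *m krylov) a b = mu * hankel (h \o S) a b.
Proof.
have M1_ : M0 *m T = M0 *m Tn 1 by rewrite /Tn /= mulmx1.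
rewrite krylov_congr M1E M1_ -scalemxAr -scalemxAl mxE krylov_M0; congr (_ * _).
by apply: eq_hankel => m; rewrite addn1.
Qed.

Lemma krylov_row c (v : 'cV[k]_n) (a b : 'I_n) : (a : nat) = 0%N -> M c *m e = M0 *m v ->
  (krylov^T *m M c *m krylov) a b = (v^T *m M0 *m krylov_vec b) 0 0.
Proof.
move=> a0 cv; rewrite krylov_congr a0 -[M c]opprK -[M0]opprK -(skewM c) -[- M0](skewM ord0).
by rewrite !(mulNmx, mulmxN) -!trmx_mul cv.
Qed.

Lemma krylov_skew c a b : (krylov^T *m M c *m krylov) a b = - (krylov^T *m M c *m krylov) b a.
Proof.
have skQ : skew_symmetric (krylov^T *m M c *m krylov).
  by rewrite -[krylov in X in _ *m X]trmxK; apply: skew_congr.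
exact: (skewE _).1 skQ a b.
Qed.

Lemma sub_mxE (X Y : 'M[k]_n) a b : (X - Y) a b = X a b - Y a b.
Proof. by rewrite !mxE. Qed.

Lemma scale_mxE l (X : 'M[k]_n) a b : (l *: X) a b = l * X a b.
Proof. by rewrite mxE. Qed.

Lemma krylov_M2E : exists g, krylov^T *m M (inord 2) *m krylov =
  \matrix_(a, b) (lam * hankel h a b) + skew_of g.
Proof.
have [g gE] : exists g, krylov^T *m M (inord 2) *m krylov - lam *: (krylov^T *m M ord0 *m krylov) = skew_of g.
  apply: skew_of_exists => [a b|a b a0].
    rewrite !sub_mxE !scale_mxE krylov_skew [(_ *m M ord0 *m _) a b]krylov_skew.
    by rewrite mulrN opprD.
  rewrite sub_mxE scale_mxE.
  rewrite (krylov_row _ (v := lam *: e) a0) ?M2e ?scalemxAr // (krylov_row _ (v := e) a0) //.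
  by rewrite linearZ /= -!scalemxAl mxE subrr.
exists g; rewrite -gE; apply/matrixP => a b.
by rewrite [RHS]mxE [X in X + _]mxE -krylov_M0E sub_mxE scale_mxE addrC subrK.
Qed.

Lemma krylov_M3E : exists g, krylov^T *m M (inord 3) *m krylov =
  \matrix_(a, b) (mu * (((a : nat) == 0)%:R * hankel h 1 b - ((b : nat) == 0)%:R * hankel h 1 a))
  + skew_of g.
Proof.
set B := \matrix_(a, b) _.
have BE a b : B a b = mu * (((a : nat) == 0)%:R * hankel h 1 b - ((b : nat) == 0)%:R * hankel h 1 a).
  by rewrite mxE.
have [g gE] : exists g, krylov^T *m M (inord 3) *m krylov - B = skew_of g.
  apply: skew_of_exists => [a b|a b a0].
    by rewrite !sub_mxE !BE krylov_skew; ring.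
  case: (eqVneq (b : nat) 0%N) => [b0|bn0].
    have -> : b = a by apply: val_inj; rewrite /= a0 b0.
    by apply: eq_opp_eq0; rewrite !sub_mxE !BE [in LHS]krylov_skew; ring.
  rewrite sub_mxE BE.
  rewrite (krylov_row _ (v := mu *: f) a0) ?M3e ?scalemxAr //.
  have one : (1 < n)%N by lia.
  have -> : ((mu *: f)^T *m M0 *m krylov_vec b) 0 0 = mu * hankel h 1 b.
    rewrite linearZ /= -!scalemxAl mxE -(krylov_M0E (Ordinal one) b) krylov_congr.
    by rewrite /M0 /krylov_vec.
  by rewrite a0 eqxx mul1r (negbTE bn0) mul0r subr0 subrr.
exists g; rewrite -gE; apply/matrixP => a b.
by rewrite [RHS]mxE sub_mxE addrC subrK.
Qed.

(** M_0 and M_1 are Hankel because T is self-adjoint for M_0. The first rows of M_2 and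
    M_3 are their values at e, given by the hypotheses, and the rest is
    unconstrained. *)
Lemma krylov_slice : exists p, forall c, krylov^T *m M c *m krylov = slice p c.
Proof.
have [g2 g2E] := krylov_M2E; have [g3 g3E] := krylov_M3E.
pose p (x : slice_ix d) : k := match x with
  | None => lam | Some None => mu | Some (Some (inl i)) => h i
  | Some (Some (inr (inl y))) => g2 y | Some (Some (inr (inr y))) => g3 y end.
have hE m : (m < n)%N -> slice_h p m = h m by move=> lt; rewrite /slice_h insubT.
have hkE (a b : 'I_n) : hankel (slice_h p) a b = hankel h a b.
  rewrite /hankel; case: eqP => // ab; rewrite hE //.
  have := odd_double_half a; have := odd_double_half b.
  by have := ltn_ord a; have := ltn_ord b; rewrite -!muln2; lia.
have hkSE (a b : 'I_n) : hankel (slice_h p \o S) a b = hankel (h \o S) a b.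
  rewrite /hankel; case: eqP => // ab; rewrite /= hE //.
  have := odd_double_half a; have := odd_double_half b.
  have := ltn_ord a; have := ltn_ord b; rewrite -!muln2.
  by case: (odd a) ab => ab; case: (odd b) ab => //= _; lia.
have hk1E (b : 'I_n) : hankel (slice_h p) 1 b = hankel h 1 b.
  by have one : (1 < n)%N by [lia]; apply: (hkE (Ordinal one) b).
exists p => c.
have [->|[->|[->|->]]] : c = ord0 \/ c = inord 1 \/ c = inord 2 \/ c = inord 3.
  case: c => [[|[|[|[|]]]] //= lt]; [left|right;left|do 2!right;left|do 3!right];
    by apply: val_inj; rewrite //= inordK.
- by apply/matrixP => a b; rewrite krylov_M0E [RHS]mxE hkE.
- by apply/matrixP => a b; rewrite krylov_M1E /slice /= inordK // mxE hkSE.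
- rewrite g2E /slice /= inordK //; congr (_ + _).
  by apply/matrixP => a b; rewrite !mxE hkE.
rewrite g3E /slice /= inordK //; congr (_ + _).
by apply/matrixP => a b; rewrite !mxE !hk1E.
Qed.
End Krylov. End NormalForm.

(** * Linear pfaffians of degree at least 16 *)

Lemma meval_map (A B : comNzRingType) (phi : {rmorphism A -> B}) n (p : {mpoly A[n]}) v :
  (map_mpoly phi p).@[fun i => phi (v i)] = phi p.@[v].
Proof.
elim/mpolyind: p => [|c m p _ _ IH]; first by rewrite rmorph0 !meval0 rmorph0.
rewrite rmorphD /= !mevalD rmorphD IH -mul_mpolyC rmorphM /= map_mpolyC map_mpolyX.
rewrite !mevalM !mevalC rmorphM !mevalX rmorph_prod.
by congr (_ * _ + _); apply: eq_bigr => i _; rewrite rmorphXn.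
Qed.

Lemma slice_count d : (16 <= d)%N -> (2 + 2 * d + 2 * 'C((2 * d).-1, 2) < 'C(d + 3, 3))%N.
Proof.
move=> /subnK <-; move: (d - 16)%N => m.
have e1 := mul_bin_diag (m + 16 + 3) 2; have e2 := mul_bin_diag (m + 16 + 3).-1 1.
have e3 := mul_bin_diag (2 * (m + 16)).-1 1; rewrite !bin1 in e2 e3.
move: 'C(m + 16 + 3, 3) 'C((m + 16 + 3).-1, 2) 'C((2 * (m + 16)).-1, 2) e1 e2 e3 => x y z.
have -> : ((2 * (m + 16)).-1 = 2 * m + 31)%N by lia.
have -> : ((m + 16 + 3).-1 = m + 18)%N by lia.
move=> e1 e2 e3.
have e2' : (2 * y = (m + 18) * (m + 17))%N by rewrite -e2; congr (_ * _)%N; lia.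
have e1' : (6 * x = (m + 19) * ((m + 18) * (m + 17)))%N.
  rewrite -e2' -[6%N]/(2 * 3)%N -mulnA -e1; lia.
have e3' : (2 * z = (2 * m + 31) * (2 * m + 30))%N by rewrite -e3; congr (_ * _)%N; lia.
rewrite -(ltn_pmul2l (_ : 0 < 6)%N) // e1' e3'.
lia.
Qed.

Lemma exists_root_pow (k : closedFieldType) n (x : k) : (0 < n)%N -> exists c, c ^+ n = x.
Proof.
move=> n0; have [|c] := closed_rootP ('X^n - x%:P : {poly k}) _.
  by rewrite size_XnsubC // eqSS -lt0n.
by rewrite rootE !hornerE subr_eq0 => /eqP; exists c.
Qed.

Lemma exists_scale_det1 (k : closedFieldType) n (P : 'M[k]_n) : (0 < n)%N -> P \in unitmx ->
  exists2 c : k, c != 0 & \det (c *: P) = 1.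
Proof.
rewrite unitmxE unitfE => n0 P0; have [c cE] := exists_root_pow (\det P)^-1 n0.
exists c; last by rewrite detZ cE mulVf.
by apply: contraNneq P0 => c0; move: cE; rewrite c0 expr0n gtn_eqF //= => /esym/eqP; rewrite invr_eq0.
Qed.

(** A constant change of basis multiplies the pfaffian of the pencil by a scalar. *)
Lemma pf_pencil_congr (k : idomainType) (char0 : [pchar k] =i pred0) d P (M : 'I_4 -> 'M[k]_(2 * d)) :
  (forall c, skew_symmetric (M c)) ->
  pf (pencil (fun c => P *m M c *m P^T)) = \det P *: pf (pencil M).
Proof.
move=> sM; pose PC := map_mx (@mpolyC 4 k) P.
have -> : pencil (fun c => P *m M c *m P^T) = PC *m pencil M *m PC^T.
  have pE (M' : 'I_4 -> 'M[k]_(2 * d)) : pencil M' = \sum_c 'X_c *: map_mx (@mpolyC 4 k) (M' c).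
    by apply/matrixP => a b; rewrite summxE mxE; apply: eq_bigr => c _; rewrite !mxE.
  rewrite !pE mulmx_sumr mulmx_suml; apply: eq_bigr => c _.
  by rewrite -scalemxAr -scalemxAl !map_mxM map_trmx.
rewrite pf_congr.
- by rewrite det_map_mx mul_mpolyC.
- move=> p; rewrite -[RHS](char0 p) !inE; congr (_ && _).
  by rewrite -[p%:R in LHS]mpolyC_nat mpolyC_eq0.
apply/skewE => a b; rewrite !mxE -sumrN; apply: eq_bigr => c _.
by rewrite ((skewE _).1 (sM c)) rmorphN mulrN.
Qed.

Section Relation.
Variable k : closedFieldType.
Hypothesis char0 : [pchar k] =i pred0.
Variable d : nat.
Hypothesis d_ge : (16 <= d)%N.
Local Notation n := (2 * d)%N.

Definition pencil_coords (A : comNzRingType) (M : 'I_4 -> 'M[A]_n) (b : 'I_#|monomial d|) := (pf (pencil M))@_(mon b).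

Lemma map_pencil_coords (A B : comNzRingType) (phi : {rmorphism A -> B}) (M : 'I_4 -> 'M[A]_n) b :
  pencil_coords (fun c => map_mx phi (M c)) b = phi (pencil_coords M b).
Proof. by rewrite /pencil_coords -map_pencil pf_map /= mcoeff_map_mpoly. Qed.

(** There are more coefficients than parameters. *)
Lemma slice_relation : exists2 Phi : {mpoly k[#|monomial d|]}, Phi != 0 &
  forall p : slice_ix d -> k, Phi.@[pencil_coords (slice p)] = 0.
Proof.
pose N := #|{: slice_ix d}|.
have lt : (N < #|monomial d|)%N.
  apply: leq_trans (card_monomial d); by rewrite /N card_slice_ix ?slice_count //; lia.
pose p0 (x : slice_ix d) : {mpoly k[N]} := 'X_(enum_rank x).
have [Phi Phi0 PhiE] := algebraic_dependence (pencil_coords (slice p0)) lt.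
exists Phi => // p; have /(congr1 (meval (fun j => p (enum_val j)))) := PhiE.
rewrite meval0 comp_mpoly_meval => <-; apply: meval_eq => b; rewrite tnth_mktuple.
rewrite -[RHS]map_pencil_coords; congr (pencil_coords _ _); apply: functional_extensionality => c.
rewrite map_slice; congr (slice _ _); apply: functional_extensionality => x /=.
by rewrite mevalXU enum_rankK.
Qed.
End Relation.

Section Vanishing.
Variable k : closedFieldType.
Hypothesis char0 : [pchar k] =i pred0.
Variable d : nat.
Hypothesis d_gt1 : (1 < d)%N.
Local Notation n := (2 * d)%N.
Variable Phi : {mpoly k[#|monomial d|]}.
Hypothesis Phi_slice : forall p : slice_ix d -> k, Phi.@[pencil_coords (slice p)] = 0.

Local Notation skews M := (forall c, skew_symmetric (M c)).
Let vanishes (M : 'I_4 -> 'M[k]_n) := Phi.@[pencil_coords M] = 0.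

Lemma eq_vanishes (M M' : 'I_4 -> 'M[k]_n) : M =1 M' -> vanishes M -> vanishes M'.
Proof.
move=> e v; rewrite /vanishes -[RHS]v; apply: meval_eq => b; rewrite /pencil_coords.
by congr ((pf _)@__); apply/matrixP => i j; rewrite !mxE; apply: eq_bigr => c _; rewrite e.
Qed.

(** Only determinant 1 leaves the coefficients unchanged. The relation need not be
    homogeneous, so changes of basis are rescaled to this case throughout. *)
Lemma vanishes_congr (M : 'I_4 -> 'M[k]_n) P : skews M -> \det P = 1 ->
  vanishes (fun c => P *m M c *m P^T) -> vanishes M.
Proof.
move=> sM dP; rewrite /vanishes => <-; apply: meval_eq => b.
by rewrite /pencil_coords pf_pencil_congr // dP scale1r.
Qed.

Lemma vanishes_krylov (M : 'I_4 -> 'M[k]_n) (e f : 'cV[k]_n) T lam mu :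
  skews M -> M ord0 *m T = T^T *m M ord0 -> M (inord 1) = mu *: (M ord0 *m T) ->
  M (inord 2) *m e = lam *: (M ord0 *m e) -> M (inord 3) *m e = mu *: (M ord0 *m f) ->
  \det (krylov e f T) != 0 -> vanishes M.
Proof.
move=> sM M0T M1E M2e M3e dK.
have [||c c0 dc] := @exists_scale_det1 k n (krylov e f T); first by lia.
  by rewrite unitmxE unitfE.
have d0 := ltnW d_gt1.
have [||p pE] := @krylov_slice k char0 d d0 (c *: e) (c *: f) T M lam mu sM M0T M1E.
- by rewrite -!scalemxAr M2e scalerA mulrC -scalerA.
- by rewrite -!scalemxAr M3e scalerA mulrC -scalerA.
rewrite krylov_scale in pE; apply: (vanishes_congr (P := (c *: krylov e f T)^T) sM).
  by rewrite det_tr.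
by apply: eq_vanishes (Phi_slice p) => a; rewrite -pE trmxK.
Qed.

(** A polynomial in one variable that vanishes outside the zeros of [D] is 0. This
    replaces a density argument on the irreducible space of all tuples. *)
Lemma vanishes_line (M : 'I_4 -> 'M[{poly k}]_n) (D : {poly k}) : D != 0 ->
  (forall t, D.[t] != 0 -> vanishes (fun c => map_mx (horner_eval t) (M c))) ->
  forall t, vanishes (fun c => map_mx (horner_eval t) (M c)).
Proof.
move=> D0 van t; pose r := (map_mpoly polyC Phi).@[pencil_coords M].
have rE x : r.[x] = Phi.@[pencil_coords (fun c => map_mx (horner_eval x) (M c))].
  rewrite -[LHS]/(horner_eval x r) -meval_map.
  have -> : map_mpoly (horner_eval x) (map_mpoly polyC Phi) = Phi.
    by apply/mpolyP => m; rewrite !mcoeff_map_mpoly /= /horner_eval hornerC.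
  by apply: meval_eq => b; rewrite -[LHS]map_pencil_coords.
rewrite /vanishes -rE; suff -> : r = 0 by rewrite horner0.
have /eqP : r * D = 0.
  apply: (poly_eq0_of_eval char0) => x; rewrite hornerM rE.
  by have [->|/van ->] := eqVneq D.[x] 0; rewrite ?mulr0 ?mul0r.
by rewrite mulf_eq0 (negbTE D0) orbF => /eqP.
Qed.

Let line (X Y : 'M[k]_n) : 'M[{poly k}]_n := map_mx polyC X + 'X *: map_mx polyC (Y - X).

Lemma line_eval X Y t : map_mx (horner_eval t) (line X Y) = X + t *: (Y - X).
Proof. by apply/matrixP => i j; rewrite !mxE /horner_eval !hornerE. Qed.

Lemma skew_line (X Y : 'M[k]_n) t : skew_symmetric X -> skew_symmetric Y -> skew_symmetric (X + t *: (Y - X)).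
Proof. by move=> /skewE sX /skewE sY; apply/skewE => i j; rewrite !mxE sX sY; ring. Qed.

(** This matrix, [antidiag1] and [border] are chosen so that M_0 is orthogonal, M_0^T M_1 shifts
    the standard basis by two places and M_0^T M_3 maps the first basis vector to
    the second. The standard basis is then the Krylov basis up to scalars. *)
Definition antidiag : 'M[k]_n := \matrix_(a, b) ((-1) ^+ odd a * ((a + b).+1 == n)%:R).
Definition antidiag1 : 'M[k]_n := \matrix_(a, b) ((-1) ^+ odd a * ((a + b).+3 == n)%:R).
Definition border : 'M[k]_n := \matrix_(a, b)
  ((((a : nat) == n - 2)%N && ((b : nat) == 0))%:R - (((b : nat) == n - 2)%N && ((a : nat) == 0))%:R).

Lemma skew_antidiag : skew_symmetric antidiag.
Proof.
apply/skewE => a b; rewrite !mxE addnC; case: eqP => e; rewrite ?mulr0 ?oppr0 // !mulr1.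
have : odd a = ~~ odd b by lia.
by move=> ->; case: odd; rewrite ?expr0 ?expr1 ?opprK.
Qed.

Lemma skew_antidiag1 : skew_symmetric antidiag1.
Proof.
apply/skewE => a b; rewrite !mxE addnC; case: eqP => e; rewrite ?mulr0 ?oppr0 // !mulr1.
have : odd a = ~~ odd b by lia.
by move=> ->; case: odd; rewrite ?expr0 ?expr1 ?opprK.
Qed.

Lemma skew_border : skew_symmetric border.
Proof. by apply/skewE => a b; rewrite !mxE opprB. Qed.

Lemma antidiag_tr_mul (a : 'I_n) (g : nat -> bool) :
  \sum_c antidiag^T a c * ((-1) ^+ odd c * (g c)%:R) = (g (n.-1 - a)%N)%:R :> k.
Proof.
have lt : (n.-1 - a < n)%N by lia.
rewrite (bigD1 (Ordinal lt)) //= big1 ?addr0.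
  rewrite !mxE /= (_ : (_ == _) = true) ?mulr1; last by have := ltn_ord a; lia.
  by rewrite mulrA -expr2 sqrr_sign mul1r.
move=> c /eqP nc; rewrite !mxE (_ : (_ == _) = false) ?mulr0 ?mul0r //.
apply/eqP => e; apply: nc; apply: val_inj => /=; lia.
Qed.

Lemma antidiag_orthogonal : antidiag^T *m antidiag = 1%:M.
Proof.
apply/matrixP => a b; rewrite [LHS]mxE [RHS]mxE.
under eq_bigr => c _ do rewrite [antidiag c b]mxE.
rewrite (antidiag_tr_mul a (fun c => (c + b).+1 == n)); congr (_%:R); congr (nat_of_bool _).
have := ltn_ord a; have := ltn_ord b; rewrite -val_eqE /=; lia.
Qed.

Let det_antidiag_neq0 : \det antidiag != 0.
Proof.
have /(congr1 determinant) := antidiag_orthogonal; rewrite det_mulmx det1 det_tr => e.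
by apply: contraTneq (oner_neq0 k) => d0; rewrite -e d0 mul0r eqxx.
Qed.

Let adj_antidiag : \adj antidiag = \det antidiag *: antidiag^T.
Proof.
have := mulmx1C antidiag_orthogonal => e.
by rewrite -[LHS]mulmx1 -e mulmxA mul_adj_mx mul_scalar_mx.
Qed.

Section Invariants.
Variable A : comNzRingType.
Implicit Type M : 'I_4 -> 'M[A]_n.

Definition std_col (m : nat) : 'cV[A]_n := \col_i ((i : nat) == m)%:R.
Definition krylov_T M := \adj (M ord0) *m M (inord 1).
Definition krylov_f M := \adj (M ord0) *m (M (inord 3) *m std_col 0).
(** Polynomial in the entries, so that it can be followed along a line: the
    adjoint matrix replaces the inverse, which changes T and f by the factor
    det M_0. Nonvanishing means that the Krylov basis exists. *)
Definition krylov_disc M := \det (M ord0) * \det (krylov (std_col 0) (krylov_f M) (krylov_T M)).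
End Invariants.

Lemma map_krylov_disc (A B : comNzRingType) (phi : {rmorphism A -> B}) (M : 'I_4 -> 'M[A]_n) :
  phi (krylov_disc M) = krylov_disc (fun c => map_mx phi (M c)).
Proof.
have sE : map_mx phi (std_col A 0) = std_col B 0.
  by apply/colP => i; rewrite !mxE rmorph_nat.
rewrite /krylov_disc rmorphM -!det_map_mx map_krylov sE.
by rewrite /krylov_f /krylov_T !map_mxM !map_mx_adj sE.
Qed.

Definition good_tuple (N : 'M[k]_n) (c : 'I_4) : 'M[k]_n :=
  match val c with 0 => antidiag | 1 => antidiag1 | 2 => N | _ => border end.

Lemma skew_good N : skew_symmetric N -> skews (good_tuple N).
Proof.
move=> sN [[|[|[|[|]]]] //= lt]; rewrite /good_tuple /=.
- exact: skew_antidiag.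
- exact: skew_antidiag1.
exact: skew_border.
Qed.

(** One tuple with a Krylov basis, whatever [N], shows that [krylov_disc] is not
    identically 0 on the lines through it. *)
Lemma good_krylov N : krylov_disc (good_tuple N) != 0.
Proof.
set D := \det antidiag; have inS j : (j < 4)%N -> val (inord j : 'I_4) = j by move=> lt; rewrite /= inordK.
rewrite /krylov_disc mulf_neq0 //.
have TE : krylov_T (good_tuple N) = \matrix_(a, b) (D * ((a : nat) == b.+2)%:R).
  rewrite /krylov_T /good_tuple /= inordK // adj_antidiag -scalemxAl; apply/matrixP => a b.
  rewrite [LHS]mxE [RHS]mxE; congr (_ * _); rewrite mxE.
  under eq_bigr => c _ do rewrite [antidiag1 c b]mxE.
  rewrite (antidiag_tr_mul a (fun c => (c + b).+3 == n)); congr (_%:R); congr (nat_of_bool _).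
  have := ltn_ord a; have := ltn_ord b; lia.
have fE : krylov_f (good_tuple N) = D *: std_col k 1.
  rewrite /krylov_f /good_tuple /= inordK // adj_antidiag -scalemxAl; apply/colP => a.
  rewrite [LHS]mxE [RHS]mxE; congr (_ * _); rewrite mxE.
  have bE c : (border *m std_col k 0) c 0 = (-1) ^+ odd c * ((c : nat) == n - 2)%N%:R.
    have n0 : (0 < n)%N by lia.
    rewrite mxE (bigD1 (Ordinal n0)) //= big1 ?addr0; last first.
      by move=> b /eqP nb; rewrite [std_col _ _ _ _]mxE; case: eqP => [b0|]; rewrite ?mulr0 //; case: nb; apply: val_inj.
    rewrite !mxE /= eqxx mulr1 andbT (_ : (0 == n - 2)%N = false) ?subr0; last by lia.
    case: eqP => [cE|]; rewrite ?mulr0 // (_ : odd c = false) ?mulr1 //; lia.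
  under eq_bigr => c _ do rewrite bE.
  rewrite (antidiag_tr_mul a (fun c => c == n - 2)%N) mxE; congr (_%:R); congr (nat_of_bool _).
  have := ltn_ord a; lia.
have Tv m : krylov_T (good_tuple N) *m std_col k m = D *: std_col k m.+2.
  rewrite TE; apply/colP => a; rewrite [LHS]mxE [RHS]mxE [std_col _ _ _ _]mxE.
  under eq_bigr => b _ do rewrite !mxE -mulrA -natrM mulnb.
  rewrite -mulr_sumr -natr_sum; congr (_ * _%:R).
  case: (ltnP m n) => mn; last first.
    rewrite big1 => [|b _]; first by have := ltn_ord a; case: eqP => //; lia.
    by have := ltn_ord b; case: eqP => //=; case: eqP => //=; lia.
  rewrite (bigD1 (Ordinal mn)) //= eqxx andbT big1 ?addn0 // => b /eqP nb.
  by case: eqP => //= _; case: eqP => // bm; case: nb; apply: val_inj.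
have iterE j (m : nat) x : iter j (mulmx (krylov_T (good_tuple N))) (x *: std_col k m) =
    (x * D ^+ j) *: std_col k (m + 2 * j).
  elim: j => [|j IH]; first by rewrite /= expr0 mulr1 addn0.
  rewrite iterS IH -scalemxAr Tv scalerA exprSr mulrA; congr (_ *: std_col _ _); lia.
pose r := \row_(b < n) (D ^+ odd b * D ^+ b./2).
have -> : krylov (std_col k 0) (krylov_f (good_tuple N)) (krylov_T (good_tuple N)) = diag_mx r.
  apply/matrixP => a b; rewrite [LHS]mxE [RHS]mxE fE /krylov_vec.
  rewrite (_ : (if odd b then _ else _) = (D ^+ odd b) *: std_col k (odd b)); last first.
    by case: odd; rewrite ?expr1 ?expr0 ?scale1r.
  rewrite iterE (_ : (odd b + 2 * b./2)%N = b); last by rewrite [(2 * b./2)%N]mul2n odd_double_half.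
  rewrite mxE mxE mxE -val_eqE /=.
  by case: eqP => [/val_inj ->|]; rewrite ?mulr1 ?mulr0.
rewrite det_diag; apply/prodf_neq0 => b _; rewrite mxE mulf_neq0 // expf_neq0 //.
Qed.

(** Join the tuple to the good tuple with second matrix lambda M_0. The eigenvector
    condition is linear and holds at both ends, hence along the line. *)
Lemma vanishes_eigen (M : 'I_4 -> 'M[k]_n) lam : skews M ->
  M (inord 2) *m std_col k 0 = lam *: (M ord0 *m std_col k 0) -> vanishes M.
Proof.
move=> sM M2e; pose G := good_tuple (lam *: antidiag).
have sG : skews G.
  apply: skew_good; apply/skewE => a b.
  by rewrite [LHS]mxE [in RHS]mxE ((skewE _).1 skew_antidiag) mulrN.
pose L c := line (M c) (G c).
have LE t c : map_mx (horner_eval t) (L c) = M c + t *: (G c - M c) by exact: line_eval.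
suff H t : vanishes (fun c => map_mx (horner_eval t) (L c)).
  by apply: eq_vanishes (H 0) => c; rewrite LE scale0r addr0.
apply: (vanishes_line (D := krylov_disc L)).
  apply: contraTneq (good_krylov (lam *: antidiag)) => D0.
  have := map_krylov_disc (horner_eval 1) L; rewrite D0 rmorph0.
  rewrite (_ : krylov_disc (fun c => map_mx (horner_eval 1) (L c)) = krylov_disc G) => [<-|].
    by rewrite eqxx.
  by rewrite /krylov_disc /krylov_f /krylov_T !LE !scale1r !(addrC (M _)) !subrK.
move=> x; rewrite -[_.[x]]/(horner_eval x _) map_krylov_disc.
set Mx := fun c => map_mx (horner_eval x) (L c).
have sMx : skews Mx by move=> c; rewrite /Mx LE; apply: skew_line.
rewrite mulf_eq0 negb_or => /andP [d0 dK].
have M0T : Mx ord0 *m krylov_T Mx = \det (Mx ord0) *: Mx (inord 1).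
  by rewrite /krylov_T mulmxA mul_mx_adj mul_scalar_mx.
apply: (vanishes_krylov (e := std_col k 0) (f := krylov_f Mx) (T := krylov_T Mx)
  (lam := lam) (mu := (\det (Mx ord0))^-1)) => //.
- have := congr1 trmx M0T; rewrite trmx_mul [RHS]linearZ /= !sMx mulmxN scalerN.
  by move/oppr_inj => ->; rewrite M0T.
- by rewrite M0T scalerA mulVf // scale1r.
- have G2 : G (inord 2) = lam *: G ord0 by rewrite /G /good_tuple /= inordK.
  rewrite /Mx !LE G2 !mulmxDl -!scalemxAl !mulmxBl M2e -!scalemxAl.
  by rewrite -scalerBr !scalerDr !scalerA [x * _]mulrC.
by rewrite /krylov_f mulmxA mul_mx_adj mul_scalar_mx scalerA mulVf // scale1r.
Qed.

Lemma std_col_row (Q : 'M[k]_n) (i : 'I_n) : (i : nat) = 0%N -> Q^T *m std_col k 0 = (row i Q)^T.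
Proof.
move=> i0; apply/colP => a; rewrite !mxE (bigD1 i) //= !mxE i0 eqxx mulr1 big1 ?addr0 // => b /eqP nb.
by rewrite !mxE; case: eqP => [b0|]; rewrite ?mulr0 //; case: nb; apply: val_inj; rewrite /= i0.
Qed.

(** An eigenvector of M_0^-1 M_2 exists over an algebraically closed field, and a
    change of basis moves it to the first basis vector. *)
Lemma vanishes_unit (M : 'I_4 -> 'M[k]_n) : skews M -> M ord0 \in unitmx -> vanishes M.
Proof.
move=> sM uM; have n0 : (0 < n)%N by lia.
pose g := (invmx (M ord0) *m M (inord 2))^T.
have [|lam] := closed_rootP (char_poly g) _; first by rewrite size_char_poly eqSS -lt0n.
rewrite -eigenvalue_root_char => /eigenvalueP [v vg v0].
pose i0 := Ordinal n0; pose Q := row_ebase v.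
have [c c0 vE] : exists2 c : k, c != 0 & v = c *: row i0 Q.
  pose x := col_ebase v; have xE : x = (x 0 0)%:M := mx11_scalar x.
  exists (x 0 0).
    have := col_ebase_unit v; rewrite -/x unitmxE unitfE.
    by rewrite [X in \det X]xE det_scalar expr1.
  rewrite -[LHS]mulmx_ebase rank_rV v0 -/x -mulmxA [X in X *m _]xE mul_scalar_mx.
  congr (_ *: _).
  apply/rowP => j; rewrite !mxE (bigD1 i0) //= !mxE /= mul1r big1 ?addr0 // => b /eqP nb.
  rewrite !mxE /= (_ : _ && _ = false) ?mul0r //; apply/negbTE/nandP.
  by left; rewrite eq_sym; apply/eqP => b0; apply: nb; apply: val_inj.
have [s s0 ds] := exists_scale_det1 n0 (row_ebase_unit v).
pose P := s *: Q; apply: (vanishes_congr (P := P) sM ds).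
apply: (vanishes_eigen (lam := lam)) => [a|]; first exact: skew_congr.
have eE : P^T *m std_col k 0 = (s / c) *: v^T.
  by rewrite (std_col_row _ (i := i0)) // vE !linearZ /= scalerA [c * _]mulrC divfK.
have key : M (inord 2) *m v^T = lam *: (M ord0 *m v^T).
  have /(congr1 trmx) := vg; rewrite trmx_mul trmxK linearZ /= -mulmxA => /(congr1 (mulmx (M ord0))).
  by rewrite mulKVmx // -scalemxAr.
by rewrite /= -!mulmxA eE -!scalemxAr key -scalemxAr !scalerA [lam * _]mulrC.
Qed.

(** Join the tuple to one with invertible first matrix. *)
Lemma vanishes_skew (M : 'I_4 -> 'M[k]_n) : skews M -> vanishes M.
Proof.
move=> sM; pose G := good_tuple 0.
have sG : skews G by apply: skew_good; rewrite /skew_symmetric trmx0 oppr0.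
pose L c := line (M c) (G c).
have LE t c : map_mx (horner_eval t) (L c) = M c + t *: (G c - M c) by exact: line_eval.
suff H t : vanishes (fun c => map_mx (horner_eval t) (L c)).
  by apply: eq_vanishes (H 0) => c; rewrite LE scale0r addr0.
apply: (vanishes_line (D := \det (L ord0))).
  apply: contraTneq det_antidiag_neq0 => D0; have := det_map_mx (horner_eval 1) (L ord0).
  by rewrite D0 LE scale1r addrC subrK rmorph0 => ->; rewrite eqxx.
move=> x; rewrite -[_.[x]]/(horner_eval x _) -det_map_mx => dx.
apply: vanishes_unit => [c|]; first by rewrite LE; apply: skew_line.
by rewrite unitmxE unitfE.
Qed.
End Vanishing.

Lemma linear_formE (A : comNzRingType) n (p : {mpoly A[n]}) : p \is 1.-homog ->
  p = \sum_c 'X_c * (p@_U_(c))%:MP.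
Proof.
move=> /dhomogP hp; apply/mpolyP => m; rewrite raddf_sum /=.
have cE c : ('X_c * (p@_U_(c))%:MP)@_m = (U_(c)%MM == m)%:R * p@_m.
  rewrite mulrC mcoeffCM mcoeffX [RHS]mulrC; case: eqP => [<-|]; rewrite ?mulr0 //.
under eq_bigr => c _ do rewrite cE.
rewrite -mulr_suml; case: (boolP (m \in msupp p)) => [/hp /eqP|]; last first.
  by move=> /memN_msupp_eq0 ->; rewrite mulr0.
rewrite mdeg_eq1 => /existsP [c /eqP ->].
rewrite (bigD1 c) //= eqxx big1 ?addr0 ?mul1r // => e ec.
by rewrite eq_mnm1 (negbTE ec).
Qed.

(** The relation times an equation of the complement of the open set would
    vanish at all nonzero points. The factor X_b0 makes the point found nonzero. *)
Theorem not_general_linear_pfaffian (k : closedFieldType) (char0 : [pchar k] =i pred0) d :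
  (16 <= d)%N -> ~ for_general_surface (fun S : surface k d => linear_pfaffian S).
Proof.
move=> d16 [U [[G [_ GP]] [S0 /GP [g Gg gS0]] UP]].
have [Phi Phi0 PhiE] := slice_relation k d16.
have d1 : (1 < d)%N by lia.
have mon_gt0 : (0 < #|monomial d|)%N.
  by apply: leq_trans (card_monomial d); rewrite bin_gt0 leq_addl.
pose b0 := Ordinal mon_gt0.
have [|y] := @exists_mnonroot k char0 _ (Phi * g * 'X_b0).
  have g0 : g != 0 by apply: contraNneq gS0 => ->; rewrite meval0.
  by rewrite !mulf_neq0 // -msupp_eq0 msuppX.
rewrite !mevalM mevalXU !mulf_eq0 !negb_or => /andP [/andP [Phiy gy] yb].
have [S SE] := surface_of_coords yb.
have [|M [sM M1 [c c0 eqS]]] := UP S.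
  by apply/GP; exists g => //; rewrite (meval_eq (v2 := y)).
case/eqP: Phiy; pose N (a : 'I_4) : 'M[k]_(2 * d) := map_mx (mcoeff U_(a)) M.
have sN a : skew_symmetric (N a).
  by apply/skewE => i j; rewrite !mxE ((skewE _).1 sM) raddfN.
have NE : pencil N = M.
  apply/matrixP => i j; rewrite mxE [RHS]linear_formE //.
  by apply: eq_bigr => a _; rewrite mxE.
(* A scalar congruence absorbs the factor between the equation and the pfaffian. *)
have [|s sE] := @exists_root_pow k (2 * d) c; first by lia.
have sN' a : skew_symmetric (s%:M *m N a *m (s%:M)^T) by exact: skew_congr.
have <- := vanishes_skew char0 d1 PhiE sN'.
apply: meval_eq => b; rewrite /pencil_coords pf_pencil_congr // NE det_scalar sE -eqS -SE //.
Qed.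

(** * The pfaffian of a skew matrix of size 6 *)

Definition swap_nat (t : nat * nat) (i : nat) : nat :=
  if i == t.1 then t.2 else if i == t.2 then t.1 else i.

(** Permutations of six elements are given by lists of transpositions of numbers, which makes
    their action and sign computable. *)
Definition act_nat (ts : seq (nat * nat)) (i : nat) : nat := foldl (fun x t => swap_nat t x) i ts.

Definition perm_of_swaps (ts : seq (nat * nat)) : 'S_(2 * 3) :=
  \prod_(t <- ts) tperm (inord t.1 : 'I_6) (inord t.2 : 'I_6).

Definition valid_swaps (ts : seq (nat * nat)) := all (fun t => [&& t.1 < 6, t.2 < 6 & t.1 != t.2]%N) ts.

Lemma perm_of_swapsE ts (i : 'I_(2 * 3)) : valid_swaps ts -> val (perm_of_swaps ts i) = act_nat ts i.
Proof.
rewrite /perm_of_swaps; elim: ts i => [|[a b] ts IH] i /=; first by rewrite big_nil perm1.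
move=> /andP [/and3P [a6 b6 ab] vts]; rewrite big_cons permM IH //; congr (act_nat ts _).
rewrite permE /= /swap_nat /= -!val_eqE /= !inordK //.
by case: eqP => _; [|case: eqP => _]; rewrite /= ?inordK.
Qed.

Lemma sign_perm_of_swaps ts : valid_swaps ts -> odd_perm (perm_of_swaps ts) = odd (size ts).
Proof.
rewrite /perm_of_swaps; elim: ts => [|[a b] ts IH] /=; first by rewrite big_nil odd_perm1.
move=> /andP [/and3P [a6 b6 ab] vts]; rewrite big_cons odd_permM IH // odd_tperm.
by rewrite -val_eqE /= !inordK // ab addTb.
Qed.

(** The 15 perfect matchings of six elements. *)
Definition matching_swaps : seq (seq (nat * nat)) :=
  [:: [::]; [:: (3, 4)]; [:: (3, 5); (3, 4)];
      [:: (1, 2)]; [:: (1, 2); (3, 4)]; [:: (1, 2); (3, 5); (3, 4)];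
      [:: (1, 3); (1, 2)]; [:: (1, 3); (1, 2); (2, 4)]; [:: (1, 3); (1, 2); (2, 5); (2, 4)];
      [:: (1, 4); (1, 2); (2, 3)]; [:: (1, 4); (1, 2)]; [:: (1, 4); (1, 2); (3, 5)];
      [:: (1, 5); (1, 2); (2, 3); (3, 4)]; [:: (1, 5); (1, 2); (2, 4)];
      [:: (1, 5); (1, 2); (3, 4); (2, 3)]]%N.

(** Values of the permutation, to compare it with a computed list. *)
Definition code (s : 'S_(2 * 3)) : seq nat := [seq val (s i) | i <- enum 'I_(2 * 3)].

Definition code_matching (c : seq nat) : bool :=
  [&& nth 0 c 0 < nth 0 c 1, nth 0 c 2 < nth 0 c 3, nth 0 c 4 < nth 0 c 5,
      nth 0 c 0 < nth 0 c 2 & nth 0 c 2 < nth 0 c 4]%N.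

Lemma nth_code s (i : 'I_(2 * 3)) : nth 0%N (code s) i = s i.
Proof. by rewrite (nth_map i) ?size_enum_ord // nth_ord_enum. Qed.

Lemma code_inj : injective code.
Proof. by move=> s s' e; apply/permP => i; apply: val_inj; rewrite /= -!nth_code e. Qed.

Lemma code_perm s : perm_eq (code s) (iota 0 6).
Proof.
have cE : code s = map val (map s (enum 'I_(2 * 3))) by rewrite -map_comp.
apply: uniq_perm; rewrite ?iota_uniq // cE.
  by rewrite map_inj_uniq; [rewrite map_inj_uniq ?enum_uniq //; apply: perm_inj | apply: val_inj].
move=> x; rewrite mem_iota /= add0n; apply/mapP/idP => [[i _ ->]|x6]; first exact: ltn_ord i.
exists (Ordinal (x6 : x < 2 * 3)%N) => //; apply/mapP.
by exists (s^-1 (Ordinal (x6 : x < 2 * 3)%N))%g; rewrite ?mem_enum ?permKV.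
Qed.

Lemma code_matchingE s : matching_perm s = code_matching (code s).
Proof.
pose o i (lt : (i < 3)%N) := Ordinal lt.
have c0 := nth_code s (ord_even (o 0 isT)); have c1 := nth_code s (ord_odd (o 0 isT)).
have c2 := nth_code s (ord_even (o 1 isT)); have c3 := nth_code s (ord_odd (o 1 isT)).
have c4 := nth_code s (ord_even (o 2 isT)); have c5 := nth_code s (ord_odd (o 2 isT)).
rewrite /= in c0 c1 c2 c3 c4 c5.
apply/idP/idP => [/andP [/forallP m1 /forallP m2] | /and5P [h1 h2 h3 h4 h5]].
  have := m1 (o 0 isT); have := m1 (o 1 isT); have := m1 (o 2 isT).
  have /forallP/(_ (o 1 isT)) := m2 (o 0 isT); have /forallP/(_ (o 2 isT)) := m2 (o 1 isT).
  by rewrite /code_matching /= -!nth_code /= => -> -> -> -> ->.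
apply/andP; split; apply/forallP => -[i i3].
  by rewrite -!nth_code; case: i i3 => [|[|[|]]].
apply/forallP => -[j j3]; apply/implyP; rewrite -!nth_code /=.
by case: i i3 => [|[|[|]]] // _; case: j j3 => [|[|[|]]] // _ _; apply: ltn_trans h5.
Qed.

Lemma code_perm_of_swaps ts : valid_swaps ts -> code (perm_of_swaps ts) = map (act_nat ts) (iota 0 6).
Proof.
move=> vts; rewrite /code -val_enum_ord -map_comp; apply: eq_map => i.
exact: perm_of_swapsE.
Qed.

Definition matching_codes := [seq map (act_nat ts) (iota 0 6) | ts <- matching_swaps].

Lemma valid_matching_swaps : all valid_swaps matching_swaps. Proof. by []. Qed.

Lemma filter_codes : filter code_matching (permutations (iota 0 6)) =i matching_codes.
Proof. by apply: perm_mem; vm_compute. Qed.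

(** A permutation is determined by its code, and the codes of matching permutations
    are found by filtering all 720 arrangements. *)
Lemma matching_perms3 :
  perm_eq (enum [pred s : 'S_(2 * 3) | matching_perm s]) (map perm_of_swaps matching_swaps).
Proof.
have cE : map code (map perm_of_swaps matching_swaps) = matching_codes.
  rewrite -map_comp; apply/eq_in_map => ts tsin /=.
  by rewrite code_perm_of_swaps //; apply: (allP valid_matching_swaps).
apply: uniq_perm; first exact: enum_uniq.
  by apply: (map_uniq (f := code)); rewrite cE; vm_compute.
move=> s; rewrite mem_enum inE -(mem_map code_inj) cE -filter_codes mem_filter.
by rewrite code_matchingE mem_permutations code_perm andbT.
Qed.

Lemma pf6 (R : comNzRingType) (m : nat -> nat -> R) :
  pf (\matrix_(i, j < 2 * 3) m i j) = \sum_(ts <- matching_swaps)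
    (-1) ^+ odd (size ts) * (m (act_nat ts 0%N) (act_nat ts 1%N) *
      (m (act_nat ts 2%N) (act_nat ts 3%N) * m (act_nat ts 4%N) (act_nat ts 5%N))).
Proof.
transitivity (\sum_(s <- map perm_of_swaps matching_swaps) (-1) ^+ s *
  \prod_(i < 3) (\matrix_(i, j < 2 * 3) m i j) (s (ord_even i)) (s (ord_odd i))).
  by rewrite -(perm_big _ matching_perms3) big_enum.
rewrite big_map;
apply: eq_big_seq => ts tsin; have vts := allP valid_matching_swaps _ tsin.
rewrite sign_perm_of_swaps // !big_ord_recl big_ord0 mulr1 !mxE.
have pE i : (perm_of_swaps ts i : nat) = act_nat ts i := perm_of_swapsE i vts.
by rewrite !pE.
Qed.

(** * Smooth cubic surfaces *)

Section Border.
Variable R : comNzRingType.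
Variables x y : nat -> R.

(** Rows 1 to 5 form the skew matrix of linear syzygies between the five quadrics
    X_i X_j - X_0 X_1, found by linear algebra. By Buchsbaum and Eisenbud its
    4 x 4 pfaffians are these quadrics, up to sign. *)
Definition border_upper (i j : nat) : R :=
  match i, j with
  | 0, j'.+1 => y j'
  | 1, 2 => x 1%N | 1, 3 => x 3%N | 1, 5 => - x 1%N
  | 2, 4 => - x 2%N | 2, 5 => x 1%N
  | 3, 4 => - x 0%N | 3, 5 => x 0%N
  | 4, 5 => - x 0%N
  | _, _ => 0
  end.

Definition border_fun (i j : nat) : R :=
  if (i < j)%N then border_upper i j else if (j < i)%N then - border_upper j i else 0.

Definition border_mx : 'M[R]_(2 * 3) := \matrix_(i, j) border_fun i j.

Lemma border_skew : skew_symmetric border_mx.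
Proof.
by apply/matrixP => i j; rewrite !mxE /border_fun; case: ltngtP; rewrite ?opprK ?oppr0.
Qed.

Lemma pf_border_mx : pf border_mx =
    y 0%N * (x 0%N * x 2%N - x 0%N * x 1%N) + y 1%N * (x 0%N * x 3%N - x 0%N * x 1%N)
  + y 2%N * (x 1%N * x 2%N - x 0%N * x 1%N) + y 3%N * (x 1%N * x 3%N - x 0%N * x 1%N)
  + y 4%N * (x 2%N * x 3%N - x 0%N * x 1%N).
Proof. by rewrite /border_mx pf6 !big_cons big_nil /border_fun /= ?expr0 ?expr1; ring. Qed.
End Border.

Section Cubic.
Variable k : fieldType.
Implicit Types g h l : {mpoly k[4]}.

Let x (i : nat) : {mpoly k[4]} := 'X_(inord i).

Lemma homogX i : x i \is 1.-homog.
Proof. by rewrite dhomogX /= mdeg1. Qed.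

(** [g] lies in the degree 3 part of the ideal generated by the five quadrics. *)
Definition five_quadrics g := exists y : nat -> {mpoly k[4]},
  (forall i, y i \is 1.-homog) /\ g = pf (border_mx x y).

Lemma five_quadrics0 : five_quadrics 0.
Proof. by exists (fun=> 0); split=> [i|]; rewrite ?rpred0 // pf_border_mx; ring. Qed.

Lemma five_quadricsD c g h : five_quadrics g -> five_quadrics h -> five_quadrics (c *: g + h).
Proof.
move=> [y [y1 ->]] [z [z1 ->]]; exists (fun i => c *: y i + z i); split=> [i|].
  by rewrite rpredD ?rpredZ.
by rewrite !pf_border_mx -!mul_mpolyC; ring.
Qed.

Lemma five_quadrics_sum (I : Type) (r : seq I) (P : pred I) (c : I -> k) (F : I -> {mpoly k[4]}) :
  (forall i, P i -> five_quadrics (F i)) -> five_quadrics (\sum_(i <- r | P i) c i *: F i).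
Proof.
by move=> FP; elim/big_rec: _ => [|i g Pi]; [exact: five_quadrics0 | apply: five_quadricsD; apply: FP].
Qed.

Lemma five_quadrics_swap l (i j i' j' : nat) : l \is 1.-homog ->
  (i < 4 -> j < 4 -> i != j -> i' < 4 -> j' < 4 -> i' != j' ->
   five_quadrics (l * (x i * x j) - l * (x i' * x j')))%N.
Proof.
have base l' a b : l' \is 1.-homog -> (a < 4 -> b < 4 -> a != b ->
    five_quadrics (l' * (x a * x b) - l' * (x 0 * x 1)))%N.
  move=> l1; wlog ab : a b / (a < b)%N => [H a4 b4 ne|].
    have /orP [lt|lt] : (a < b)%N || (b < a)%N by rewrite -neq_ltn.
      exact: H.
    by rewrite [x a * _]mulrC; apply: H; rewrite // eq_sym.
  have unit_y t : exists y : nat -> {mpoly k[4]}, (forall i, y i \is 1.-homog) /\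
      (forall i, y i = if i == t then l' else 0).
    by exists (fun i => if i == t then l' else 0); split=> // e; case: ifP; rewrite ?rpred0.
  case: a b ab => [|[|[|[|//]]]] [|[|[|[|//]]]] //= _ _ _ _;
  [ by rewrite subrr; apply: five_quadrics0
  | have [y [y1 yE]] := unit_y 0%N | have [y [y1 yE]] := unit_y 1%N
  | have [y [y1 yE]] := unit_y 2%N | have [y [y1 yE]] := unit_y 3%N
  | have [y [y1 yE]] := unit_y 4%N ];
  by exists y; split => //; rewrite pf_border_mx !yE /=; ring.
move=> l1 i4 j4 ij i'4 j'4 ij'.
rewrite (_ : _ - _ = 1 *: (l * (x i * x j) - l * (x 0 * x 1))
  + (-1 *: (l * (x i' * x j') - l * (x 0 * x 1)) + 0)); last first.
  by rewrite scale1r scaleN1r; ring.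
by apply/five_quadricsD/five_quadricsD/five_quadrics0; apply: base.
Qed.

(** All monomials of degree 3 other than cubes are congruent modulo the five
    quadrics: in x_a x_i x_j with i and j distinct the pair i, j can be replaced
    by any other pair of distinct indices. *)
Lemma five_quadrics_monomial (a i j : nat) : (a < 4 -> i < 4 -> j < 4 -> i != j ->
  five_quadrics (x a * (x i * x j) - x 0 * (x 1 * x 2)))%N.
Proof.
have step (g1 g2 g3 : {mpoly k[4]}) : five_quadrics (g1 - g2) -> five_quadrics (g2 - g3) -> five_quadrics (g1 - g3).
  move=> h1 h2; rewrite (_ : _ - _ = 1 *: (g1 - g2) + (g2 - g3)); last by rewrite scale1r; ring.
  exact: five_quadricsD.
move=> a4 i4 j4 ij; case: a a4 => [|[|[|[|//]]]] _.
- by apply: five_quadrics_swap; rewrite ?homogX.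
- rewrite [x 0 * _](_ : _ = x 1 * (x 0 * x 2)); last ring.
  by apply: five_quadrics_swap; rewrite ?homogX.
- rewrite [x 0 * _](_ : _ = x 2 * (x 0 * x 1)); last ring.
  by apply: five_quadrics_swap; rewrite ?homogX.
apply: (step _ (x 3 * (x 0 * x 1))); first by apply: five_quadrics_swap; rewrite ?homogX.
rewrite [x 3 * _](_ : _ = x 0 * (x 1 * x 3)); last ring.
by apply: five_quadrics_swap; rewrite ?homogX.
Qed.

Lemma mnm_split n e (m : 'X_{1..n}) : mdeg m = e.+1 ->
  exists a (m' : 'X_{1..n}), m = (U_(a) + m')%MM /\ mdeg m' = e.
Proof.
move=> dm; have [a ma] : exists a, m a != 0%N.
  apply/existsP; apply: contra_eqT dm => /existsPn m0.
  by rewrite mdegE big1 // => i _; apply/eqP/negPn/m0.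
have le : (U_(a) <= m)%MM by rewrite lep1mP.
exists a, (m - U_(a))%MM; have mE := submK le; split; first by rewrite addmC mE.
by move: dm; rewrite -{1}mE mdegD mdeg1 addn1 => -[].
Qed.

(** A monomial of degree 3 other than a cube contains two distinct variables. *)
Lemma mnm_deg3 (m : 'X_{1..4}) : mdeg m = 3%N -> (forall a, m != (U_(a) *+ 3)%MM) ->
  exists a i j : 'I_4, m = (U_(a) + (U_(i) + U_(j)))%MM /\ i != j.
Proof.
move=> /mnm_split [a [m1 [-> /mnm_split [i [m2 [-> /eqP]]]]]].
rewrite mdeg_eq1 => /existsP [j /eqP ->] ncube.
case: (eqVneq i j) => [ij|ij]; last by exists a, i, j.
subst j.
exists i, a, i; split; first by rewrite !addmA [(U_(a) + _)%MM]addmC.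
by apply: contraNneq (ncube i) => ->; apply/eqP/mnmP => l; rewrite [RHS]mulmnE !mnmDE; lia.
Qed.

(** Vanishing at the vertices removes the cubes, and vanishing at (1,1,1,1) says
    that the coefficients add up to 0. So g is a combination of differences of
    the remaining monomials. *)
Lemma cubic_five_quadrics g : g \is 3.-homog -> (forall a : 'I_4, g.@[fun i => (i == a)%:R] = 0) ->
  g.@[fun=> 1] = 0 -> five_quadrics g.
Proof.
move=> g3 ge; rewrite mevalE => g1; have /dhomogP gh := g3.
have sum0 : \sum_(m <- msupp g) g@_m = 0.
  rewrite -[RHS]g1; apply: eq_bigr => m _; rewrite big1 ?mulr1 // => i _; exact: expr1n.
have -> : g = \sum_(m <- msupp g) g@_m *: ('X_[m] - x 0 * (x 1 * x 2)).
  under eq_bigr => m _ do rewrite scalerBr.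
  by rewrite sumrB -mpolyE -scaler_suml sum0 scale0r subr0.
rewrite big_seq; apply: five_quadrics_sum => m mg.
have [|a [i [j [-> ij]]]] := mnm_deg3 (gh _ mg).
  by move=> a; apply: contraTneq mg => ->; rewrite -mcoeff_eq0 -meval_vertex // ge.
rewrite !mpolyXD -[a]inord_val -[i]inord_val -[j]inord_val.
by apply: five_quadrics_monomial.
Qed.
End Cubic.

Section Points.
Variable k : closedFieldType.
Hypothesis char0 : [pchar k] =i pred0.

Lemma horner_meval n (f : {mpoly k[n]}) (v : 'I_n -> {poly k}) t :
  (map_mpoly polyC f).@[v].[t] = f.@[fun i => (v i).[t]].
Proof.
rewrite -[LHS]/(horner_eval t _) -meval_map.
by congr (meval _ _); apply/mpolyP => m; rewrite !mcoeff_map_mpoly /= /horner_eval hornerC.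
Qed.

(** On the affine line a + t b the form is a polynomial in t with leading
    coefficient f(b), but this coefficient need not be extracted: if the polynomial were
    constant, f (t a + b) would be a multiple of t^d, so it would vanish at t = 0. *)
Lemma root_on_line n d (f : {mpoly k[n]}) (a b : 'I_n -> k) : f \is d.-homog -> (0 < d)%N ->
  f.@[b] != 0 -> exists t, f.@[fun i => a i + t * b i] = 0.
Proof.
move=> fh d0 fb; pose q := (map_mpoly polyC f).@[fun i => (a i)%:P + 'X * (b i)%:P].
have qE t : q.[t] = f.@[fun i => a i + t * b i].
  by rewrite horner_meval; apply: meval_eq => i; rewrite !hornerE.
have [/closed_rootP [t /rootP]|] := boolP (size q != 1%N).
  by rewrite qE => qt; exists t.
rewrite negbK => /size_poly1P [c c0 qc].
pose r := (map_mpoly polyC f).@[fun i => 'X * (a i)%:P + (b i)%:P].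
have rE t : r.[t] = f.@[fun i => t * a i + b i].
  by rewrite horner_meval; apply: meval_eq => i; rewrite !hornerE.
have /eqP : (r - c *: 'X^d) * 'X = 0.
  apply: (poly_eq0_of_eval char0) => t; rewrite hornerM hornerX.
  have [->|t0] := eqVneq t 0; first by rewrite mulr0.
  rewrite hornerD hornerN hornerZ hornerXn rE.
  rewrite (meval_eq (v2 := fun i => t * (a i + t^-1 * b i))) => [|i]; last first.
    by rewrite mulrDr mulrA mulfV // mul1r.
  by rewrite (meval_scale _ _ fh) -qE qc hornerC [t ^+ d * c]mulrC subrr mul0r.
rewrite mulf_eq0 polyX_eq0 orbF subr_eq0 => /eqP rc.
case/eqP: fb; have := rE 0; rewrite rc hornerZ hornerXn expr0n gtn_eqF // mulr0 => ->.
by apply: meval_eq => i; rewrite mul0r add0r.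
Qed.

Definition lin n (l v : 'I_n -> k) := \sum_j l j * v j.

Lemma lin_comb n (l a b : 'I_n -> k) s t :
  lin l (fun i => s * a i + t * b i) = s * lin l a + t * lin l b.
Proof. by rewrite /lin !mulr_sumr -big_split; apply: eq_bigr => i _ /=; ring. Qed.

(** Choose b off all the planes and f = 0, then a such that f does not vanish at
    the points where the line through a and b meets the planes, that is at
    l_i(b) a - l_i(a) b. Every zero of f on this line is off the planes. *)
Lemma zero_off_planes n d (f : {mpoly k[n]}) (I : finType) (l : I -> 'I_n -> k) :
  f \is d.-homog -> (0 < d)%N -> f != 0 -> (forall i, exists j, l i j != 0) ->
  (forall i, exists2 a, lin (l i) a = 0 & f.@[a] != 0) ->
  exists2 p, f.@[p] = 0 & forall i, lin (l i) p != 0.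
Proof.
move=> fh d0 f0 l0 fl; pose L i : {mpoly k[n]} := \sum_j l i j *: 'X_j.
have LE i v : (L i).@[v] = lin (l i) v.
  by rewrite raddf_sum; apply: eq_bigr => j _; rewrite /= mevalZ mevalXU.
have [|b] := @exists_mnonroot k char0 n (f * \prod_i L i).
  rewrite mulf_neq0 //; apply/prodf_neq0 => i _; have [j lj] := l0 i.
  apply: contraNneq lj => Li0; have := LE i (fun j' => (j' == j)%:R).
  rewrite Li0 meval0 /lin (bigD1 j) //= eqxx mulr1 big1 ?addr0 => [<- //|j' /negbTE ->].
  by rewrite mulr0.
rewrite mevalM mulf_eq0 negb_or rmorph_prod => /andP [fb /prodf_neq0 /= Lb].
have {}Lb i : lin (l i) b != 0 by rewrite -LE; apply: Lb.
pose F i := f \mPo [tuple lin (l i) b *: 'X_j - b j *: L i | j < n].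
have FE i v : (F i).@[v] = f.@[fun j => lin (l i) b * v j - b j * lin (l i) v].
  rewrite comp_mpoly_meval; apply: meval_eq => j.
  by rewrite tnth_mktuple mevalB !mevalZ mevalXU LE.
have [|a] := @exists_mnonroot k char0 n (\prod_i F i).
  apply/prodf_neq0 => i _; have [a la fa] := fl i.
  apply: contraNneq fa => Fi0; have := FE i a; rewrite Fi0 meval0 la.
  rewrite (meval_eq (v2 := fun j => lin (l i) b * a j)) => [|j]; last by rewrite mulr0 subr0.
  by rewrite (meval_scale _ _ fh) => /esym/eqP; rewrite mulf_eq0 expf_eq0 (negbTE (Lb i)) andbF.
rewrite rmorph_prod => /prodf_neq0 /= Fa; have [t ft] := root_on_line a fh d0 fb.
exists (fun i => a i + t * b i) => // i; apply: contraNneq (Fa i isT).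
rewrite (_ : lin _ _ = lin (l i) (fun i => 1 * a i + t * b i)); last first.
  by apply: eq_bigr => j _; rewrite mul1r.
rewrite lin_comb mul1r => /eqP; rewrite addr_eq0 => /eqP la; rewrite FE la.
rewrite (meval_eq (v2 := fun j => lin (l i) b * (a j + t * b j))) => [|j]; last by ring.
by rewrite (meval_scale _ _ fh) ft mulr0.
Qed.
End Points.

Lemma mderiv_dhomog (R : nzRingType) n d (f : {mpoly R[n]}) i :
  f \is d.+1.-homog -> f^`M(i) \is d.-homog.
Proof.
move=> /dhomogP fh; apply/dhomogP => m; rewrite mcoeff_msupp mcoeff_deriv => fm.
have : (m + U_(i))%MM \in msupp f.
  by rewrite mcoeff_msupp; apply: contraNneq fm => ->; rewrite mul0rn.
by move=> /fh; rewrite /= mdegD mdeg1 addn1 => -[].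
Qed.

Section Smooth.
Variable k : closedFieldType.
Hypothesis char0 : [pchar k] =i pred0.
Variable f : {mpoly k[4]}.
Hypothesis f3 : f \is 3.-homog.
Hypothesis f_smooth : forall x : 'I_4 -> k, (exists i, x i != 0) -> f.@[x] = 0 ->
  exists i, f^`M(i).@[x] != 0.

(** If f vanishes on a plane, so do its derivatives along the plane. *)
Lemma directional_deriv (l a v : 'I_4 -> k) :
  (forall b, lin l b = 0 -> f.@[b] = 0) -> lin l a = 0 -> lin l v = 0 ->
  \sum_i f^`M(i).@[a] * v i = 0.
Proof.
move=> fl la lv; pose t i : {mpoly k[1]} := (a i)%:MP + v i *: 'X_ord0.
have tE i x : (t i).@[x] = a i + x ord0 * v i.
  by rewrite mevalD mevalC mevalZ mevalXU mulrC.
have ft : f \mPo (mktuple t) = 0.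
  apply/eqP/negPn/negP => /(exists_mnonroot char0) [x]; rewrite comp_mpoly_meval.
  rewrite (meval_eq (v2 := fun i => 1 * a i + x ord0 * v i)) => [|i]; last first.
    by rewrite tnth_mktuple tE mul1r.
  by rewrite fl ?eqxx // lin_comb la lv !mulr0 addr0.
have subUU : (U_(ord0) - U_(ord0) = 0 :> 'X_{1..1})%MM.
  by apply/mnmP => i; rewrite mnmBE subnn mnm0E.
have /(congr1 (meval (fun=> 0))) := mderiv_comp t f ord0.
rewrite ft raddf0 meval0 (raddf_sum (meval _)) => e; rewrite [RHS]e; apply: eq_bigr => i _ /=.
rewrite mevalM comp_mpoly_meval; congr (_ * _).
  by apply: meval_eq => j; rewrite tnth_mktuple tE mul0r addr0.
by rewrite mderivD mderivC add0r mderivZ mderivX mevalZ /= mnm1E eqxx subUU mpolyX0 scale1r meval1 mulr1.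
Qed.

(** Otherwise the gradient of f is proportional to l along the plane l = 0, with a
    quadratic factor, which has a zero in the plane. The surface is singular there. *)
Lemma smooth_plane_section (l : 'I_4 -> k) j : l j != 0 -> exists2 a, lin l a = 0 & f.@[a] != 0.
Proof.
move=> lj; apply: NNPP => none.
have fl b : lin l b = 0 -> f.@[b] = 0.
  by move=> lb; apply/eqP/negPn/negP => fb; apply: none; exists b.
(* These vectors span the plane l = 0. *)
pose v i : 'I_4 -> k := fun j' => (j' == i)%:R - l i / l j * (j' == j)%:R.
have dE (u : 'I_4 -> k) i : \sum_j' u j' * (j' == i)%:R = u i.
  rewrite (bigD1 i) //= eqxx mulr1 big1 ?addr0 // => j' /negbTE ->; exact: mulr0.
have uv (u : 'I_4 -> k) i : \sum_j' u j' * v i j' = u i - l i / l j * u j.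
  rewrite -[u i]dE -[u j]dE mulr_sumr -sumrB; apply: eq_bigr => j' _; rewrite /v; ring.
have lv i : lin l (v i) = 0 by rewrite /lin uv divfK // subrr.
have part a i : lin l a = 0 -> f^`M(i).@[a] = l i / l j * f^`M(j).@[a].
  move=> la; have := directional_deriv fl la (lv i).
  by rewrite (uv (fun i' => f^`M(i').@[a])) => /eqP; rewrite subr_eq0 => /eqP.
have [a [a0 la Da]] : exists a, [/\ exists i, a i != 0, lin l a = 0 & f^`M(j).@[a] = 0].
  pose i1 := lift j (ord0 : 'I_3); pose i2 := lift j (lift ord0 ord0 : 'I_3).
  have i12 : (i1 == i2) = false by apply/negbTE; rewrite (inj_eq (@lift_inj _ j)).
  have i1j : (i1 == j) = false by rewrite eq_sym (negbTE (neq_lift _ _)).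
  have i2j : (i2 == j) = false by rewrite eq_sym (negbTE (neq_lift _ _)).
  have [D2|D2] := eqVneq (f^`M(j).@[v i2]) 0.
    exists (v i2); split => //; exists i2.
    by rewrite /v eqxx i2j mulr0 subr0 oner_neq0.
  have [t Dt] := root_on_line char0 (v i1) (mderiv_dhomog j f3) isT D2.
  exists (fun i => v i1 i + t * v i2 i); split => //.
    by exists i1; rewrite /v eqxx i12 i1j !mulr0 !subr0 mulr0 addr0 oner_neq0.
  rewrite (_ : lin _ _ = lin l (fun i => 1 * v i1 i + t * v i2 i)).
    by rewrite lin_comb !lv !mulr0 addr0.
  by apply: eq_bigr => i _; rewrite mul1r.
have [i] := f_smooth a0 (fl _ la).
by rewrite part // Da mulr0 eqxx.
Qed.

Hypothesis f_neq0 : f != 0.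

(** Replace the rows of an invertible matrix one after the other by points of the
    surface outside the plane spanned by the other rows. *)
Lemma zero_basis (m : nat) : exists2 X : 'M[k]_4, X \in unitmx &
  forall i : 'I_4, (i < m)%N -> f.@[X i] = 0.
Proof.
elim: m => [|m [X uX fX]]; first by exists 1%:M; rewrite ?unitmx1.
case: (ltnP m 4) => [m4|m4]; last by exists X => // i _; apply: fX; apply: leq_trans m4.
pose r := Ordinal m4; pose l (_ : unit) j := cofactor X r j.
have lX : lin (l tt) (X r) = \det X.
  by rewrite (expand_det_row X r); apply: eq_bigr => j _; rewrite mulrC.
have [j lj] : exists j, l tt j != 0.
  apply/existsP; apply: contraTT uX => /existsPn l0; rewrite unitmxE unitfE -lX.
  by rewrite /lin big1 ?eqxx // => j _; rewrite (eqP (negPn (l0 j))) mul0r.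
have [[]||p fp lp] := zero_off_planes char0 (l := l) f3 isT f_neq0; first by exists j.
  by case; apply: smooth_plane_section lj.
pose Y := \matrix_(i, j) if i == r then p j else X i j.
exists Y => [|i]; last first.
  rewrite ltnS leq_eqVlt => im.
  case: (eqVneq i r) => [->|ir]; first by rewrite -[RHS]fp; apply: meval_eq => j'; rewrite mxE eqxx.
  rewrite -[RHS](fX i); last by case/orP: im => // /eqP im; case/eqP: ir; apply: val_inj.
  by apply: meval_eq => j'; rewrite mxE (negbTE ir).
rewrite unitmxE unitfE (expand_det_row Y r); apply: contraNneq (lp tt) => <-.
apply/eqP/eq_bigr => j' _; rewrite [Y r j']mxE eqxx mulrC; congr (_ * _).
rewrite /l /cofactor; congr (_ * \det _); apply/matrixP => a b.
by rewrite !mxE eq_sym (negbTE (neq_lift _ _)).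
Qed.

(** Take a fifth point off the coordinate planes of a basis on the surface and
    rescale the basis so that this point becomes the sum of its vectors. *)
Lemma five_points : exists2 Q : 'M[k]_4, Q \in unitmx &
  (forall i, f.@[Q i] = 0) /\ f.@[fun j => \sum_i Q i j] = 0.
Proof.
have [X uX fX] := zero_basis 4; pose l i j := invmx X j i.
have l0 i : exists j, l i j != 0.
  apply/existsP; apply: contraT => /existsPn l0; case/eqP: (oner_neq0 k).
  have /matrixP/(_ i i) := mulmxV uX; rewrite [RHS]mxE eqxx [LHS]mxE => e.
  by apply: etrans (esym e) _; rewrite big1 // => j _; rewrite [invmx X j i](eqP (negPn (l0 j))) mulr0.
have [|p fp lp] := zero_off_planes char0 (l := l) f3 isT f_neq0 l0.
  by move=> i; have [j] := l0 i; apply: smooth_plane_section.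
pose c := \row_i lin (l i) p.
exists (diag_mx c *m X).
  rewrite unitmx_mul uX andbT unitmxE unitfE det_diag.
  by apply/prodf_neq0 => i _; rewrite mxE.
have QE i j : (diag_mx c *m X) i j = c 0 i * X i j by rewrite mul_diag_mx mxE.
split=> [i|].
  rewrite (meval_eq (v2 := fun j => c 0 i * X i j)) // (meval_scale _ _ f3) fX ?mulr0 //.
rewrite -[RHS]fp; apply: meval_eq => j.
have := congr1 (fun Z : 'M_4 => ((\row_j p j) *m Z) 0 j) (mulVmx uX).
rewrite mulmxA mulmx1 !mxE => <-; apply: eq_bigr => i _; rewrite QE !mxE; congr (_ * _).
by apply: eq_bigr => j' _; rewrite mxE mulrC.
Qed.
End Smooth.

Lemma comp_dhomog (R : comNzRingType) n m d (f : {mpoly R[n]}) (t : n.-tuple {mpoly R[m]}) :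
  (forall i, tnth t i \is 1.-homog) -> f \is d.-homog -> f \mPo t \is d.-homog.
Proof.
move=> t1 /dhomogP fh; rewrite comp_mpolyE big_seq; apply: rpred_sum => x xf; apply: rpredZ.
have /= <- := fh x xf; rewrite [mdeg x]mdegE; elim/big_rec2: _ => [|i e p _ ph]; first exact: dhomog1.
apply: dhomogM => //; have := dhomogMn (x i) (t1 i).
by rewrite mul1n.
Qed.

Section LinearChange.
Variables (k : fieldType) (n : nat).

Definition change (Q : 'M[k]_n) : n.-tuple {mpoly k[n]} := [tuple \sum_i Q i j *: 'X_i | j < n].

Lemma change_linear Q i : tnth (change Q) i \is 1.-homog.
Proof.
by rewrite tnth_mktuple; apply: rpred_sum => j _; apply: rpredZ; rewrite dhomogX /= mdeg1.
Qed.

Lemma change_meval Q (f : {mpoly k[n]}) v :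
  (f \mPo change Q).@[v] = f.@[fun j => \sum_i v i * Q i j].
Proof.
rewrite comp_mpoly_meval; apply: meval_eq => j; rewrite tnth_mktuple raddf_sum.
by apply: eq_bigr => i _; rewrite /= mevalZ mevalXU mulrC.
Qed.

(** Polynomials over an infinite field are determined by their values. *)
Lemma changeK (char0 : [pchar k] =i pred0) Q (f : {mpoly k[n]}) : Q \in unitmx ->
  (f \mPo change Q) \mPo change (invmx Q) = f.
Proof.
move=> uQ; apply/eqP; rewrite -subr_eq0; apply/negPn/negP => /(exists_mnonroot char0) [v].
rewrite mevalB !change_meval subr_eq0 => /eqP; apply; apply: meval_eq => j.
have /matrixP/(_ ord0 j) := mulmxKV uQ (\row_i v i); rewrite [RHS]mxE [LHS]mxE => e.
rewrite -[RHS]e; apply: eq_bigr => i _; congr (_ * _); rewrite mxE.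
by apply: eq_bigr => i' _; rewrite mxE.
Qed.
End LinearChange.

(** After a linear change of coordinates the surface passes through the five
    standard points. *)
Theorem smooth_cubic_linear_pfaffian (k : closedFieldType) (char0 : [pchar k] =i pred0)
  (S : surface k 3) : smooth S -> linear_pfaffian S.
Proof.
move=> sm; set f := equation S; have f3 : f \is 3.-homog by apply: (valP (surface_form S)).
have f0 : f != 0 by apply: (surface_form_neq0 S).
have [Q uQ [fQ fQ1]] := five_points char0 f3 sm f0.
have [|||y [y1 gE]] := @cubic_five_quadrics k (f \mPo change Q).
- exact: comp_dhomog (change_linear Q) f3.
- move=> a; rewrite change_meval -[RHS](fQ a); apply: meval_eq => j.
  by rewrite (bigD1 a) //= eqxx mul1r big1 ?addr0 // => i /negbTE ->; rewrite mul0r.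
- by rewrite change_meval -[RHS]fQ1; apply: meval_eq => j; apply: eq_bigr => i _; rewrite mul1r.
set B := border_mx _ y in gE.
have BE i j : B i j \is 1.-homog.
  rewrite mxE /border_fun; case: ltngtP => _; rewrite ?rpredN ?rpred0 //.
    by case: (i : nat) (j : nat) => [|[|[|[|[|?]]]]] [|[|[|[|[|[|?]]]]]] /=; rewrite ?rpredN ?rpred0 ?homogX.
  by case: (i : nat) (j : nat) => [|[|[|[|[|[|?]]]]]] [|[|[|[|[|?]]]]] /=; rewrite ?rpredN ?rpred0 ?homogX.
exists (map_mx (comp_mpoly (change (invmx Q))) B); split.
- by apply/skewE => i j; rewrite [LHS]mxE [X in _ = - X]mxE ((skewE B).1 (border_skew _ _) i j) raddfN.
- by move=> i j; rewrite mxE; apply: comp_dhomog (BE i j); apply: change_linear.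
exists 1; first exact: oner_neq0.
by rewrite scale1r pf_map /= -gE changeK.
Qed.

(** * Conclusion *)

Lemma check_le15 d : (0 < d <= 15)%N -> check d.
Proof.
have: all check (iota 1 15) by vm_compute.
by move=> /allP all_ok dle; apply: all_ok; rewrite mem_iota.
Qed.

Theorem proposition7p6 (k : closedFieldType) (char0 : [pchar k] =i pred0) :
  (forall S : surface k 3, smooth S -> linear_pfaffian S) /\
  (forall d : nat, (1 <= d)%N ->
     (for_general_surface (fun S : surface k d => linear_pfaffian S)
      <-> (d <= 15)%N)).
Proof.
split=> [S|d d1]; first exact: smooth_cubic_linear_pfaffian.
split=> [gen|d15]; last by apply: general_linear_pfaffian; rewrite ?check_le15 ?d1.
by rewrite leqNgt; apply/negP => /(not_general_linear_pfaffian char0).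
Qed.
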